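(* Let $r\ge2$, and let $\boldsymbol g_{2r-1}(\tau)=(g_1(\tau),\ldots,g_{2r-1}(\tau))^T$ and $\boldsymbol g_{2r-1}^\vee(\tau)=(g_1^\vee(\tau),\ldots,g_{2r-1}^\vee(\tau))^T$, with $g_j,g_j^\vee$ as defined in the context. Then for $\tau\in\mathbb{H}$, $$\boldsymbol g_{2r-1}\Big(-\frac1{2\tau}\Big)=2S\,\boldsymbol g_{2r-1}^\vee(\tau),\qquad \boldsymbol g_{2r-1}^\vee\Big(-\frac1{2\tau}\Big)=S\,\boldsymbol g_{2r-1}(\tau),$$ where $S=(s_{j,k})_{(2r-1)\times(2r-1)}$ with $s_{j,k}=\sqrt{\frac2{4r-1}}\cos\frac{(2j-1)(2k-1)\pi}{2(4r-1)}$.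
   Context: Notation: $\tau\in\mathbb{H}$ (upper half-plane), $q=e^{2\pi i\tau}$, $q^x=e^{2\pi ix\tau}$ for rational $x$; $(a;p)_\infty=\prod_{n\ge0}(1-ap^n)$, $(a_1,\ldots,a_k;p)_\infty=\prod_i(a_i;p)_\infty$ for $|p|<1$. For $1\le j\le 2r-1$, the functions $g_j,g_j^\vee$ on $\mathbb{H}$ are defined by $$g_j(\tau)=q^{\frac{(4r-4j+1)^2}{32r-8}}\left(q^{\frac{2j-r-1}2}\frac{(q^{8r-4j},q^{8r+4j-4},q^{16r-4};q^{16r-4})_\infty}{(q,q^3,q^4;q^4)_\infty}+\frac{(-q^{2j-1},q^{4r-2j},-q^{4r-1};-q^{4r-1})_\infty}{(q^2,q^2,q^4;q^4)_\infty}\right),$$ $$g_j^\vee(2\tau)=\frac12q^{\frac{2j^2-2j-2r+1}{16r-4}}\left(\frac{(q^{2r-j},q^{2r+j-1},q^{4r-1};q^{4r-1})_\infty}{(q,q^3,q^4;q^4)_\infty}+(-1)^{\frac{j(j-1)}2}\frac{((-q)^{2r-j},(-q)^{2r+j-1},-q^{4r-1};-q^{4r-1})_\infty}{(-q,-q^3,q^4;q^4)_\infty}\right).$$ *)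

(* Defs.v *)
From Stdlib Require Import Reals List.
From Coquelicot Require Import Coquelicot.
Import ListNotations.
Open Scope R_scope.

Definition Cexp (z : C) : C :=
  (exp (Re z) * cos (Im z), exp (Re z) * sin (Im z)).

(* q^x = e^(2 pi i x tau), for a real exponent x. *)
Definition qpow (tau : C) (x : R) : C :=
  Cexp (RtoC (2 * PI * x) * Ci * tau)%C.

(* [Lim_seq] is total, so the value is meaningful only when both real limits
   exist and are finite; see [Clim_seq_correct]. *)
Definition Clim_seq (u : nat -> C) : C :=
  (real (Lim_seq (fun n => Re (u n))), real (Lim_seq (fun n => Im (u n)))).

Lemma Clim_seq_correct (u : nat -> C) (l : C) :
  filterlim u eventually (locally l) -> Clim_seq u = l.
Proof.
  intros H.
  assert (Hre : is_lim_seq (fun n => Re (u n)) (Re l)).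
  { apply is_lim_seq_spec; intros eps.
    apply (H (fun z => Rabs (Re z - Re l) < eps)).
    exists eps; intros y [Hy _]; exact Hy. }
  assert (Him : is_lim_seq (fun n => Im (u n)) (Im l)).
  { apply is_lim_seq_spec; intros eps.
    apply (H (fun z => Rabs (Im z - Im l) < eps)).
    exists eps; intros y [_ Hy]; exact Hy. }
  unfold Clim_seq.
  rewrite (is_lim_seq_unique _ _ Hre), (is_lim_seq_unique _ _ Him).
  symmetry; apply surjective_pairing.
Qed.

(* (a; p)_n, the product of the first n factors. *)
Fixpoint qpoch_fin (a p : C) (n : nat) : C :=
  match n with
  | O => 1%C
  | S m => (qpoch_fin a p m * (1 - a * p ^ m))%C
  end.

(* (a; p)_oo; the product converges for |p| < 1. *)
Definition qpoch (a p : C) : C := Clim_seq (qpoch_fin a p).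

(* (a_1, ..., a_k; p)_oo *)
Definition qpochs (l : list C) (p : C) : C :=
  fold_right (fun a x => (qpoch a p * x)%C) 1%C l.

(* Exponents of type [nat] use truncated subtraction, which never truncates
   in the range 1 <= j <= 2r-1 considered here; the exponents that can be
   negative or fractional are real and go through [qpow]. *)
Definition g (r j : nat) (tau : C) : C :=
  let q := qpow tau 1 in
  (qpow tau ((4 * INR r - 4 * INR j + 1) ^ 2 / (32 * INR r - 8)) *
   (qpow tau ((2 * INR j - INR r - 1) / 2) *
      (qpochs [q ^ (8 * r - 4 * j); q ^ (8 * r + 4 * j - 4); q ^ (16 * r - 4)]
              (q ^ (16 * r - 4))
       / qpochs [q; q ^ 3; q ^ 4] (q ^ 4))
    + qpochs [- q ^ (2 * j - 1); q ^ (4 * r - 2 * j); - q ^ (4 * r - 1)]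
             (- q ^ (4 * r - 1))
      / qpochs [q ^ 2; q ^ 2; q ^ 4] (q ^ 4)))%C.

(* The value g_j^\vee(2 tau) as a function of tau. *)
Definition gvee_double (r j : nat) (tau : C) : C :=
  let q := qpow tau 1 in
  (1 / 2 *
   qpow tau ((2 * INR j ^ 2 - 2 * INR j - 2 * INR r + 1) / (16 * INR r - 4)) *
   (qpochs [q ^ (2 * r - j); q ^ (2 * r + j - 1); q ^ (4 * r - 1)]
           (q ^ (4 * r - 1))
      / qpochs [q; q ^ 3; q ^ 4] (q ^ 4)
    + (- (1)) ^ (j * (j - 1) / 2) *
      (qpochs [(- q) ^ (2 * r - j); (- q) ^ (2 * r + j - 1); - q ^ (4 * r - 1)]
              (- q ^ (4 * r - 1))
       / qpochs [- q; - q ^ 3; q ^ 4] (q ^ 4))))%C.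

Definition gvee (r j : nat) (tau : C) : C := gvee_double r j (tau / 2)%C.

(* Matrix entries are indexed from 0, so the entry of index i belongs to
   j = i + 1. *)
Definition gvec (r : nat) (tau : C) : @matrix C (2 * r - 1) 1 :=
  mk_matrix (2 * r - 1) 1 (fun i _ => g r (i + 1) tau).

Definition gveevec (r : nat) (tau : C) : @matrix C (2 * r - 1) 1 :=
  mk_matrix (2 * r - 1) 1 (fun i _ => gvee r (i + 1) tau).

Definition s_coef (r j k : nat) : R :=
  sqrt (2 / (4 * INR r - 1)) *
  cos ((2 * INR j - 1) * (2 * INR k - 1) * PI / (2 * (4 * INR r - 1))).

Definition Smat (r : nat) : @matrix C (2 * r - 1) (2 * r - 1) :=
  mk_matrix (2 * r - 1) (2 * r - 1)
    (fun i l => RtoC (s_coef r (i + 1) (l + 1))).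

Definition Mscale {m n : nat} (c : C) (A : @matrix C m n) : @matrix C m n :=
  mk_matrix m n (fun i j => (c * coeff_mat (RtoC 0) A i j)%C).

(* Main.v *)
(* By the Jacobi triple product every infinite product in [g] and [gvee] is, up
   to a power of q, a theta series: a sum over the integers of a Gaussian times
   a root of unity. The powers of q cancel, leaving
   g_j = A_j / D + B_j / D' and gvee_j = (Av_j / Dv + Bv_j / Dv') / 2.
   Poisson summation inverts each theta series, producing a factor
   [gint a] (the integral of exp (- a v^2) over the real line) and a sum over
   all odd integers m of a Gaussian in m times an even character, the latter
   containing cos ((2j-1) m pi / (2 (4r-1))). Grouping m by its residue modulo
   2 (4r-1), up to sign, gives the rows of S; the class of 4r-1 drops out as its
   cosine vanishes. In the quotients only ratios of [gint] survive, and these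
   are known from the scaling gint (a / l^2) = l gint a, so [gint] is never
   evaluated and no branch of a complex square root is needed. The second
   identity follows from the first, since tau -> -1/(2 tau) is an involution and
   2 S^2 = 1. *)

Require Import Defs.
From Stdlib Require Import Reals Lra Lia Psatz ZArith List.
From Coquelicot Require Import Coquelicot.
Import ListNotations.
Open Scope R_scope.

(** * Complex exponentials and limits *)

(** In the variable p = -log q, the map tau -> -1/(2 tau), combined with the argument 2 tau in the
    definition of [gvee], becomes p -> PI^2 / p. The obstacle is the second quotient of [g]: with
    base -q^(4r-1) its series carries the sign (-1)^(k(k-1)/2), which has period 4 and is not a
    character of the integers. Written as a cosine it is a sum of two characters of frequencies 1/4
    and -1/4, whose duals run over the two classes of odd integers modulo 4 and reassemble into one
    sum over all odd m, at the cost of a factor 1 / sqrt 2. Of the denominators, (q, q^3, q^4; q^4)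
    is self-dual up to the same factor 1 / sqrt 2, while (q^2, q^2, q^4; q^4) is dual to (-q, -q^3,
    q^4; q^4). So 1 / sqrt 2 sits below in one quotient and above in the other, and the ratios of
    [gint] differ by exactly the factor 2 that makes both quotients scale by sqrt (2 / (4r-1)). All
    convergence rests on one bound, M / (1 + k^2), so that dominated convergence, continuity of sums
    and termwise integration share one explicit rate. *)

Lemma C_eq (z w : C) : Re z = Re w -> Im z = Im w -> z = w.
Proof. intros H1 H2; destruct z, w; simpl in *; congruence. Qed.

Lemma Cexp_plus (z w : C) : Cexp (z + w)%C = (Cexp z * Cexp w)%C.
Proof.
  destruct z as [a b], w as [c d]. unfold Cexp; apply C_eq; simpl;
    rewrite exp_plus, ?cos_plus, ?sin_plus; ring.
Qed.

Lemma Cexp_0 : Cexp 0 = 1%C.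
Proof. unfold Cexp; simpl; rewrite exp_0, cos_0, sin_0; apply C_eq; simpl; ring. Qed.

Lemma Cexp_opp (z : C) : (Cexp z * Cexp (- z))%C = 1%C.
Proof. rewrite <- Cexp_plus, Cplus_opp_r; apply Cexp_0. Qed.

Lemma Cexp_neq_0 (z : C) : Cexp z <> 0%C.
Proof.
  intros H. apply C1_nz. rewrite <- (Cexp_opp z), H. ring.
Qed.

Lemma Cmod_Cexp (z : C) : Cmod (Cexp z) = exp (Re z).
Proof.
  destruct z as [a b]. unfold Cmod, Cexp; simpl.
  transitivity (sqrt (Rsqr (exp a))); [f_equal | apply sqrt_Rsqr; left; apply exp_pos].
  transitivity (Rsqr (exp a) * (Rsqr (sin b) + Rsqr (cos b))).
  - unfold Rsqr; ring.
  - rewrite sin2_cos2; ring.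
Qed.

Lemma Cexp_pow (z : C) (n : nat) : (Cexp z ^ n)%C = Cexp (RtoC (INR n) * z)%C.
Proof.
  induction n as [|n IH].
  - simpl. rewrite Cmult_0_l, Cexp_0; reflexivity.
  - rewrite Cpow_S, IH, <- Cexp_plus, S_INR. f_equal.
    rewrite RtoC_plus; ring.
Qed.

Lemma Cexp_PI : Cexp (RtoC PI * Ci)%C = (- (1))%C.
Proof.
  unfold Cexp; apply C_eq; simpl.
  - replace (PI * 0 + 0 * 1) with 0 by ring.
    replace (PI * 0 - 0 * 1) with 0 by ring.
    replace (PI * 1 + 0 * 0) with PI by ring. rewrite exp_0, cos_PI; ring.
  - replace (PI * 1 + 0 * 0) with PI by ring. rewrite sin_PI; ring.
Qed.

Lemma Cexp_2PI_nat (n : nat) : Cexp (RtoC (2 * PI * INR n) * Ci)%C = 1%C.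
Proof.
  induction n as [|n IH].
  - simpl. rewrite Rmult_0_r, Cmult_0_l. apply Cexp_0.
  - replace (RtoC (2 * PI * INR (S n)) * Ci)%C
      with ((RtoC (2 * PI * INR n) * Ci + RtoC PI * Ci) + RtoC PI * Ci)%C.
    + rewrite !Cexp_plus, IH, Cexp_PI. ring.
    + rewrite S_INR; apply C_eq; simpl; ring.
Qed.

Lemma Cexp_2PI (k : Z) : Cexp (RtoC (2 * PI * IZR k) * Ci)%C = 1%C.
Proof.
  destruct (Z_le_gt_dec 0 k) as [Hk|Hk].
  - rewrite <- (Z2Nat.id k Hk), <- INR_IZR_INZ. apply Cexp_2PI_nat.
  - assert (Hk' : (0 <= - k)%Z) by lia.
    generalize (Cexp_opp (RtoC (2 * PI * IZR k) * Ci)%C).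
    replace (- (RtoC (2 * PI * IZR k) * Ci))%C
      with (RtoC (2 * PI * INR (Z.to_nat (- k))) * Ci)%C.
    + rewrite Cexp_2PI_nat, Cmult_1_r; tauto.
    + rewrite INR_IZR_INZ, Z2Nat.id, opp_IZR by lia. apply C_eq; simpl; ring.
Qed.

(** Signs and phases are written throughout as exponentials of multiples of i PI; supplying the
    integer [k] of full turns turns an equality of phases into an algebraic identity. *)
Lemma Cexp_eq_mod (z w : C) (k : Z) :
  z = (w + RtoC (2 * PI * IZR k) * Ci)%C -> Cexp z = Cexp w.
Proof. intros ->. rewrite Cexp_plus, Cexp_2PI; ring. Qed.

Lemma RtoC_cos (x : R) :
  RtoC (cos x) = ((Cexp (RtoC x * Ci) + Cexp (- (RtoC x * Ci))) / 2)%C.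
Proof.
  unfold Cexp; simpl.
  replace (x * 0 - 0 * 1) with 0 by ring.
  replace (- 0) with 0 by ring.
  replace (x * 1 + 0 * 0) with x by ring.
  rewrite exp_0, cos_neg, sin_neg.
  apply C_eq; simpl; field.
Qed.

Lemma Cmod_le_abs (z : C) : Cmod z <= Rabs (Re z) + Rabs (Im z).
Proof.
  replace z with (RtoC (Re z) + RtoC (Im z) * Ci)%C by (apply C_eq; simpl; ring).
  eapply Rle_trans; [apply Cmod_triangle|].
  rewrite Cmod_mult, !Cmod_R, Cmod_Ci; simpl.
  replace (Re z + (Im z * 0 - 0 * 1)) with (Re z) by ring.
  replace (0 + (Im z * 1 + 0 * 0)) with (Im z) by ring. lra.
Qed.

Lemma im_le_Cmod (z : C) : Rabs (Im z) <= Cmod z.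
Proof.
  eapply Rle_trans; [|apply Rmax_Cmod]. apply Rmax_r.
Qed.

(** Phrased through a real limit, so that comparison of real sequences applies; [is_Clim_Clim_seq]
    links it to the total function [Clim_seq]. *)
Definition is_Clim (u : nat -> C) (l : C) : Prop :=
  is_lim_seq (fun n => Cmod (u n - l)) 0.

Lemma is_Clim_le (u : nat -> C) (l : C) (e : nat -> R) :
  (forall n, Cmod (u n - l) <= e n) -> is_lim_seq e 0 -> is_Clim u l.
Proof.
  intros H He. apply is_lim_seq_le_le with (fun _ => 0) e.
  - intros n; split; [apply Cmod_ge_0 | apply H].
  - apply is_lim_seq_const.
  - exact He.
Qed.

Lemma is_Clim_ext (u v : nat -> C) (l : C) :
  (forall n, u n = v n) -> is_Clim u l -> is_Clim v l.
Proof.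
  intros H. apply is_lim_seq_ext. intros n; rewrite H; reflexivity.
Qed.

Lemma is_Clim_const (l : C) : is_Clim (fun _ => l) l.
Proof.
  apply is_lim_seq_ext with (fun _ => 0); [|apply is_lim_seq_const].
  intros _. replace (l - l)%C with (RtoC 0) by ring. symmetry; apply Cmod_0.
Qed.

Lemma is_Clim_plus (u v : nat -> C) (l m : C) :
  is_Clim u l -> is_Clim v m -> is_Clim (fun n => (u n + v n)%C) (l + m)%C.
Proof.
  intros Hu Hv. apply is_Clim_le with (fun n => Cmod (u n - l) + Cmod (v n - m)).
  - intros n. replace (u n + v n - (l + m))%C with ((u n - l) + (v n - m))%C by ring.
    apply Cmod_triangle.
  - rewrite <- (Rplus_0_r 0). apply is_lim_seq_plus'; assumption.
Qed.

Lemma is_Clim_scal (c : C) (u : nat -> C) (l : C) :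
  is_Clim u l -> is_Clim (fun n => (c * u n)%C) (c * l)%C.
Proof.
  intros Hu. apply is_Clim_le with (fun n => Cmod c * Cmod (u n - l)).
  - intros n. rewrite <- Cmod_mult. right; f_equal; ring.
  - rewrite <- (Rmult_0_r (Cmod c)). apply is_lim_seq_mult'; [apply is_lim_seq_const|exact Hu].
Qed.

Lemma is_Clim_minus (u v : nat -> C) (l m : C) :
  is_Clim u l -> is_Clim v m -> is_Clim (fun n => (u n - v n)%C) (l - m)%C.
Proof.
  intros Hu Hv. apply is_Clim_ext with (fun n => (u n + (- (1)) * v n)%C).
  - intros n; ring.
  - replace (l - m)%C with (l + (- (1)) * m)%C by ring.
    apply is_Clim_plus; [exact Hu | apply is_Clim_scal, Hv].
Qed.

Lemma is_Clim_mult (u v : nat -> C) (l m : C) :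
  is_Clim u l -> is_Clim v m -> is_Clim (fun n => (u n * v n)%C) (l * m)%C.
Proof.
  intros Hu Hv.
  apply is_Clim_le with
    (fun n => Cmod (u n - l) * Cmod (v n - m) + (Cmod l * Cmod (v n - m) + Cmod m * Cmod (u n - l))).
  - intros n.
    replace (u n * v n - l * m)%C
      with ((u n - l) * (v n - m) + (l * (v n - m) + m * (u n - l)))%C by ring.
    rewrite <- !Cmod_mult.
    eapply Rle_trans; [apply Cmod_triangle|]. apply Rplus_le_compat_l, Cmod_triangle.
  - replace (Finite 0) with (Finite (0 * 0 + (Cmod l * 0 + Cmod m * 0)))
      by (f_equal; ring).
    apply is_lim_seq_plus'; [apply is_lim_seq_mult'; assumption|].
    apply is_lim_seq_plus'; (apply is_lim_seq_mult'; [apply is_lim_seq_const|assumption]).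
Qed.

Lemma is_Clim_comp (u : nat -> C) (l : C) (phi : nat -> nat) :
  (forall N, exists M, forall n, (M <= n)%nat -> (N <= phi n)%nat) ->
  is_Clim u l -> is_Clim (fun n => u (phi n)) l.
Proof.
  intros Hphi Hu. apply (is_lim_seq_subseq (fun n => Cmod (u n - l))); [|exact Hu].
  intros P [N HN]. destruct (Hphi N) as [M HM]. exists M. intros n Hn. apply HN, HM, Hn.
Qed.

Lemma is_Clim_subseq (u : nat -> C) (l : C) (phi : nat -> nat) :
  (forall n, (n <= phi n)%nat) -> is_Clim u l -> is_Clim (fun n => u (phi n)) l.
Proof.
  intros Hphi. apply is_Clim_comp. intros N. exists N. intros n Hn. specialize (Hphi n). lia.
Qed.

Lemma is_Clim_ext_loc (u v : nat -> C) (l : C) (N : nat) :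
  (forall n, (N <= n)%nat -> u n = v n) -> is_Clim u l -> is_Clim v l.
Proof.
  intros H. apply is_lim_seq_ext_loc. exists N. intros n Hn; rewrite H; auto.
Qed.

Lemma is_Clim_unique (u : nat -> C) (l m : C) : is_Clim u l -> is_Clim u m -> l = m.
Proof.
  intros Hl Hm.
  assert (H0 : is_Clim (fun _ => 0%C) (l - m)%C).
  { apply is_Clim_ext with (fun n => (u n - u n)%C); [intros; ring|].
    apply is_Clim_minus; assumption. }
  assert (H1 : Cmod (l - m) = 0).
  { assert (E : Finite (Cmod (0 - (l - m))%C) = Finite 0).
    { rewrite <- (is_lim_seq_unique _ _ H0). symmetry. apply Lim_seq_const. }
    injection E. intros E'. rewrite <- E'.
    replace (0 - (l - m))%C with (- (l - m))%C by ring. rewrite Cmod_opp; reflexivity. }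
  apply Cmod_eq_0 in H1.
  replace l with ((l - m) + m)%C by ring. rewrite H1; ring.
Qed.

Lemma is_Clim_Clim_seq (u : nat -> C) (l : C) : is_Clim u l -> Clim_seq u = l.
Proof.
  intros H. apply Clim_seq_correct.
  intros P [eps HP]. apply is_lim_seq_spec in H.
  destruct (H eps) as [N HN]. exists N. intros n Hn. apply HP.
  apply C_NormedModule_mixin_compat1.
  specialize (HN n Hn). rewrite Rminus_0_r, Rabs_pos_eq in HN by apply Cmod_ge_0.
  exact HN.
Qed.

Lemma is_Clim_Cmod_le (u : nat -> C) (l : C) (M : R) :
  (forall n, Cmod (u n) <= M) -> is_Clim u l -> Cmod l <= M.
Proof.
  intros HM Hu.
  assert (H : Rbar_le (Cmod l) (M + 0)).
  { apply is_lim_seq_le with (fun _ => Cmod l) (fun n => M + Cmod (u n - l)).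
    - intros n. replace l with (u n + - (u n - l))%C at 1 by ring.
      eapply Rle_trans; [apply Cmod_triangle|]. rewrite Cmod_opp.
      apply Rplus_le_compat_r, HM.
    - apply is_lim_seq_const.
    - apply is_lim_seq_plus'; [apply is_lim_seq_const|exact Hu]. }
  simpl in H; lra.
Qed.

(** The Cauchy bound survives the passage of [m] to infinity, so the limit comes together with its
    rate. *)
Lemma Cauchy_rate (u : nat -> C) (e : nat -> R) :
  (forall n m, (n <= m)%nat -> Cmod (u m - u n) <= e n) -> is_lim_seq e 0 ->
  exists l, forall n, Cmod (u n - l) <= e n.
Proof.
  intros Hu He.
  assert (Hcau : forall p : C -> R, (forall z w, p (z - w)%C = p z - p w) ->
            (forall z, Rabs (p z) <= Cmod z) -> ex_finite_lim_seq (fun n => p (u n))).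
  { intros p Hlin Hle. apply ex_lim_seq_cauchy_corr. intros eps.
    apply is_lim_seq_spec in He.
    destruct (He (mkposreal _ (is_pos_div_2 eps))) as [N HN]. exists N.
    assert (Hall : forall n, (N <= n)%nat -> Rabs (p (u n) - p (u N)) < eps / 2).
    { intros n Hn. rewrite <- Hlin.
      eapply Rle_lt_trans; [apply Hle|].
      eapply Rle_lt_trans; [apply Hu, Hn|].
      specialize (HN N (Nat.le_refl N)). simpl in HN. rewrite Rminus_0_r in HN.
      eapply Rle_lt_trans; [apply Rle_abs|exact HN]. }
    intros n m Hn Hm.
    replace (p (u n) - p (u m)) with ((p (u n) - p (u N)) - (p (u m) - p (u N))) by ring.
    eapply Rle_lt_trans; [apply Rabs_triang|]. rewrite Rabs_Ropp.
    generalize (Hall n Hn) (Hall m Hm). lra. }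
  destruct (Hcau Re) as [a Ha]; [reflexivity|apply re_le_Cmod|].
  destruct (Hcau Im) as [b Hb]; [reflexivity|apply im_le_Cmod|].
  exists (a, b).
  assert (Hl : is_Clim u (a, b)).
  { apply is_Clim_le with (fun n => Rabs (Re (u n) - a) + Rabs (Im (u n) - b)).
    - intros n. eapply Rle_trans; [apply Cmod_le_abs|]. apply Rle_refl.
    - rewrite <- (Rplus_0_r 0). apply is_lim_seq_plus'.
      + rewrite <- Rabs_R0. apply (is_lim_seq_abs _ (Finite 0)). replace 0 with (a - a) by ring.
        apply is_lim_seq_minus'; [exact Ha|apply is_lim_seq_const].
      + rewrite <- Rabs_R0. apply (is_lim_seq_abs _ (Finite 0)). replace 0 with (b - b) by ring.
        apply is_lim_seq_minus'; [exact Hb|apply is_lim_seq_const]. }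
  intros n.
  replace (u n - (a, b))%C with (- ((a, b) - u n))%C by ring. rewrite Cmod_opp.
  apply is_Clim_Cmod_le with (fun m => (u (n + m)%nat - u n)%C).
  - intros m. apply Hu. lia.
  - apply is_Clim_minus; [|apply is_Clim_const].
    apply (is_Clim_subseq u (a, b) (fun m => (n + m)%nat)); [intros; lia|exact Hl].
Qed.

(** * Sums over the integers *)

Fixpoint csum (f : nat -> C) (n : nat) : C :=
  match n with
  | O => 0%C
  | S m => (csum f m + f m)%C
  end.

Lemma csum_ext (f g : nat -> C) (n : nat) :
  (forall i, (i < n)%nat -> f i = g i) -> csum f n = csum g n.
Proof.
  induction n as [|n IH]; intros H; [reflexivity|].
  simpl. rewrite IH, H by auto with arith. reflexivity.
Qed.

Lemma csum_plus (f g : nat -> C) (n : nat) :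
  csum (fun i => (f i + g i)%C) n = (csum f n + csum g n)%C.
Proof. induction n as [|n IH]; simpl; [ring|rewrite IH; ring]. Qed.

Lemma csum_scal (c : C) (f : nat -> C) (n : nat) :
  csum (fun i => (c * f i)%C) n = (c * csum f n)%C.
Proof. induction n as [|n IH]; simpl; [ring|rewrite IH; ring]. Qed.

Lemma csum_app (f : nat -> C) (n m : nat) :
  csum f (n + m) = (csum f n + csum (fun i => f (n + i)%nat) m)%C.
Proof.
  induction m as [|m IH]; [rewrite Nat.add_0_r; simpl; ring|].
  rewrite Nat.add_succ_r; simpl. rewrite IH; ring.
Qed.

Lemma csum_S_l (f : nat -> C) (n : nat) :
  csum f (S n) = (f O + csum (fun i => f (S i)) n)%C.
Proof. change (S n) with (1 + n)%nat. rewrite csum_app. simpl. ring. Qed.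

Lemma csum_zero (f : nat -> C) (n : nat) :
  (forall i, (i < n)%nat -> f i = 0%C) -> csum f n = 0%C.
Proof.
  intros H. induction n as [|n IH]; simpl; [reflexivity|].
  rewrite IH, H by auto with arith. ring.
Qed.

Lemma csum_swap (f : nat -> nat -> C) (n m : nat) :
  csum (fun i => csum (f i) m) n = csum (fun j => csum (fun i => f i j) n) m.
Proof.
  induction n as [|n IH]; simpl.
  - symmetry; apply csum_zero; reflexivity.
  - rewrite IH, <- csum_plus. reflexivity.
Qed.

Lemma csum_rev (f : nat -> C) (n : nat) :
  csum f n = csum (fun i => f (n - 1 - i)%nat) n.
Proof.
  induction n as [|n IH]; [reflexivity|].
  rewrite (csum_S_l (fun i => f (S n - 1 - i)%nat)).
  change (csum f (S n)) with (csum f n + f n)%C. rewrite IH, Cplus_comm. f_equal.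
  - f_equal; lia.
  - apply csum_ext. intros i Hi. f_equal. lia.
Qed.

Lemma csum_blocks (f : nat -> C) (K n : nat) :
  csum f (K * n) = csum (fun l => csum (fun i => f (K * i + l)%nat) n) K.
Proof.
  rewrite csum_swap.
  induction n as [|n IH]; [rewrite Nat.mul_0_r; reflexivity|].
  replace (K * S n)%nat with (K * n + K)%nat by lia.
  rewrite csum_app, IH. reflexivity.
Qed.

(* The half-open window [-n <= k < n] is stable under [k -> -1 - k] and is
   tiled exactly by residue classes when [n] is replaced by [K n]. *)
Definition window (f : Z -> C) (n : nat) : C :=
  csum (fun i => f (Z.of_nat i - Z.of_nat n)%Z) (2 * n).

Definition is_sumZ (f : Z -> C) (s : C) : Prop := is_Clim (window f) s.

Lemma window_S (f : Z -> C) (n : nat) :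
  window f (S n) = (window f n + (f (Z.of_nat n) + f (- Z.of_nat n - 1)%Z))%C.
Proof.
  unfold window. replace (2 * S n)%nat with (S (S (2 * n))) by lia.
  rewrite csum_S_l.
  set (F := fun i => f (Z.of_nat (S i) - Z.of_nat (S n))%Z).
  change (csum F (S (2 * n))) with (csum F (2 * n) + F (2 * n)%nat)%C.
  rewrite (csum_ext F (fun i => f (Z.of_nat i - Z.of_nat n)%Z))
    by (intros i _; unfold F; f_equal; lia).
  replace (F (2 * n)%nat) with (f (Z.of_nat n)) by (unfold F; f_equal; lia).
  replace (Z.of_nat 0 - Z.of_nat (S n))%Z with (- Z.of_nat n - 1)%Z by lia.
  ring.
Qed.

Lemma window_ext (f g : Z -> C) (n : nat) :
  (forall k, (- Z.of_nat n <= k < Z.of_nat n)%Z -> f k = g k) -> window f n = window g n.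
Proof. intros H. apply csum_ext. intros i Hi. apply H. lia. Qed.

Lemma window_plus (f g : Z -> C) (n : nat) :
  window (fun k => (f k + g k)%C) n = (window f n + window g n)%C.
Proof. apply csum_plus. Qed.

Lemma window_scal (c : C) (f : Z -> C) (n : nat) :
  window (fun k => (c * f k)%C) n = (c * window f n)%C.
Proof. apply csum_scal. Qed.

Lemma window_succ (f : Z -> C) (n : nat) :
  window (fun k => f (k + 1)%Z) n = (window f n - f (- Z.of_nat n)%Z + f (Z.of_nat n))%C.
Proof.
  destruct n as [|n]; [unfold window; simpl; ring|].
  unfold window. replace (2 * S n)%nat with (S (2 * n + 1)) by lia.
  rewrite (csum_S_l (fun i => f (Z.of_nat i - Z.of_nat (S n))%Z)).
  set (F := fun i => f (Z.of_nat i - Z.of_nat (S n) + 1)%Z).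
  change (csum F (S (2 * n + 1))) with (csum F (2 * n + 1) + F (2 * n + 1)%nat)%C.
  rewrite (csum_ext F (fun i => f (Z.of_nat (S i) - Z.of_nat (S n))%Z))
    by (intros i _; unfold F; f_equal; lia).
  replace (F (2 * n + 1)%nat) with (f (Z.of_nat (S n))) by (unfold F; f_equal; lia).
  replace (Z.of_nat 0 - Z.of_nat (S n))%Z with (- Z.of_nat (S n))%Z by lia.
  ring.
Qed.

Lemma window_pred (f : Z -> C) (n : nat) :
  window (fun k => f (k - 1)%Z) n = (window f n + f (- Z.of_nat n - 1)%Z - f (Z.of_nat n - 1)%Z)%C.
Proof.
  assert (H := window_succ (fun k => f (k - 1)%Z) n). cbv beta in H.
  rewrite (window_ext _ f) in H by (intros; f_equal; lia).
  rewrite H. ring.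
Qed.

Lemma window_refl (f : Z -> C) (n : nat) :
  window (fun k => f (- 1 - k)%Z) n = window f n.
Proof.
  unfold window. rewrite (csum_rev (fun i => f _)).
  apply csum_ext. intros i Hi. f_equal. lia.
Qed.

Lemma is_sumZ_ext (f g : Z -> C) (s : C) :
  (forall k, f k = g k) -> is_sumZ f s -> is_sumZ g s.
Proof. intros H. apply is_Clim_ext. intros n; apply window_ext; auto. Qed.

Lemma is_sumZ_unique (f : Z -> C) (s s' : C) : is_sumZ f s -> is_sumZ f s' -> s = s'.
Proof. apply is_Clim_unique. Qed.

Lemma is_sumZ_plus (f g : Z -> C) (s s' : C) :
  is_sumZ f s -> is_sumZ g s' -> is_sumZ (fun k => (f k + g k)%C) (s + s')%C.
Proof.
  intros Hf Hg. apply is_Clim_ext with (fun n => (window f n + window g n)%C).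
  - intros n; symmetry; apply window_plus.
  - apply is_Clim_plus; assumption.
Qed.

Lemma is_sumZ_scal (c : C) (f : Z -> C) (s : C) :
  is_sumZ f s -> is_sumZ (fun k => (c * f k)%C) (c * s)%C.
Proof.
  intros Hf. apply is_Clim_ext with (fun n => (c * window f n)%C).
  - intros n; symmetry; apply window_scal.
  - apply is_Clim_scal; assumption.
Qed.

Lemma is_sumZ_refl (f : Z -> C) (s : C) :
  is_sumZ f s -> is_sumZ (fun k => f (- 1 - k)%Z) s.
Proof. apply is_Clim_ext. intros n; symmetry; apply window_refl. Qed.

Lemma is_sumZ_succ (f : Z -> C) (s : C) :
  is_Clim (fun n => f (Z.of_nat n)) 0 -> is_Clim (fun n => f (- Z.of_nat n)%Z) 0 ->
  is_sumZ f s -> is_sumZ (fun k => f (k + 1)%Z) s.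
Proof.
  intros H1 H2 Hs.
  apply is_Clim_ext with (fun n => (window f n - f (- Z.of_nat n)%Z + f (Z.of_nat n))%C).
  - intros n; symmetry; apply window_succ.
  - replace s with (s - 0 + 0)%C by ring.
    apply is_Clim_plus; [apply is_Clim_minus|]; assumption.
Qed.

Lemma is_Clim_csum (u : nat -> nat -> C) (l : nat -> C) (K : nat) :
  (forall i, (i < K)%nat -> is_Clim (fun n => u n i) (l i)) ->
  is_Clim (fun n => csum (u n) K) (csum l K).
Proof.
  induction K as [|K IH]; intros H; simpl.
  - apply is_Clim_const.
  - apply is_Clim_plus; [apply IH; auto with arith | apply H; auto with arith].
Qed.

(** The window of half-length K n is the disjoint union of the windows of half-length n in the K
    residue classes, so no boundary terms appear. *)
Lemma is_sumZ_blocks (f : Z -> C) (K : nat) (s : C) (t : nat -> C) :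
  (0 < K)%nat -> is_sumZ f s ->
  (forall l, (l < K)%nat -> is_sumZ (fun n => f (Z.of_nat K * n + Z.of_nat l)%Z) (t l)) ->
  s = csum t K.
Proof.
  intros HK Hs Ht.
  apply is_Clim_unique with (fun n => window f (K * n)).
  - apply (is_Clim_subseq (window f)); [intros n; nia|exact Hs].
  - apply is_Clim_ext with
      (fun n => csum (fun l => window (fun m => f (Z.of_nat K * m + Z.of_nat l)%Z) n) K).
    + intros n. unfold window.
      replace (2 * (K * n))%nat with (K * (2 * n))%nat by lia.
      rewrite csum_blocks. apply csum_ext. intros l Hl.
      apply csum_ext. intros i Hi. f_equal. nia.
    + apply is_Clim_csum. exact Ht.
Qed.

(** * Summable families *)

(** Quadratic decay with an explicit constant gives the tail bound 8 M / (n + 1), which is uniform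
    in any parameter on which [M] does not depend. *)
Definition dominated (f : Z -> C) (M : R) : Prop :=
  forall k, Cmod (f k) <= M / (1 + IZR k ^ 2).

Lemma dominated_pos (f : Z -> C) (M : R) : dominated f M -> 0 <= M.
Proof.
  intros H. specialize (H 0%Z). simpl in H.
  generalize (Cmod_ge_0 (f 0%Z)). replace (M / (1 + 0 * (0 * 1))) with M in H by field. lra.
Qed.

(** The induction carries the telescoping bound 8 M / (n+1) - 8 M / (m+1): the two terms added at
    radius m are at most 2 M / (1 + m^2), which is below 8 M / ((m+1)(m+2)). *)
Lemma window_tail (f : Z -> C) (M : R) (n m : nat) :
  dominated f M -> (n <= m)%nat ->
  Cmod (window f m - window f n) <= 8 * M / (INR n + 1).
Proof.
  intros Hf Hnm. assert (HM := dominated_pos f M Hf).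
  assert (Hstrong : Cmod (window f m - window f n) <= 8 * M / (INR n + 1) - 8 * M / (INR m + 1)).
  { induction Hnm as [|m Hnm IH].
    - replace (window f n - window f n)%C with (RtoC 0) by ring. rewrite Cmod_0. lra.
    - rewrite window_S.
      replace (window f m + (f (Z.of_nat m) + f (- Z.of_nat m - 1)%Z) - window f n)%C
        with ((window f m - window f n) + (f (Z.of_nat m) + f (- Z.of_nat m - 1)%Z))%C by ring.
      eapply Rle_trans; [apply Cmod_triangle|].
      assert (H1 : Cmod (f (Z.of_nat m) + f (- Z.of_nat m - 1)%Z) <= 2 * M / (1 + INR m ^ 2)).
      { eapply Rle_trans; [apply Cmod_triangle|].
        assert (A := Hf (Z.of_nat m)). assert (B := Hf (- Z.of_nat m - 1)%Z).
        rewrite <- INR_IZR_INZ in A.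
        rewrite minus_IZR, opp_IZR, <- INR_IZR_INZ in B.
        assert (Hm := pos_INR m).
        assert (M / (1 + (- INR m - 1) ^ 2) <= M / (1 + INR m ^ 2)).
        { apply Rmult_le_compat_l; [lra|]. apply Rinv_le_contravar; nra. }
        replace (2 * M / (1 + INR m ^ 2)) with (M / (1 + INR m ^ 2) + M / (1 + INR m ^ 2))
          by (field; nra).
        lra. }
      assert (H2 : 2 * M / (1 + INR m ^ 2) <= 8 * M / (INR m + 1) - 8 * M / (INR (S m) + 1)).
      { rewrite S_INR. assert (Hm := pos_INR m).
        replace (8 * M / (INR m + 1) - 8 * M / (INR m + 1 + 1))
          with (2 * M * (4 / ((INR m + 1) * (INR m + 2)))) by (field; lra).
        unfold Rdiv at 1. apply Rmult_le_compat_l; [lra|].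
        apply Rmult_le_reg_l with ((1 + INR m ^ 2) * ((INR m + 1) * (INR m + 2))); [nra|].
        field_simplify; nra. }
      lra. }
  assert (0 <= 8 * M / (INR m + 1)).
  { apply Rmult_le_pos; [lra|]. left; apply Rinv_0_lt_compat. generalize (pos_INR m); lra. }
  lra.
Qed.

Lemma is_lim_seq_div_S (K : R) : is_lim_seq (fun n => K / (INR n + 1)) 0.
Proof.
  rewrite <- (Rmult_0_r K).
  apply is_lim_seq_mult'.
  - apply is_lim_seq_const.
  - apply is_lim_seq_ext with (fun n => / INR (S n)); [intros n; rewrite S_INR; reflexivity|].
    apply (is_lim_seq_incr_1 (fun n => / INR n)).
    replace (Finite 0) with (Rbar_inv p_infty) by reflexivity.
    apply is_lim_seq_inv; [apply is_lim_seq_INR|discriminate].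
Qed.

Lemma dominated_sum (f : Z -> C) (M : R) :
  dominated f M ->
  exists s, is_sumZ f s /\ forall n, Cmod (window f n - s) <= 8 * M / (INR n + 1).
Proof.
  intros Hf.
  destruct (Cauchy_rate (window f) (fun n => 8 * M / (INR n + 1))) as [s Hs].
  - intros n m Hnm. apply window_tail; assumption.
  - apply is_lim_seq_div_S.
  - exists s; split; [|exact Hs].
    apply is_Clim_le with (fun n => 8 * M / (INR n + 1)); [exact Hs|apply is_lim_seq_div_S].
Qed.

Lemma dominated_rate (f : Z -> C) (M : R) (s : C) (n : nat) :
  dominated f M -> is_sumZ f s -> Cmod (window f n - s) <= 8 * M / (INR n + 1).
Proof.
  intros Hf Hs. destruct (dominated_sum f M Hf) as [s' [Hs' H]].
  rewrite (is_sumZ_unique f s s'); auto.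
Qed.

(** Tannery's theorem: the common bound makes the tails beyond a fixed [N] uniformly small, and
    inside [N] only finitely many limits are taken. *)
Lemma is_sumZ_Tannery (F : nat -> Z -> C) (f : Z -> C) (s : C) (M : R)
    (phi : nat -> nat) :
  (forall n, (n <= phi n)%nat) ->
  (forall m, dominated (F m) M) -> (forall k, is_Clim (fun m => F m k) (f k)) ->
  is_sumZ f s -> is_Clim (fun m => window (F m) (phi m)) s.
Proof.
  intros Hphi HF Hlim Hs.
  assert (Hf : dominated f M).
  { intros k. apply is_Clim_Cmod_le with (fun m => F m k); [intros m; apply HF|apply Hlim]. }
  apply is_lim_seq_spec. intros eps. cbv beta.
  assert (Hr := is_lim_seq_div_S (8 * M)). apply is_lim_seq_spec in Hr.
  destruct (Hr (mkposreal _ (is_pos_div_2 (mkposreal _ (is_pos_div_2 eps))))) as [N HN].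
  specialize (HN N (Nat.le_refl N)). simpl in HN.
  rewrite Rminus_0_r in HN. apply Rabs_def2 in HN. destruct HN as [HN _].
  assert (Hw : is_Clim (fun m => window (F m) N) (window f N)).
  { apply is_Clim_csum. intros i _. apply Hlim. }
  apply is_lim_seq_spec in Hw. destruct (Hw (mkposreal _ (is_pos_div_2 eps))) as [N' HN'].
  exists (N + N')%nat. intros m Hm. specialize (HN' m ltac:(lia)). simpl in HN'.
  rewrite Rminus_0_r in HN' |- *.
  rewrite Rabs_pos_eq in HN' |- * by apply Cmod_ge_0.
  replace (window (F m) (phi m) - s)%C
    with ((window (F m) (phi m) - window (F m) N) + ((window (F m) N - window f N) + (window f N - s)))%C
    by ring.
  assert (H1 := window_tail (F m) M N (phi m) (HF m) ltac:(specialize (Hphi m); lia)).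
  assert (H2 := dominated_rate f M s N Hf Hs).
  eapply Rle_lt_trans; [apply Cmod_triangle|].
  assert (H3 := Cmod_triangle (window (F m) N - window f N) (window f N - s)).
  lra.
Qed.

Lemma dominated_lim (f : Z -> C) (M : R) :
  dominated f M ->
  is_Clim (fun n => f (Z.of_nat n)) 0 /\ is_Clim (fun n => f (- Z.of_nat n)%Z) 0.
Proof.
  intros Hf. assert (HM := dominated_pos f M Hf).
  assert (H : forall n, M / (1 + INR n ^ 2) <= 2 * M / (INR n + 1)).
  { intros n. assert (Hn := pos_INR n).
    replace (2 * M / (INR n + 1)) with (M * (2 / (INR n + 1))) by (field; lra).
    apply Rmult_le_compat_l; [lra|].
    replace (2 / (INR n + 1)) with (/ ((INR n + 1) / 2)) by (field; lra).
    assert (Hsq := pow2_ge_0 (INR n - 1)).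
    apply Rinv_le_contravar; nra. }
  split; apply is_Clim_le with (fun n => 2 * M / (INR n + 1));
    try apply is_lim_seq_div_S; intros n.
  - replace (f (Z.of_nat n) - 0)%C with (f (Z.of_nat n)) by ring.
    eapply Rle_trans; [apply Hf|]. rewrite <- INR_IZR_INZ. apply H.
  - replace (f (- Z.of_nat n)%Z - 0)%C with (f (- Z.of_nat n)%Z) by ring.
    eapply Rle_trans; [apply Hf|]. rewrite opp_IZR, <- INR_IZR_INZ.
    replace ((- INR n) ^ 2) with (INR n ^ 2) by ring. apply H.
Qed.

(** Negation does not preserve the window. It is the reflection k -> -1 - k combined with a unit
    shift, whose boundary terms tend to 0 by domination. *)
Lemma is_sumZ_opp (f : Z -> C) (M : R) (s : C) :
  dominated f M -> is_sumZ f s -> is_sumZ (fun k => f (- k)%Z) s.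
Proof.
  intros Hf Hs. destruct (dominated_lim f M Hf) as [H1 H2].
  apply is_sumZ_succ in Hs; [|assumption|assumption].
  apply is_sumZ_refl in Hs. eapply is_sumZ_ext; [|exact Hs].
  intros k; cbv beta. f_equal; lia.
Qed.

(** Half of the quadratic decay absorbs the linear term by completing the square; the other half
    dominates 1 + x^2 through 1 + t <= exp t. *)
Lemma gauss_bound (d b c : R) : 0 < d ->
  exists M, forall x, exp (- d * x ^ 2 + b * x + c) <= M / (1 + x ^ 2).
Proof.
  intros Hd.
  exists (exp (c + b ^ 2 / (2 * d)) * (1 + 2 / d)). intros x.
  assert (H1 : exp (- d * x ^ 2 + b * x + c)
               <= exp (c + b ^ 2 / (2 * d)) * exp (- (d / 2 * x ^ 2))).
  { rewrite <- exp_plus.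
    assert (- d * x ^ 2 + b * x + c <= c + b ^ 2 / (2 * d) + - (d / 2 * x ^ 2)).
    { assert (0 <= d / 2 * (x - b / d) ^ 2) by (apply Rmult_le_pos; [lra|apply pow2_ge_0]).
      replace (d / 2 * (x - b / d) ^ 2) with (d / 2 * x ^ 2 - b * x + b ^ 2 / (2 * d)) in H
        by (field; lra).
      lra. }
    destruct H as [H|H]; [left; apply exp_increasing, H|rewrite H; apply Rle_refl]. }
  eapply Rle_trans; [exact H1|]. unfold Rdiv at 3. rewrite Rmult_assoc.
  apply Rmult_le_compat_l; [left; apply exp_pos|].
  rewrite exp_Ropp.
  assert (Hx : 0 <= x ^ 2) by apply pow2_ge_0.
  assert (H2 : 1 + d / 2 * x ^ 2 <= exp (d / 2 * x ^ 2)) by apply exp_ineq1_le.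
  assert (H3 : 0 <= d / 2 * x ^ 2) by nra.
  apply Rle_trans with (/ (1 + d / 2 * x ^ 2)); [apply Rinv_le_contravar; lra|].
  assert (Hd' : 0 < 2 / d) by (apply Rdiv_lt_0_compat; lra).
  apply Rmult_le_reg_l with ((1 + d / 2 * x ^ 2) * (1 + x ^ 2)); [nra|].
  replace ((1 + d / 2 * x ^ 2) * (1 + x ^ 2) * / (1 + d / 2 * x ^ 2)) with (1 + x ^ 2)
    by (field; lra).
  replace ((1 + d / 2 * x ^ 2) * (1 + x ^ 2) * ((1 + 2 / d) * / (1 + x ^ 2)))
    with (1 + 2 / d + d / 2 * x ^ 2 + x ^ 2) by (field; lra).
  lra.
Qed.

Lemma dominated_Cexp (f : Z -> C) (d b c : R) :
  0 < d -> (forall k, Re (f k) = - d * IZR k ^ 2 + b * IZR k + c) ->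
  exists M, dominated (fun k => Cexp (f k)) M.
Proof.
  intros Hd Hf. destruct (gauss_bound d b c Hd) as [M HM]. exists M.
  intros k. rewrite Cmod_Cexp, Hf. apply HM.
Qed.

(** * The Jacobi triple product *)

(** Each factor is at most exp (|a| |p|^n), and the exponents form a geometric series whose partial
    sums the induction keeps. *)
Lemma qpoch_fin_bound (a p : C) (n : nat) :
  Cmod p < 1 -> Cmod (qpoch_fin a p n) <= exp (Cmod a / (1 - Cmod p)).
Proof.
  intros Hp. assert (Hp0 := Cmod_ge_0 p). assert (Ha := Cmod_ge_0 a).
  assert (H : Cmod (qpoch_fin a p n) <= exp (Cmod a * ((1 - Cmod p ^ n) / (1 - Cmod p)))).
  { induction n as [|n IH]; simpl qpoch_fin.
    - rewrite Cmod_1. simpl. replace (Cmod a * ((1 - 1) / (1 - Cmod p))) with 0 by (field; lra).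
      rewrite exp_0; lra.
    - rewrite Cmod_mult.
      replace (Cmod a * ((1 - Cmod p ^ S n) / (1 - Cmod p)))
        with (Cmod a * ((1 - Cmod p ^ n) / (1 - Cmod p)) + Cmod a * Cmod p ^ n)
        by (simpl; field; lra).
      rewrite exp_plus.
      apply Rmult_le_compat; try apply Cmod_ge_0; [exact IH|].
      eapply Rle_trans; [apply Cmod_triangle|].
      rewrite Cmod_opp, Cmod_mult, Cmod_pow, Cmod_1. apply exp_ineq1_le. }
  eapply Rle_trans; [exact H|].
  assert (Hn : 0 <= Cmod p ^ n) by (apply pow_le; lra).
  assert (Hle : Cmod a * ((1 - Cmod p ^ n) / (1 - Cmod p)) <= Cmod a / (1 - Cmod p)).
  { unfold Rdiv. apply Rmult_le_compat_l; [lra|].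
    rewrite <- (Rmult_1_l (/ (1 - Cmod p))) at 2.
    apply Rmult_le_compat_r; [left; apply Rinv_0_lt_compat|]; lra. }
  destruct Hle as [Hle|Hle]; [left; apply exp_increasing, Hle|rewrite Hle; apply Rle_refl].
Qed.

Lemma qpoch_fin_lim (a p : C) : Cmod p < 1 -> is_Clim (qpoch_fin a p) (qpoch a p).
Proof.
  intros Hp. assert (Hp0 := Cmod_ge_0 p). assert (Ha := Cmod_ge_0 a).
  set (K := exp (Cmod a / (1 - Cmod p)) * Cmod a / (1 - Cmod p)).
  assert (HK : 0 <= K).
  { unfold K, Rdiv. apply Rmult_le_pos; [apply Rmult_le_pos; [left; apply exp_pos|lra]|].
    left; apply Rinv_0_lt_compat; lra. }
  assert (Hlim : is_lim_seq (fun n => K * Cmod p ^ n) 0).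
  { rewrite <- (Rmult_0_r K). apply is_lim_seq_mult'; [apply is_lim_seq_const|].
    apply is_lim_seq_geom. rewrite Rabs_pos_eq; lra. }
  destruct (Cauchy_rate (qpoch_fin a p) (fun n => K * Cmod p ^ n)) as [l Hl]; [|exact Hlim|].
  - intros n m Hnm.
    assert (Hs : Cmod (qpoch_fin a p m - qpoch_fin a p n) <= K * Cmod p ^ n - K * Cmod p ^ m).
    { induction Hnm as [|m Hnm IH].
      - replace (qpoch_fin a p n - qpoch_fin a p n)%C with (RtoC 0) by ring.
        rewrite Cmod_0; lra.
      - simpl qpoch_fin.
        replace (qpoch_fin a p m * (1 - a * p ^ m) - qpoch_fin a p n)%C
          with ((qpoch_fin a p m - qpoch_fin a p n) + - (qpoch_fin a p m * (a * p ^ m)))%C by ring.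
        eapply Rle_trans; [apply Cmod_triangle|]. rewrite Cmod_opp, !Cmod_mult, Cmod_pow.
        assert (Hb := qpoch_fin_bound a p m Hp).
        assert (Hm : 0 <= Cmod p ^ m) by (apply pow_le; lra).
        assert (Hb' : Cmod (qpoch_fin a p m) * (Cmod a * Cmod p ^ m)
                      <= exp (Cmod a / (1 - Cmod p)) * (Cmod a * Cmod p ^ m)).
        { apply Rmult_le_compat_r; [apply Rmult_le_pos; lra|exact Hb]. }
        replace (K * Cmod p ^ n - K * Cmod p ^ S m)
          with (K * Cmod p ^ n - K * Cmod p ^ m
                + exp (Cmod a / (1 - Cmod p)) * (Cmod a * Cmod p ^ m))
          by (unfold K; simpl; field; lra).
        lra. }
    assert (0 <= K * Cmod p ^ m) by (apply Rmult_le_pos; [exact HK|apply pow_le; lra]).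
    lra.
  - assert (H : is_Clim (qpoch_fin a p) l) by (apply is_Clim_le with (fun n => K * Cmod p ^ n); assumption).
    unfold qpoch. rewrite (is_Clim_Clim_seq _ _ H). exact H.
Qed.

(** With x = |p|, each factor has modulus at least 1 - x^n >= exp (- x^n / (1 - x)) for n >= 1, and
    these exponents sum geometrically. A bound uniform in [n] lets the reciprocals pass to the
    limit. *)
Lemma qpoch_fin_lower (p : C) : Cmod p < 1 ->
  exists d, 0 < d /\ forall n, d <= Cmod (qpoch_fin p p n).
Proof.
  intros Hp. assert (Hp0 := Cmod_ge_0 p). set (x := Cmod p) in *.
  exists (exp (- (1 / (1 - x) ^ 2))). split; [apply exp_pos|]. intros n.
  assert (H : exp (- (x * (1 - x ^ n) / (1 - x) ^ 2)) <= Cmod (qpoch_fin p p n)).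
  { induction n as [|n IH]; simpl qpoch_fin.
    - rewrite Cmod_1. simpl.
      replace (- (x * (1 - 1) / ((1 - x) * ((1 - x) * 1)))) with 0 by (field; lra).
      rewrite exp_0; lra.
    - rewrite Cmod_mult.
      replace (- (x * (1 - x ^ S n) / (1 - x) ^ 2))
        with (- (x * (1 - x ^ n) / (1 - x) ^ 2) + - (x ^ S n / (1 - x))) by (simpl; field; lra).
      rewrite exp_plus.
      apply Rmult_le_compat; try (left; apply exp_pos); [exact IH|].
      change (p * p ^ n)%C with (p ^ S n)%C.
      assert (Hx : Cmod (p ^ S n)%C = x ^ S n) by apply Cmod_pow.
      assert (Ht : 1 <= Cmod (1 - p ^ S n) + Cmod (p ^ S n)).
      { apply Rle_trans with (Cmod ((1 - p ^ S n) + p ^ S n)%C); [|apply Cmod_triangle].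
        replace ((1 - p ^ S n) + p ^ S n)%C with (RtoC 1) by ring. rewrite Cmod_1; lra. }
      rewrite Hx in Ht. apply Rle_trans with (1 - x ^ S n); [|lra].
      assert (Hxn : 0 <= x ^ S n) by (apply pow_le; lra).
      assert (Hxn1 : x ^ S n <= x).
      { simpl. assert (x ^ n <= 1) by (rewrite <- (pow1 n); apply pow_incr; lra). nra. }
      rewrite exp_Ropp.
      assert (He : 1 + x ^ S n / (1 - x) <= exp (x ^ S n / (1 - x))) by apply exp_ineq1_le.
      assert (H0 : 0 <= x ^ S n / (1 - x)).
      { apply Rmult_le_pos; [lra|left; apply Rinv_0_lt_compat; lra]. }
      apply Rle_trans with (/ (1 + x ^ S n / (1 - x))); [apply Rinv_le_contravar; lra|].
      apply Rmult_le_reg_l with (1 + x ^ S n / (1 - x)); [lra|].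
      rewrite Rinv_r by lra.
      replace ((1 + x ^ S n / (1 - x)) * (1 - x ^ S n))
        with (1 + x ^ S n * (x - x ^ S n) / (1 - x)) by (field; lra).
      assert (0 <= x ^ S n * (x - x ^ S n) / (1 - x)).
      { apply Rmult_le_pos; [nra|left; apply Rinv_0_lt_compat; lra]. }
      lra. }
  eapply Rle_trans; [|exact H].
  assert (Hxn : 0 <= x ^ n) by (apply pow_le; lra).
  assert (Hle : - (1 / (1 - x) ^ 2) <= - (x * (1 - x ^ n) / (1 - x) ^ 2)).
  { apply Ropp_le_contravar. unfold Rdiv. apply Rmult_le_compat_r.
    - left; apply Rinv_0_lt_compat. nra.
    - nra. }
  destruct Hle as [Hle|Hle]; [left; apply exp_increasing, Hle|rewrite Hle; apply Rle_refl].
Qed.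

(* [1 / (Q; Q)_k], extended by 0 to negative [k]; this makes the recurrence
   [iqfact_pred] hold for all integers. *)
Definition iqfact (Q : C) (k : Z) : C :=
  if (0 <=? k)%Z then (/ qpoch_fin Q Q (Z.to_nat k))%C else 0%C.

Lemma qpoch_fin_neq_0 (p : C) (n : nat) : Cmod p < 1 -> qpoch_fin p p n <> 0%C.
Proof.
  intros Hp H. destruct (qpoch_fin_lower p Hp) as [d [Hd Hn]].
  specialize (Hn n). rewrite H, Cmod_0 in Hn. lra.
Qed.

Lemma Cmod_Cexp_lt_1 (v : C) : Re v < 0 -> Cmod (Cexp v) < 1.
Proof. intros Hv. rewrite Cmod_Cexp, <- exp_0. apply exp_increasing, Hv. Qed.

Lemma iqfact_pred (v : C) (k : Z) : Re v < 0 ->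
  iqfact (Cexp v) (k - 1) = ((1 - Cexp (v * RtoC (IZR k))) * iqfact (Cexp v) k)%C.
Proof.
  intros Hv. assert (HQ := Cmod_Cexp_lt_1 v Hv). unfold iqfact.
  destruct (Z.leb_spec 0 k) as [Hk|Hk]; destruct (Z.leb_spec 0 (k - 1)) as [Hk'|Hk'];
    try lia; [| |ring].
  - set (m := Z.to_nat (k - 1)).
    replace (Z.to_nat k) with (S m) by lia.
    assert (E : Cexp (v * RtoC (IZR k)) = (Cexp v * Cexp v ^ m)%C).
    { change (Cexp v * Cexp v ^ m)%C with (Cexp v ^ S m)%C.
      rewrite Cexp_pow, Cmult_comm. do 3 f_equal.
      rewrite INR_IZR_INZ. f_equal. lia. }
    rewrite E.
    assert (H1 := qpoch_fin_neq_0 _ m HQ). assert (H2 := qpoch_fin_neq_0 _ (S m) HQ).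
    simpl qpoch_fin in *. field. split; [|exact H1].
    intros H0. apply H2. rewrite H0. ring.
  - replace k with 0%Z by lia. rewrite Cmult_0_r, Cexp_0. ring.
Qed.

(** The Gaussian binomial coefficient of 2m over m + k, centred at k = 0. *)
Definition qbinom (Q : C) (m : nat) (k : Z) : C :=
  (qpoch_fin Q Q (2 * m) * (iqfact Q (Z.of_nat m + k) * iqfact Q (Z.of_nat m - k)))%C.

Lemma qbinom_out (Q : C) (m : nat) (k : Z) :
  (Z.of_nat m < Z.abs k)%Z -> qbinom Q m k = 0%C.
Proof.
  intros Hk. unfold qbinom, iqfact.
  destruct (Z.leb_spec 0 (Z.of_nat m + k)); destruct (Z.leb_spec 0 (Z.of_nat m - k));
    try lia; ring.
Qed.

(** With z = e^u and Q = e^v this is (-1)^k Q^(k(k-1)/2) z^k. Keeping the logarithms [u] and [v] as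
    data makes every power an exponential, without a choice of branch. *)
Definition jtp_term (u v : C) (k : Z) : C :=
  Cexp (RtoC (PI * IZR k) * Ci + v * RtoC (IZR k * (IZR k - 1) / 2) + u * RtoC (IZR k))%C.

(** The two factors gained between m and m + 1 multiply to 1 + Q^(2m+1) - z Q^m - (Q/z) Q^m, and the
    powers of z produce the shifts k, k-1, k+1. Once all three terms are expressed by
    [jtp_term u v k], a polynomial identity in Q, X = Q^(m+k) and Y = Q^(m-k) remains. *)
Lemma jtp_step (u v : C) (m : nat) (k : Z) : Re v < 0 ->
  (jtp_term u v k * qbinom (Cexp v) (S m) k)%C =
  ((1 + Cexp v * Cexp v ^ (2 * m)) * (jtp_term u v k * qbinom (Cexp v) m k)
   + (- (Cexp u * Cexp v ^ m) * (jtp_term u v (k - 1) * qbinom (Cexp v) m (k - 1))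
      + - (Cexp (v - u) * Cexp v ^ m) * (jtp_term u v (k + 1) * qbinom (Cexp v) m (k + 1))))%C.
Proof.
  intros Hv.
  set (X := Cexp (v * RtoC (IZR (Z.of_nat m + k)))%C).
  set (Y := Cexp (v * RtoC (IZR (Z.of_nat m - k)))%C).
  assert (EXY : (Cexp v ^ (2 * m))%C = (X * Y)%C).
  { unfold X, Y. rewrite <- Cexp_plus, Cexp_pow. f_equal.
    rewrite INR_IZR_INZ, plus_IZR, minus_IZR.
    replace (Z.of_nat (2 * m)) with (2 * Z.of_nat m)%Z by lia. rewrite mult_IZR.
    apply C_eq; simpl; ring. }
  assert (ES : forall j : Z, Cexp (v * RtoC (IZR (j + 1))) = (Cexp v * Cexp (v * RtoC (IZR j)))%C).
  { intros j. rewrite <- Cexp_plus. f_equal. rewrite plus_IZR. apply C_eq; simpl; ring. }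
  assert (Em : (Cexp u * Cexp v ^ m * jtp_term u v (k - 1))%C = (- (Cexp v * Y) * jtp_term u v k)%C).
  { unfold Y, jtp_term. rewrite <- (ES (Z.of_nat m - k)%Z), Cexp_pow.
    replace (- Cexp (v * RtoC (IZR (Z.of_nat m - k + 1))))%C
      with (Cexp (RtoC PI * Ci) * Cexp (v * RtoC (IZR (Z.of_nat m - k + 1))))%C
      by (rewrite Cexp_PI; ring).
    rewrite <- !Cexp_plus. apply Cexp_eq_mod with (-1)%Z.
    rewrite plus_IZR, !minus_IZR, <- INR_IZR_INZ. apply C_eq; simpl; field. }
  assert (Ep : (Cexp (v - u) * Cexp v ^ m * jtp_term u v (k + 1))%C
               = (- (Cexp v * X) * jtp_term u v k)%C).
  { unfold X, jtp_term. rewrite <- (ES (Z.of_nat m + k)%Z), Cexp_pow.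
    replace (- Cexp (v * RtoC (IZR (Z.of_nat m + k + 1))))%C
      with (Cexp (RtoC PI * Ci) * Cexp (v * RtoC (IZR (Z.of_nat m + k + 1))))%C
      by (rewrite Cexp_PI; ring).
    rewrite <- !Cexp_plus. f_equal.
    rewrite !plus_IZR, <- INR_IZR_INZ. apply C_eq; simpl; field. }
  assert (I1 := iqfact_pred v (Z.of_nat m + k + 1) Hv).
  assert (I2 := iqfact_pred v (Z.of_nat m + k) Hv). fold X in I2.
  assert (I3 := iqfact_pred v (Z.of_nat m - k + 1) Hv).
  assert (I4 := iqfact_pred v (Z.of_nat m - k) Hv). fold Y in I4.
  rewrite ES in I1, I3. fold X in I1. fold Y in I3.
  replace (Z.of_nat m + k + 1 - 1)%Z with (Z.of_nat m + k)%Z in I1 by lia.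
  replace (Z.of_nat m - k + 1 - 1)%Z with (Z.of_nat m - k)%Z in I3 by lia.
  unfold qbinom.
  replace (Z.of_nat (S m) + k)%Z with (Z.of_nat m + k + 1)%Z by lia.
  replace (Z.of_nat (S m) - k)%Z with (Z.of_nat m - k + 1)%Z by lia.
  replace (Z.of_nat m + (k - 1))%Z with (Z.of_nat m + k - 1)%Z by lia.
  replace (Z.of_nat m - (k - 1))%Z with (Z.of_nat m - k + 1)%Z by lia.
  replace (Z.of_nat m + (k + 1))%Z with (Z.of_nat m + k + 1)%Z by lia.
  replace (Z.of_nat m - (k + 1))%Z with (Z.of_nat m - k - 1)%Z by lia.
  replace (2 * S m)%nat with (S (S (2 * m))) by lia.
  rewrite I2, I4, I1, I3.
  change (qpoch_fin (Cexp v) (Cexp v) (S (S (2 * m))))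
    with (qpoch_fin (Cexp v) (Cexp v) (2 * m) * (1 - Cexp v * Cexp v ^ (2 * m))
          * (1 - Cexp v * (Cexp v * Cexp v ^ (2 * m))))%C.
  rewrite EXY.
  set (P := qpoch_fin _ _ _). set (J1 := iqfact _ _). set (J2 := iqfact _ _).
  set (Q := Cexp v) in *.
  transitivity ((1 + Q * (X * Y)) * (jtp_term u v k * (P * ((1 - Q * X) * J1 * ((1 - Q * Y) * J2))))
    + (- (Cexp u * Q ^ m * jtp_term u v (k - 1)) * (P * ((1 - X) * ((1 - Q * X) * J1) * J2))
      + - (Cexp (v - u) * Q ^ m * jtp_term u v (k + 1)) * (P * (J1 * ((1 - Y) * ((1 - Q * Y) * J2))))))%C.
  - rewrite Em, Ep. ring.
  - ring.
Qed.

(** The finite triple product, a form of the q-binomial theorem. As [n] exceeds [m], the boundary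
    terms produced by the shifts in [jtp_step] lie outside the support of the binomials. *)
Lemma jtp_finite (u v : C) (m n : nat) : Re v < 0 -> (m < n)%nat ->
  window (fun k => (jtp_term u v k * qbinom (Cexp v) m k)%C) n
  = (qpoch_fin (Cexp u) (Cexp v) m * qpoch_fin (Cexp (v - u)) (Cexp v) m)%C.
Proof.
  intros Hv. revert n. induction m as [|m IH]; intros n Hn.
  - assert (E : forall n, window (fun k => (jtp_term u v k * qbinom (Cexp v) 0 k)%C) (S n) = 1%C).
    { clear n Hn. intros n. induction n as [|n IHn].
      - unfold window. simpl. rewrite (qbinom_out (Cexp v) 0 (-1)) by (simpl; lia).
        unfold jtp_term, qbinom, iqfact; simpl.
        replace (RtoC (PI * 0) * Ci + v * RtoC (0 * (0 - 1) / 2) + u * 0)%C with (RtoC 0)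
          by (apply C_eq; simpl; field).
        rewrite Cexp_0. field.
      - rewrite window_S, IHn, !qbinom_out by lia. ring. }
    destruct n as [|n]; [lia|]. rewrite E. simpl. ring.
  - set (F := fun k => (jtp_term u v k * qbinom (Cexp v) m k)%C).
    rewrite (window_ext _ (fun k =>
      ((1 + Cexp v * Cexp v ^ (2 * m)) * F k
       + (- (Cexp u * Cexp v ^ m) * F (k - 1)%Z + - (Cexp (v - u) * Cexp v ^ m) * F (k + 1)%Z))%C) n)
      by (intros k _; apply jtp_step, Hv).
    rewrite !window_plus, !window_scal, window_succ, window_pred.
    assert (HF : forall k, (Z.of_nat m < Z.abs k)%Z -> F k = 0%C).
    { intros k Hk. unfold F. rewrite qbinom_out by exact Hk. ring. }
    rewrite (HF (- Z.of_nat n - 1)%Z), (HF (Z.of_nat n - 1)%Z),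
      (HF (- Z.of_nat n)%Z), (HF (Z.of_nat n)) by lia.
    unfold F. rewrite IH by lia.
    change (qpoch_fin (Cexp u) (Cexp v) (S m))
      with (qpoch_fin (Cexp u) (Cexp v) m * (1 - Cexp u * Cexp v ^ m))%C.
    change (qpoch_fin (Cexp (v - u)) (Cexp v) (S m))
      with (qpoch_fin (Cexp (v - u)) (Cexp v) m * (1 - Cexp (v - u) * Cexp v ^ m))%C.
    assert (E : (Cexp (v - u) * Cexp u)%C = Cexp v).
    { rewrite <- Cexp_plus. f_equal. ring. }
    replace (2 * m)%nat with (m + m)%nat by lia. rewrite Cpow_add_r.
    rewrite <- E at 1. ring.
Qed.

Lemma iqfact_lim (Q : C) (k : Z) : Cmod Q < 1 ->
  is_Clim (fun m => iqfact Q (Z.of_nat m + k)) (/ qpoch Q Q)%C /\ qpoch Q Q <> 0%C.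
Proof.
  intros HQ. destruct (qpoch_fin_lower Q HQ) as [d [Hd Hn]].
  assert (HP := qpoch_fin_lim Q Q HQ). set (P := qpoch Q Q) in *.
  assert (HdP : d <= Cmod P).
  { assert (H : Rbar_le d (Cmod P + 0)).
    { apply is_lim_seq_le with (fun _ => d) (fun n => Cmod P + Cmod (qpoch_fin Q Q n - P)).
      - intros n. eapply Rle_trans; [apply (Hn n)|].
        replace (qpoch_fin Q Q n) with (P + (qpoch_fin Q Q n - P))%C at 1 by ring.
        apply Cmod_triangle.
      - apply is_lim_seq_const.
      - apply is_lim_seq_plus'; [apply is_lim_seq_const|exact HP]. }
    simpl in H; lra. }
  assert (HP0 : P <> 0%C) by (intros H; rewrite H, Cmod_0 in HdP; lra).
  split; [|exact HP0].
  apply is_Clim_ext_loc with (fun m => (/ qpoch_fin Q Q (Z.to_nat (Z.of_nat m + k)))%C)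
    (Z.to_nat (Z.abs k)).
  { intros n Hnk. unfold iqfact. destruct (Z.leb_spec 0 (Z.of_nat n + k)); [reflexivity|lia]. }
  apply (is_Clim_comp (fun n => (/ qpoch_fin Q Q n)%C) _ (fun m => Z.to_nat (Z.of_nat m + k))).
  { intros N. exists (N + Z.to_nat (Z.abs k))%nat. intros n H. lia. }
  apply is_Clim_le with (fun n => / (d * d) * Cmod (qpoch_fin Q Q n - P)).
  - intros n. assert (Hqn := qpoch_fin_neq_0 Q n HQ).
    replace (/ qpoch_fin Q Q n - / P)%C with ((- (qpoch_fin Q Q n - P)) / (qpoch_fin Q Q n * P))%C
      by (field; split; assumption).
    rewrite Cmod_div, Cmod_opp, Cmod_mult.
    + unfold Rdiv. rewrite Rmult_comm. apply Rmult_le_compat_r; [apply Cmod_ge_0|].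
      apply Rinv_le_contravar; [nra|]. specialize (Hn n).
      apply Rmult_le_compat; lra.
    + apply Cmult_neq_0; assumption.
  - rewrite <- (Rmult_0_r (/ (d * d))). apply is_lim_seq_mult'; [apply is_lim_seq_const|exact HP].
Qed.

Lemma iqfact_bound (Q : C) : Cmod Q < 1 -> exists M, forall k, Cmod (iqfact Q k) <= M.
Proof.
  intros HQ. destruct (qpoch_fin_lower Q HQ) as [d [Hd Hn]]. exists (/ d). intros k.
  unfold iqfact. destruct (0 <=? k)%Z.
  - rewrite Cmod_inv by (apply qpoch_fin_neq_0, HQ). apply Rinv_le_contravar; [exact Hd|apply Hn].
  - rewrite Cmod_0. left; apply Rinv_0_lt_compat, Hd.
Qed.

Lemma jtp_term_dominated (u v : C) : Re v < 0 -> exists M, dominated (jtp_term u v) M.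
Proof.
  intros Hv. apply (dominated_Cexp _ (- Re v / 2) (Re u - Re v / 2) 0); [lra|].
  intros k. destruct u as [u1 u2], v as [v1 v2]; simpl. field.
Qed.

(** Limit of [jtp_finite]: the Gaussian binomials are bounded uniformly in m and k and tend to 1 /
    (Q; Q)_oo, so Tannery's theorem applies, and this constant supplies the third product. *)
Lemma jacobi_triple_product (u v : C) : Re v < 0 ->
  is_sumZ (jtp_term u v) (qpochs [Cexp u; Cexp (v - u); Cexp v] (Cexp v)).
Proof.
  intros Hv. assert (HQ := Cmod_Cexp_lt_1 v Hv).
  destruct (jtp_term_dominated u v Hv) as [M HM].
  destruct (dominated_sum _ _ HM) as [s [Hs _]].
  destruct (iqfact_bound _ HQ) as [B HB].
  set (Q := Cexp v) in *. set (P := qpoch Q Q).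
  assert (HP0 : P <> 0%C) by apply (iqfact_lim Q 0 HQ).
  assert (HPlim : is_Clim (qpoch_fin Q Q) P) by (apply qpoch_fin_lim, HQ).
  assert (Hlim : is_Clim
     (fun m => window (fun k => (jtp_term u v k * qbinom Q m k)%C) (S m)) (/ P * s)%C).
  { apply is_sumZ_Tannery with (f := fun k => (/ P * jtp_term u v k)%C)
      (M := M * (exp (Cmod Q / (1 - Cmod Q)) * (B * B))).
    - intros n; lia.
    - intros m k. unfold qbinom. rewrite !Cmod_mult.
      replace (M * (exp (Cmod Q / (1 - Cmod Q)) * (B * B)) / (1 + IZR k ^ 2))
        with (M / (1 + IZR k ^ 2) * (exp (Cmod Q / (1 - Cmod Q)) * (B * B)))
        by (field; generalize (pow2_ge_0 (IZR k)); lra).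
      repeat (apply Rmult_le_compat;
        repeat apply Rmult_le_pos; try apply Cmod_ge_0; try apply HB; try apply HM).
      apply qpoch_fin_bound, HQ.
    - intros k.
      replace (/ P * jtp_term u v k)%C with (jtp_term u v k * (P * (/ P * / P)))%C
        by (field; exact HP0).
      apply is_Clim_mult; [apply is_Clim_const|].
      apply is_Clim_mult; [apply (is_Clim_subseq (qpoch_fin Q Q) P (fun m => (2 * m)%nat));
        [intros; lia|exact HPlim]|].
      apply is_Clim_mult; [apply iqfact_lim, HQ|apply (iqfact_lim Q (- k)), HQ].
    - apply is_sumZ_scal, Hs. }
  assert (E : (/ P * s)%C = (qpoch (Cexp u) Q * qpoch (Cexp (v - u)) Q)%C).
  { apply is_Clim_unique with (1 := Hlim).
    apply is_Clim_ext with
      (fun m => (qpoch_fin (Cexp u) Q m * qpoch_fin (Cexp (v - u)) Q m)%C).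
    - intros m. symmetry. apply jtp_finite; [exact Hv|lia].
    - apply is_Clim_mult; apply qpoch_fin_lim, HQ. }
  replace (qpochs [Cexp u; Cexp (v - u); Q] Q) with s; [exact Hs|].
  simpl. fold P. rewrite Cmult_1_r, Cmult_assoc, <- E. field. exact HP0.
Qed.

(** * Complex-valued Riemann integrals *)

(** Componentwise, so that the theory of real integrals applies; the price is the factor 2 in
    [CInt_bound]. *)
Definition CInt (f : R -> C) (a b : R) : C :=
  (RInt (fun x => Re (f x)) a b, RInt (fun x => Im (f x)) a b).

Definition Ccont (f : R -> C) : Prop :=
  (forall x, continuous (fun x => Re (f x)) x) /\ (forall x, continuous (fun x => Im (f x)) x).

Lemma Ccont_const (c : C) : Ccont (fun _ => c).
Proof. split; intros x; apply continuous_const. Qed.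

Lemma Ccont_RtoC (f : R -> R) : (forall x, continuous f x) -> Ccont (fun x => RtoC (f x)).
Proof. intros Hf; split; intros x; simpl; [apply Hf|apply continuous_const]. Qed.

Lemma Ccont_id : Ccont RtoC.
Proof. apply (Ccont_RtoC (fun x => x)). intros x; apply continuous_id. Qed.

Lemma Ccont_plus (f g : R -> C) : Ccont f -> Ccont g -> Ccont (fun x => (f x + g x)%C).
Proof.
  intros [Hf1 Hf2] [Hg1 Hg2]; split; intros x.
  - apply (continuous_plus (V := R_NormedModule)); auto.
  - apply (continuous_plus (V := R_NormedModule)); auto.
Qed.

Lemma Ccont_mult (f g : R -> C) : Ccont f -> Ccont g -> Ccont (fun x => (f x * g x)%C).
Proof.
  intros [Hf1 Hf2] [Hg1 Hg2]; split; intros x.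
  - apply (continuous_minus (V := R_NormedModule)); apply (continuous_mult (K := R_AbsRing)); auto.
  - apply (continuous_plus (V := R_NormedModule)); apply (continuous_mult (K := R_AbsRing)); auto.
Qed.

Lemma Ccont_comp (f : R -> C) (g : R -> R) :
  Ccont f -> (forall x, continuous g x) -> Ccont (fun x => f (g x)).
Proof.
  intros [Hf1 Hf2] Hg; split; intros x.
  - apply (continuous_comp g (fun x => Re (f x))); auto.
  - apply (continuous_comp g (fun x => Im (f x))); auto.
Qed.

Lemma Ccont_Cexp (f : R -> C) : Ccont f -> Ccont (fun x => Cexp (f x)).
Proof.
  intros [Hf1 Hf2].
  assert (He : forall x, continuous (fun x => exp (Re (f x))) x).
  { intros x. apply (continuous_comp (fun x => Re (f x)) exp); [auto|].
    apply continuity_pt_filterlim, derivable_continuous_pt, derivable_pt_exp. }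
  split; intros x.
  - apply (continuous_mult (K := R_AbsRing) (fun x => exp (Re (f x))) (fun x => cos (Im (f x)))).
    + apply He.
    + apply (continuous_comp (fun x => Im (f x)) cos); [auto|apply continuous_cos].
  - apply (continuous_mult (K := R_AbsRing) (fun x => exp (Re (f x))) (fun x => sin (Im (f x)))).
    + apply He.
    + apply (continuous_comp (fun x => Im (f x)) sin); [auto|apply continuous_sin].
Qed.

Lemma Ccont_csum (f : nat -> R -> C) (n : nat) :
  (forall i, Ccont (f i)) -> Ccont (fun x => csum (fun i => f i x) n).
Proof.
  intros Hf. induction n as [|n IH]; simpl; [apply Ccont_const|].
  apply Ccont_plus; auto.
Qed.

Lemma Ccont_window (f : Z -> R -> C) (n : nat) :
  (forall k, Ccont (f k)) -> Ccont (fun x => window (fun k => f k x) n).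
Proof.
  intros Hf. apply (Ccont_csum (fun i => f (Z.of_nat i - Z.of_nat n)%Z)). auto.
Qed.

Lemma cont_ex_RInt (f : R -> R) (a b : R) : (forall x, continuous f x) -> ex_RInt f a b.
Proof. intros Hf. apply (ex_RInt_continuous (V := R_CompleteNormedModule)). auto. Qed.

Lemma CInt_ext (f g : R -> C) (a b : R) :
  a <= b -> (forall x, a < x < b -> f x = g x) -> CInt f a b = CInt g a b.
Proof.
  intros Hab H. unfold CInt. f_equal; apply RInt_ext; intros x;
    rewrite Rmin_left, Rmax_right by exact Hab; intros Hx; rewrite H; auto.
Qed.

Lemma CInt_plus (f g : R -> C) (a b : R) : Ccont f -> Ccont g ->
  CInt (fun x => (f x + g x)%C) a b = (CInt f a b + CInt g a b)%C.
Proof.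
  intros [Hf1 Hf2] [Hg1 Hg2]. apply C_eq; simpl.
  - apply (RInt_plus (V := R_CompleteNormedModule)); apply cont_ex_RInt; auto.
  - apply (RInt_plus (V := R_CompleteNormedModule)); apply cont_ex_RInt; auto.
Qed.

Lemma CInt_scal (c : C) (f : R -> C) (a b : R) : Ccont f ->
  CInt (fun x => (c * f x)%C) a b = (c * CInt f a b)%C.
Proof.
  intros [Hf1 Hf2].
  assert (Hs : forall (k : R) (h : R -> R), (forall x, continuous h x) ->
            is_RInt (fun x => k * h x) a b (k * RInt h a b)).
  { intros k h Hh. apply (is_RInt_scal h a b k), (RInt_correct (V := R_CompleteNormedModule)).
    apply cont_ex_RInt, Hh. }
  apply C_eq; simpl; apply is_RInt_unique.
  - apply (is_RInt_minus (V := R_NormedModule)); apply Hs; auto.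
  - apply (is_RInt_plus (V := R_NormedModule)); apply Hs; auto.
Qed.

Lemma CInt_const (c : C) (a b : R) : CInt (fun _ => c) a b = (RtoC (b - a) * c)%C.
Proof.
  assert (H : forall v : R, RInt (fun _ => v) a b = (b - a) * v).
  { intros v. apply (RInt_const (V := R_CompleteNormedModule)). }
  unfold CInt. rewrite !H. destruct c as [c1 c2]. apply C_eq; simpl; ring.
Qed.

Lemma CInt_csum (f : nat -> R -> C) (n : nat) (a b : R) : (forall i, Ccont (f i)) ->
  CInt (fun x => csum (fun i => f i x) n) a b = csum (fun i => CInt (f i) a b) n.
Proof.
  intros Hf. induction n as [|n IH]; simpl.
  - rewrite CInt_const. ring.
  - rewrite CInt_plus, IH; [reflexivity|apply Ccont_csum, Hf|apply Hf].
Qed.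

Lemma CInt_Chasles (f : R -> C) (a b c : R) : Ccont f ->
  (CInt f a b + CInt f b c)%C = CInt f a c.
Proof.
  intros [Hf1 Hf2]. apply C_eq; simpl.
  - apply (RInt_Chasles (V := R_CompleteNormedModule)); apply cont_ex_RInt; auto.
  - apply (RInt_Chasles (V := R_CompleteNormedModule)); apply cont_ex_RInt; auto.
Qed.

Lemma CInt_comp_lin (f : R -> C) (u v a b : R) : Ccont f ->
  CInt (fun x => (RtoC u * f (u * x + v)%R)%C) a b = CInt f (u * a + v) (u * b + v).
Proof.
  intros [Hf1 Hf2]. apply C_eq; simpl.
  - rewrite <- (RInt_comp_lin (V := R_CompleteNormedModule)) by (apply cont_ex_RInt; auto).
    apply RInt_ext. intros x _. unfold scal; simpl; unfold mult, Re, Im; simpl. ring.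
  - rewrite <- (RInt_comp_lin (V := R_CompleteNormedModule)) by (apply cont_ex_RInt; auto).
    apply RInt_ext. intros x _. unfold scal; simpl; unfold mult, Re, Im; simpl. ring.
Qed.

Lemma CInt_shift (f : R -> C) (v a b : R) : Ccont f ->
  CInt (fun x => f (x + v)) a b = CInt f (a + v) (b + v).
Proof.
  intros Hf. assert (H := CInt_comp_lin f 1 v a b Hf). rewrite !Rmult_1_l in H.
  rewrite <- H. unfold CInt. f_equal; apply RInt_ext; intros x _; rewrite Rmult_1_l, Cmult_1_l;
    reflexivity.
Qed.

Lemma CInt_bound (f : R -> C) (a b M : R) : a <= b -> Ccont f ->
  (forall x, a <= x <= b -> Cmod (f x) <= M) -> Cmod (CInt f a b) <= 2 * (b - a) * M.
Proof.
  intros Hab [Hf1 Hf2] HM. eapply Rle_trans; [apply Cmod_le_abs|]. simpl.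
  assert (H1 : Rabs (RInt (fun x => Re (f x)) a b) <= (b - a) * M).
  { apply abs_RInt_le_const; [exact Hab|apply cont_ex_RInt; auto|].
    intros x Hx. eapply Rle_trans; [apply re_le_Cmod|auto]. }
  assert (H2 : Rabs (RInt (fun x => Im (f x)) a b) <= (b - a) * M).
  { apply abs_RInt_le_const; [exact Hab|apply cont_ex_RInt; auto|].
    intros x Hx. eapply Rle_trans; [apply im_le_Cmod|auto]. }
  simpl in *. lra.
Qed.

Lemma uniform_limit_continuous (u : nat -> R -> R) (f : R -> R) (e : nat -> R) (x : R) :
  (forall n y, Rabs (u n y - f y) <= e n) -> is_lim_seq e 0 ->
  (forall n, continuous (u n) x) -> continuous f x.
Proof.
  intros Hu He Hc. apply filterlim_locally. intros eps.
  assert (Hpos : 0 < eps / 3) by (generalize (cond_pos eps); lra).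
  apply is_lim_seq_spec in He. destruct (He (mkposreal _ Hpos)) as [N HN].
  specialize (HN N (Nat.le_refl N)). simpl in HN. rewrite Rminus_0_r in HN.
  apply Rabs_def2 in HN. destruct HN as [HN _].
  assert (Hl := proj1 (filterlim_locally (u N) (u N x)) (Hc N) (mkposreal _ Hpos)).
  revert Hl. apply filter_imp. intros y Hy.
  change (Rabs (u N y - u N x) < eps / 3) in Hy. change (Rabs (f y - f x) < eps).
  replace (f y - f x) with (- (u N y - f y) + ((u N y - u N x) + (u N x - f x))) by ring.
  eapply Rle_lt_trans; [apply Rabs_triang|]. rewrite Rabs_Ropp.
  assert (H1 := Hu N x). assert (H2 := Hu N y).
  assert (H3 := Rabs_triang (u N y - u N x) (u N x - f x)). lra.
Qed.

(** The Weierstrass M-test: a domination constant independent of [x] gives a uniform rate of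
    convergence. *)
Lemma normal_sum_cont (f : Z -> R -> C) (S : R -> C) (M : R) :
  (forall k, Ccont (f k)) -> (forall x, dominated (fun k => f k x) M) ->
  (forall x, is_sumZ (fun k => f k x) (S x)) ->
  Ccont S.
Proof.
  intros f_cont f_dom f_sum.
  assert (Hr : forall n x, Cmod (window (fun k => f k x) n - S x) <= 8 * M / (INR n + 1)).
  { intros n x. apply (dominated_rate (fun k => f k x)); auto. }
  split; intros x.
  - apply (uniform_limit_continuous (fun n x => Re (window (fun k => f k x) n)) _
            (fun n => 8 * M / (INR n + 1))); [|apply is_lim_seq_div_S|].
    + intros n y. eapply Rle_trans; [|apply Hr].
      apply (re_le_Cmod (window (fun k => f k y) n - S y)).
    + intros n. exact (proj1 (Ccont_window f n f_cont) x).
  - apply (uniform_limit_continuous (fun n x => Im (window (fun k => f k x) n)) _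
            (fun n => 8 * M / (INR n + 1))); [|apply is_lim_seq_div_S|].
    + intros n y. eapply Rle_trans; [|apply Hr].
      apply (im_le_Cmod (window (fun k => f k y) n - S y)).
    + intros n. exact (proj2 (Ccont_window f n f_cont) x).
Qed.

Lemma normal_sum_CInt (f : Z -> R -> C) (S : R -> C) (M a b : R) :
  (forall k, Ccont (f k)) -> (forall x, dominated (fun k => f k x) M) ->
  (forall x, is_sumZ (fun k => f k x) (S x)) ->
  a <= b -> is_sumZ (fun k => CInt (f k) a b) (CInt S a b).
Proof.
  intros f_cont f_dom f_sum Hab.
  assert (HS := normal_sum_cont f S M f_cont f_dom f_sum).
  apply is_Clim_le with (fun n => 2 * (b - a) * (8 * M) / (INR n + 1)); [|apply is_lim_seq_div_S].
  intros n.
  assert (HW := Ccont_window f n f_cont).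
  assert (E : window (fun k => CInt (f k) a b) n = CInt (fun x => window (fun k => f k x) n) a b).
  { symmetry. apply (CInt_csum (fun i => f (Z.of_nat i - Z.of_nat n)%Z)). auto. }
  rewrite E.
  replace (CInt (fun x => window (fun k => f k x) n) a b - CInt S a b)%C
    with (CInt (fun x => (window (fun k => f k x) n + (- (1)) * S x)%C) a b).
  - replace (2 * (b - a) * (8 * M) / (INR n + 1)) with (2 * (b - a) * (8 * M / (INR n + 1)))
      by (unfold Rdiv; ring).
    apply CInt_bound; [exact Hab| |].
    + apply Ccont_plus; [exact HW|]. apply Ccont_mult; [apply Ccont_const|exact HS].
    + intros x _.
      replace (window (fun k => f k x) n + (- (1)) * S x)%C
        with (window (fun k => f k x) n - S x)%C by ring.
      apply (dominated_rate (fun k => f k x)); auto.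
  - rewrite CInt_plus, CInt_scal; [ring|exact HS|exact HW|].
    apply Ccont_mult; [apply Ccont_const|exact HS].
Qed.

(** * Fourier coefficients and Poisson summation *)

Lemma cos_pow_cont (N : nat) (x : R) : continuous (fun y => cos (PI * y) ^ N) x.
Proof.
  apply (ex_derive_continuous (fun y => cos (PI * y) ^ N)). auto_derive. exact I.
Qed.

Definition wallis (N : nat) : R := RInt (fun y => cos (PI * y) ^ (2 * N)) (- (1 / 2)) (1 / 2).

(** Integrates the derivative of sin (PI y) cos (PI y)^(2N+1) / PI, whose boundary values vanish
    because cos (PI/2) = 0. *)
Lemma wallis_S (N : nat) : (2 * INR N + 2) * wallis (S N) = (2 * INR N + 1) * wallis N.
Proof.
  assert (Hd : is_RInt (fun y => (2 * INR N + 2) * cos (PI * y) ^ (2 * S N)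
                               - (2 * INR N + 1) * cos (PI * y) ^ (2 * N))
       (- (1 / 2)) (1 / 2)
       (minus (sin (PI * (1 / 2)) * cos (PI * (1 / 2)) ^ (2 * N + 1) / PI)
              (sin (PI * - (1 / 2)) * cos (PI * - (1 / 2)) ^ (2 * N + 1) / PI))).
  { apply (is_RInt_derive (V := R_CompleteNormedModule)
      (fun y => sin (PI * y) * cos (PI * y) ^ (2 * N + 1) / PI)).
    - intros y _. auto_derive; [exact I|].
      replace (Init.Nat.pred (N + (N + 0) + 1)) with (2 * N)%nat by lia.
      replace (N + (N + 0) + 1)%nat with (2 * N + 1)%nat by lia.
      replace (2 * S N)%nat with (2 * N + 2)%nat by lia.
      rewrite plus_INR, mult_INR, !pow_add. change (INR 2) with 2. change (INR 1) with 1.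
      assert (Hs := sin2_cos2 (PI * y)). unfold Rsqr in Hs.
      set (P := cos (PI * y) ^ (2 * N)). set (c := cos (PI * y)) in *. set (z := sin (PI * y)) in *.
      transitivity (c * c * P - (2 * INR N + 1) * P * (z * z)).
      + simpl. field. apply PI_neq0.
      + replace (z * z) with (1 - c * c) by lra. simpl. ring.
    - intros y _. apply (continuous_minus (V := R_NormedModule)
        (fun y => (2 * INR N + 2) * cos (PI * y) ^ (2 * S N))
        (fun y => (2 * INR N + 1) * cos (PI * y) ^ (2 * N)));
      apply (continuous_mult (K := R_AbsRing) (fun _ => _) (fun y => cos (PI * y) ^ _));
      try apply continuous_const; apply cos_pow_cont. }
  assert (Hd' := is_RInt_minus (V := R_NormedModule) _ _ _ _ _ _
    (is_RInt_scal _ _ _ (2 * INR N + 2) _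
       (RInt_correct (V := R_CompleteNormedModule) _ _ _
         (cont_ex_RInt _ (- (1 / 2)) (1 / 2) (cos_pow_cont (2 * S N)))))
    (is_RInt_scal _ _ _ (2 * INR N + 1) _
       (RInt_correct (V := R_CompleteNormedModule) _ _ _
         (cont_ex_RInt _ (- (1 / 2)) (1 / 2) (cos_pow_cont (2 * N)))))).
  apply (is_RInt_unique (V := R_CompleteNormedModule)) in Hd.
  apply (is_RInt_unique (V := R_CompleteNormedModule)) in Hd'.
  assert (E : (2 * INR N + 2) * wallis (S N) - (2 * INR N + 1) * wallis N = 0).
  { etransitivity; [symmetry; exact Hd'|]. etransitivity; [exact Hd|].
    unfold minus, plus, opp; simpl.
    replace (PI * - (1 / 2)) with (- (PI / 2)) by field.
    replace (PI * (1 / 2)) with (PI / 2) by field.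
    rewrite cos_neg, cos_PI2, pow_add. simpl. unfold Rdiv. rewrite !Rmult_0_l, !Rmult_0_r. ring. }
  lra.
Qed.

Lemma wallis_pos (N : nat) : 0 < wallis N.
Proof.
  induction N as [|N IH].
  - unfold wallis. simpl. assert (H := RInt_const (V := R_CompleteNormedModule) (- (1 / 2)) (1 / 2) 1).
    unfold scal in H; simpl in H; unfold mult in H; simpl in H. rewrite H. lra.
  - assert (H := wallis_S N). assert (HN := pos_INR N). nra.
Qed.

(* [cos (pi y) ^ (2 N)] concentrates at 0: by [wallis_S], multiplying it by
   [sin (pi y) ^ 2] shrinks its integral by the factor [1 / (2 N + 2)], while
   [E y >= eps - K sin (pi y) ^ 2] with [eps > 0] if [E 0 > 0]. *)
Lemma cos_moments_pos (E : R -> R) :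
  (forall x, continuous E x) ->
  (forall N, RInt (fun y => E y * cos (PI * y) ^ (2 * N)) (- (1 / 2)) (1 / 2) = 0) ->
  E 0 <= 0.
Proof.
  intros Hc H0. apply Rnot_lt_le. intros Hpos.
  set (eps := E 0 / 2).
  assert (Heps : 0 < eps) by (unfold eps; lra).
  destruct (proj1 (filterlim_locally E (E 0)) (Hc 0) (mkposreal _ Heps)) as [d Hd].
  destruct (continuity_ab_min E (- (1 / 2)) (1 / 2)) as [m [Hm _]];
    [lra|intros c _; apply continuity_pt_filterlim, Hc|].
  set (d' := Rmin d (1 / 2)).
  assert (Hd' : 0 < d' <= 1 / 2).
  { unfold d'. split; [apply Rmin_glb_lt; [apply cond_pos|lra]|apply Rmin_r]. }
  assert (Hpi := PI_RGT_0).
  set (s := sin (PI * d') ^ 2).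
  assert (Hs : 0 < s).
  { apply pow_lt, sin_gt_0; nra. }
  (* Away from 0, where sin (PI y)^2 >= s, this [K] pushes the lower bound below the minimum [E m];
     near 0 continuity alone gives E y >= eps. *)
  set (K := Rmax 0 ((eps - E m) / s)).
  assert (HK : 0 <= K) by apply Rmax_l.
  assert (Hlow : forall y, - (1 / 2) <= y <= 1 / 2 -> eps - K * sin (PI * y) ^ 2 <= E y).
  { intros y Hy. destruct (Rlt_dec (Rabs y) d) as [Hyd|Hyd].
    - assert (Hb : Rabs (E y - E 0) < eps).
      { apply Hd. change (Rabs (y - 0) < d). rewrite Rminus_0_r. exact Hyd. }
      apply Rabs_def2 in Hb. assert (0 <= K * sin (PI * y) ^ 2).
      { apply Rmult_le_pos; [exact HK|apply pow2_ge_0]. }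
      unfold eps in *. lra.
    - assert (Hsy : s <= sin (PI * y) ^ 2).
      { assert (Hdy : d' <= Rabs y).
        { apply Rle_trans with d; [apply Rmin_l|lra]. }
        assert (Hy2 : Rabs y <= 1 / 2) by (apply Rabs_le; lra).
        replace (sin (PI * y) ^ 2) with (sin (PI * Rabs y) ^ 2).
        - unfold s. apply pow_incr. split; [left; apply sin_gt_0; nra|].
          apply sin_incr_1; nra.
        - unfold Rabs. destruct (Rcase_abs y); [|reflexivity].
          replace (PI * - y) with (- (PI * y)) by ring. rewrite sin_neg. ring. }
      assert (HKs : eps - E m <= K * s).
      { apply Rle_trans with ((eps - E m) / s * s); [right; field; lra|].
        apply Rmult_le_compat_r; [lra|apply Rmax_r]. }
      assert (K * s <= K * sin (PI * y) ^ 2) by (apply Rmult_le_compat_l; assumption).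
      specialize (Hm y Hy). lra. }
  destruct (INR_unbounded (K / eps)) as [N HN].
  assert (HW := wallis_pos N). assert (HWS := wallis_S N). assert (HNp := pos_INR N).
  assert (Hle : (eps - K) * wallis N + K * wallis (S N)
                <= RInt (fun y => E y * cos (PI * y) ^ (2 * N)) (- (1 / 2)) (1 / 2)).
  { assert (Hint := is_RInt_plus (V := R_NormedModule) _ _ _ _ _ _
      (is_RInt_scal _ _ _ (eps - K) _
         (RInt_correct (V := R_CompleteNormedModule) _ _ _
           (cont_ex_RInt _ (- (1 / 2)) (1 / 2) (cos_pow_cont (2 * N)))))
      (is_RInt_scal _ _ _ K _
         (RInt_correct (V := R_CompleteNormedModule) _ _ _
           (cont_ex_RInt _ (- (1 / 2)) (1 / 2) (cos_pow_cont (2 * S N)))))).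
    eapply is_RInt_le; [|exact Hint| |].
    - lra.
    - apply (RInt_correct (V := R_CompleteNormedModule)).
      apply cont_ex_RInt. intros x.
      apply (continuous_mult (K := R_AbsRing) E (fun y => cos (PI * y) ^ (2 * N)));
        [apply Hc|apply cos_pow_cont].
    - intros y Hy. unfold plus, scal; simpl; unfold mult; simpl.
      replace (N + S (N + 0))%nat with (S (2 * N)) by lia. simpl.
      assert (Hs2 := sin2_cos2 (PI * y)). unfold Rsqr in Hs2.
      specialize (Hlow y ltac:(lra)).
      replace (N + (N + 0))%nat with (2 * N)%nat by lia.
      assert (HP : 0 <= cos (PI * y) ^ (2 * N)).
      { rewrite pow_mult. apply pow_le, pow2_ge_0. }
      set (P := cos (PI * y) ^ (2 * N)) in *.
      replace ((eps - K) * P + K * (cos (PI * y) * (cos (PI * y) * P)))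
        with ((eps - K * (1 - cos (PI * y) * cos (PI * y))) * P) by ring.
      apply Rmult_le_compat_r; [exact HP|].
      replace (1 - cos (PI * y) * cos (PI * y)) with (sin (PI * y) ^ 2) by (simpl; lra).
      exact Hlow. }
  rewrite H0 in Hle.
  assert (HK2 : K < eps * INR N).
  { replace K with (K / eps * eps) by (field; lra). rewrite (Rmult_comm eps).
    apply Rmult_lt_compat_r; lra. }
  nra.
Qed.

Definition efun (k : Z) (y : R) : C := Cexp (RtoC (2 * PI * IZR k * y) * Ci)%C.

Lemma efun_plus (k m : Z) (y : R) : (efun k y * efun m y)%C = efun (k + m) y.
Proof.
  unfold efun. rewrite <- Cexp_plus. f_equal. rewrite plus_IZR. apply C_eq; simpl; ring.
Qed.

Lemma efun_0 (y : R) : efun 0 y = 1%C.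
Proof.
  unfold efun. replace (RtoC (2 * PI * 0 * y) * Ci)%C with (RtoC 0) by (apply C_eq; simpl; ring).
  apply Cexp_0.
Qed.

Lemma efun_at_0 (k : Z) : efun k 0 = 1%C.
Proof.
  unfold efun. replace (RtoC (2 * PI * IZR k * 0) * Ci)%C with (RtoC 0) by (apply C_eq; simpl; ring).
  apply Cexp_0.
Qed.

Lemma efun_shift (k n : Z) (y : R) : efun k (y + IZR n) = efun k y.
Proof.
  unfold efun. apply Cexp_eq_mod with (k * n)%Z. rewrite mult_IZR. apply C_eq; simpl; ring.
Qed.

Lemma Cmod_efun (k : Z) (y : R) : Cmod (efun k y) = 1.
Proof.
  unfold efun. rewrite Cmod_Cexp. simpl. rewrite <- exp_0. f_equal. ring.
Qed.

Lemma Ccont_efun (k : Z) : Ccont (efun k).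
Proof.
  apply Ccont_Cexp, Ccont_mult; [|apply Ccont_const]. apply Ccont_RtoC. intros x.
  apply (ex_derive_continuous (fun y => 2 * PI * IZR k * y)). auto_derive. exact I.
Qed.

Lemma CInt_efun (k : Z) : k <> 0%Z -> CInt (efun k) (- (1 / 2)) (1 / 2) = 0%C.
Proof.
  intros Hk. assert (Hk' : IZR k <> 0) by (apply not_0_IZR; exact Hk).
  assert (Hpi := PI_neq0). unfold CInt, efun; simpl.
  assert (Hs : sin (PI * IZR k) = 0) by (apply sin_eq_0_1; exists k; ring).
  apply C_eq; simpl; apply (is_RInt_unique (V := R_CompleteNormedModule)).
  - apply is_RInt_ext with (fun y => cos (2 * PI * IZR k * y)).
    { intros y _. replace (2 * PI * IZR k * y * 0 - 0 * 1) with 0 by ring. rewrite exp_0, Rmult_1_l.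
      f_equal; ring. }
    replace 0 with (minus (sin (2 * PI * IZR k * (1 / 2)) / (2 * PI * IZR k))
                          (sin (2 * PI * IZR k * - (1 / 2)) / (2 * PI * IZR k))).
    + apply (is_RInt_derive (V := R_CompleteNormedModule)
        (fun y => sin (2 * PI * IZR k * y) / (2 * PI * IZR k))).
      * intros y _. auto_derive; [exact I|]. field. split; assumption.
      * intros y _. apply (ex_derive_continuous (fun y => cos (2 * PI * IZR k * y))).
        auto_derive. exact I.
    + unfold minus, plus, opp; simpl.
      replace (2 * PI * IZR k * - (1 / 2)) with (- (PI * IZR k)) by field.
      replace (2 * PI * IZR k * (1 / 2)) with (PI * IZR k) by field.
      rewrite sin_neg, Hs. field. split; assumption.
  - apply is_RInt_ext with (fun y => sin (2 * PI * IZR k * y)).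
    { intros y _. replace (2 * PI * IZR k * y * 0 - 0 * 1) with 0 by ring. rewrite exp_0, Rmult_1_l.
      f_equal; ring. }
    replace 0 with (minus (- cos (2 * PI * IZR k * (1 / 2)) / (2 * PI * IZR k))
                          (- cos (2 * PI * IZR k * - (1 / 2)) / (2 * PI * IZR k))).
    + apply (is_RInt_derive (V := R_CompleteNormedModule)
        (fun y => - cos (2 * PI * IZR k * y) / (2 * PI * IZR k))).
      * intros y _. auto_derive; [exact I|]. field. split; assumption.
      * intros y _. apply (ex_derive_continuous (fun y => sin (2 * PI * IZR k * y))).
        auto_derive. exact I.
    + unfold minus, plus, opp; simpl.
      replace (2 * PI * IZR k * - (1 / 2)) with (- (PI * IZR k)) by field.
      replace (2 * PI * IZR k * (1 / 2)) with (PI * IZR k) by field.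
      rewrite cos_neg. field. split; assumption.
Qed.

Lemma cos_sqr_efun (y : R) :
  RtoC (cos (PI * y) ^ 2) = (1 / 2 + 1 / 4 * efun 1 y + 1 / 4 * efun (-1) y)%C.
Proof.
  rewrite RtoC_pow, RtoC_cos.
  assert (E1 : efun 1 y = (Cexp (RtoC (PI * y) * Ci) * Cexp (RtoC (PI * y) * Ci))%C).
  { unfold efun. rewrite <- Cexp_plus. f_equal. apply C_eq; simpl; ring. }
  assert (E2 : efun (-1) y = (Cexp (- (RtoC (PI * y) * Ci)) * Cexp (- (RtoC (PI * y) * Ci)))%C).
  { unfold efun. rewrite <- Cexp_plus. f_equal. apply C_eq; simpl; ring. }
  rewrite E1, E2. assert (E3 := Cexp_opp (RtoC (PI * y) * Ci)%C).
  set (X := Cexp (RtoC (PI * y) * Ci)%C) in *. set (Y := Cexp (- _)%C) in *.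
  replace (((X + Y) / 2) ^ 2)%C with (1 / 2 * (X * Y) + 1 / 4 * (X * X) + 1 / 4 * (Y * Y))%C.
  - rewrite E3. ring.
  - simpl. field.
Qed.

(** Multiplication by cos (PI y)^2 only mixes neighbouring frequencies, so all moments of D against
    cos (PI y)^(2N) vanish. Then [cos_moments_pos], applied to the real part of conj (D 0) D, whose
    value at 0 is |D 0|^2, forces D 0 = 0. *)
Lemma fourier_unique (D : R -> C) : Ccont D ->
  (forall k, CInt (fun y => (D y * efun k y)%C) (- (1 / 2)) (1 / 2) = 0%C) -> D 0 = 0%C.
Proof.
  intros HD H0.
  assert (Hcos : forall n, Ccont (fun y => RtoC (cos (PI * y) ^ n))).
  { intros n. apply Ccont_RtoC, cos_pow_cont. }
  (* The frequency [k] stays quantified in the induction, since a further factor cos (PI y)^2 calls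
     for the frequencies k, k+1 and k-1. *)
  assert (HN : forall N k,
    CInt (fun y => (D y * (RtoC (cos (PI * y) ^ (2 * N)) * efun k y))%C) (- (1 / 2)) (1 / 2) = 0%C).
  { induction N as [|N IH]; intros k.
    - rewrite <- (H0 k). apply CInt_ext; [lra|]. intros y _. simpl. ring.
    - set (T := fun j y => (D y * (RtoC (cos (PI * y) ^ (2 * N)) * efun j y))%C).
      assert (HT : forall j, Ccont (T j)).
      { intros j. apply Ccont_mult; [exact HD|apply Ccont_mult; [apply Hcos|apply Ccont_efun]]. }
      assert (HcT : forall c j, Ccont (fun y => (c * T j y)%C)).
      { intros c j. apply Ccont_mult; [apply Ccont_const|apply HT]. }
      rewrite (CInt_ext _ (fun y => (1 / 2 * T k y + (1 / 4 * T (1 + k)%Z y + 1 / 4 * T (-1 + k)%Z y))%C)).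
      + rewrite !CInt_plus, !CInt_scal; auto.
        * unfold T. rewrite !IH. ring.
        * apply Ccont_plus; auto.
      + lra.
      + intros y _. unfold T. replace (2 * S N)%nat with (2 + 2 * N)%nat by lia.
        rewrite pow_add, RtoC_mult, cos_sqr_efun, <- !efun_plus. ring. }
  destruct (Ceq_dec (D 0) 0) as [E|E]; [exact E|exfalso].
  apply Cmod_gt_0 in E.
  set (f := fun y => (Cconj (D 0) * D y)%C).
  assert (Hf : Ccont f) by (apply Ccont_mult; [apply Ccont_const|exact HD]).
  assert (Hle : Re (f 0) <= 0).
  { apply (cos_moments_pos (fun y => Re (f y))); [apply Hf|].
    intros N. assert (HH := HN N 0%Z).
    apply (f_equal (fun z => Cconj (D 0) * z)%C) in HH.
    rewrite <- CInt_scal in HH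
      by (apply Ccont_mult; [exact HD|apply Ccont_mult; [apply Hcos|apply Ccont_efun]]).
    apply (f_equal Re) in HH. rewrite Cmult_0_r in HH.
    change (Re 0%C) with 0 in HH. rewrite <- HH. symmetry.
    apply (RInt_ext (fun y =>
      Re (Cconj (D 0) * (D y * (RtoC (cos (PI * y) ^ (2 * N)) * efun 0 y)))%C)).
    intros y _. rewrite efun_0. unfold f, Re, Im; simpl. ring. }
  assert (Hf0 : Re (f 0) = Cmod (D 0) ^ 2).
  { rewrite Cmod2_alt. unfold f, Re, Im; simpl; ring. }
  rewrite Hf0 in Hle. assert (0 < Cmod (D 0) ^ 2) by (apply pow_lt, E). lra.
Qed.

Definition sumZ (f : Z -> C) : C := Clim_seq (window f).

Lemma dominated_sumZ (f : Z -> C) (M : R) : dominated f M -> is_sumZ f (sumZ f).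
Proof.
  intros Hf. destruct (dominated_sum f M Hf) as [s [Hs _]].
  unfold sumZ. rewrite (is_Clim_Clim_seq _ _ Hs). exact Hs.
Qed.

Lemma is_sumZ_sumZ (f : Z -> C) (s : C) : is_sumZ f s -> sumZ f = s.
Proof. apply is_Clim_Clim_seq. Qed.

Lemma csum_single (f : nat -> C) (n i : nat) :
  (i < n)%nat -> (forall j, j <> i -> f j = 0%C) -> csum f n = f i.
Proof.
  intros Hi Hf. induction n as [|n IH]; [lia|]. simpl.
  destruct (Nat.eq_dec i n) as [->|Hn].
  - rewrite csum_zero; [ring|]. intros j Hj. apply Hf. lia.
  - rewrite IH, (Hf n) by lia. ring.
Qed.

Lemma is_sumZ_single (f : Z -> C) (k : Z) :
  (forall m, m <> k -> f m = 0%C) -> is_sumZ f (f k).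
Proof.
  intros Hf. apply is_Clim_ext_loc with (fun _ => f k) (S (Z.to_nat (Z.abs k)));
    [|apply is_Clim_const].
  intros n Hn. unfold window. symmetry.
  rewrite (csum_single _ _ (Z.to_nat (k + Z.of_nat n))).
  - f_equal. lia.
  - lia.
  - intros j Hj. apply Hf. lia.
Qed.

(* Freezing [y] outside [-1/2, 1/2] makes the bounds on [F (y + n)] uniform in [y]. *)
Definition clamp (y : R) : R := Rmax (- (1 / 2)) (Rmin y (1 / 2)).

Lemma clamp_bounds (y : R) : - (1 / 2) <= clamp y <= 1 / 2.
Proof.
  unfold clamp. split; [apply Rmax_l|]. apply Rmax_lub; [lra|apply Rmin_r].
Qed.

Lemma clamp_id (y : R) : - (1 / 2) <= y <= 1 / 2 -> clamp y = y.
Proof. intros H. unfold clamp. rewrite Rmin_left, Rmax_right; lra. Qed.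

Lemma clamp_cont (x : R) : continuous clamp x.
Proof.
  apply filterlim_locally. intros eps. exists eps. intros y Hy.
  change (Rabs (y - x) < eps) in Hy. change (Rabs (clamp y - clamp x) < eps).
  eapply Rle_lt_trans; [|exact Hy]. unfold clamp, Rmax, Rmin.
  repeat destruct Rle_dec; unfold Rabs; repeat destruct Rcase_abs; lra.
Qed.

(** The periodisation [G] of [F] and the Fourier series [T] with coefficients [Fh] are continuous
    and have the same Fourier coefficients, so [fourier_unique] identifies their values at 0. The
    half-integer limits of integration are those tiled by unit intervals around the integers of the
    window -n <= m < n. *)
Lemma poisson_summation (F : R -> C) (Fh : Z -> C) (M M' : R) (s : C) :
  Ccont F -> (forall u, Cmod (F u) <= M / (1 + u ^ 2)) -> dominated Fh M' ->
  (forall k, is_Clim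
     (fun n => CInt (fun u => (F u * efun (- k) u)%C) (- INR n - 1 / 2) (INR n - 1 / 2)) (Fh k)) ->
  is_sumZ (fun n => F (IZR n)) s -> is_sumZ Fh s.
Proof.
  intros HF HM HFh Hcoef Hs.
  set (fG := fun (n : Z) y => F (clamp y + IZR n)).
  set (fT := fun (n : Z) y => (Fh n * efun n y)%C).
  assert (HM0 : 0 <= M).
  { specialize (HM 0). generalize (Cmod_ge_0 (F 0)).
    replace (M / (1 + 0 ^ 2)) with M in HM by field. lra. }
  assert (cG : forall n, Ccont (fG n)).
  { intros n. apply (Ccont_comp F); [exact HF|]. intros x.
    apply (continuous_plus (V := R_NormedModule)); [apply clamp_cont|apply continuous_const]. }
  assert (dG : forall y, dominated (fun n => fG n y) (4 * M)).
  { intros y n. unfold fG. eapply Rle_trans; [apply HM|]. assert (Hc := clamp_bounds y).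
    set (c := clamp y) in *. set (x := IZR n).
    replace (4 * M / (1 + x ^ 2)) with (M * / ((1 + x ^ 2) / 4))
      by (field; generalize (pow2_ge_0 x); lra).
    apply Rmult_le_compat_l; [exact HM0|].
    (* For |c| <= 1/2, 4 (1 + (c + x)^2) - (1 + x^2) equals 3 - 4 c^2 / 3 + (3 x + 4 c)^2 / 3, hence
       is positive. *)
    apply Rinv_le_contravar; generalize (pow2_ge_0 x) (pow2_ge_0 (3 * x + 4 * c)); nra. }
  assert (cT : forall n, Ccont (fT n)).
  { intros n. apply Ccont_mult; [apply Ccont_const|apply Ccont_efun]. }
  assert (dT : forall y, dominated (fun n => fT n y) M').
  { intros y n. unfold fT. rewrite Cmod_mult, Cmod_efun, Rmult_1_r. apply HFh. }
  set (G := fun y => sumZ (fun n => fG n y)). set (T := fun y => sumZ (fun n => fT n y)).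
  assert (sG : forall y, is_sumZ (fun n => fG n y) (G y)).
  { intros y. eapply dominated_sumZ, dG. }
  assert (sT : forall y, is_sumZ (fun n => fT n y) (T y)).
  { intros y. eapply dominated_sumZ, dT. }
  assert (contG : Ccont G) by (apply (normal_sum_cont fG G (4 * M)); assumption).
  assert (contT : Ccont T) by (apply (normal_sum_cont fT T M'); assumption).
  assert (mulc : forall (f : Z -> R -> C) j, (forall n, Ccont (f n)) ->
            forall n, Ccont (fun y => (efun j y * f n y)%C)).
  { intros f j Hf n. apply Ccont_mult; [apply Ccont_efun|apply Hf]. }
  assert (muld : forall (f : Z -> R -> C) j K, (forall y, dominated (fun n => f n y) K) ->
            forall y, dominated (fun n => (efun j y * f n y)%C) K).
  { intros f j K Hf y n. rewrite Cmod_mult, Cmod_efun, Rmult_1_l. apply Hf. }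
  assert (IG : forall k, CInt (fun y => (efun (- k) y * G y)%C) (- (1 / 2)) (1 / 2) = Fh k).
  { intros k.
    assert (H := normal_sum_CInt _ (fun y => (efun (- k) y * G y)%C) _ (- (1 / 2)) (1 / 2)
      (mulc fG (- k)%Z cG) (muld fG (- k)%Z _ dG)
      (fun y => is_sumZ_scal _ _ _ (sG y)) ltac:(lra)).
    apply is_Clim_unique with (1 := H).
    refine (is_Clim_ext _ _ _ _ (Hcoef k)).
    set (A := fun u => (F u * efun (- k) u)%C).
    assert (HA : Ccont A) by (apply Ccont_mult; [exact HF|apply Ccont_efun]).
    (* As [efun] has period 1, each term of the periodisation contributes the integral over the unit
       interval centred at its integer. *)
    assert (Hn : forall n : Z, CInt (fun y => (efun (- k) y * fG n y)%C) (- (1 / 2)) (1 / 2)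
                 = CInt A (IZR n - 1 / 2) (IZR n + 1 / 2)).
    { intros n. rewrite (CInt_ext _ (fun y => A (y + IZR n))).
      - rewrite CInt_shift by exact HA. f_equal; ring.
      - lra.
      - intros y Hy. unfold A, fG. rewrite clamp_id, efun_shift by lra. ring. }
    intros n. symmetry. induction n as [|n IH].
    - unfold window. simpl. unfold CInt. rewrite Rminus_0_l, Ropp_0, Rminus_0_l, !RInt_point.
      reflexivity.
    - rewrite window_S, IH, !Hn, S_INR, minus_IZR, opp_IZR, <- INR_IZR_INZ.
      replace (- INR n - 1 + 1 / 2) with (- INR n - 1 / 2) by field.
      replace (- (INR n + 1) - 1 / 2) with (- INR n - 1 - 1 / 2) by field.
      replace (INR n + 1 - 1 / 2) with (INR n + 1 / 2) by field.
      rewrite <- (CInt_Chasles A (- INR n - 1 - 1 / 2) (- INR n - 1 / 2) (INR n + 1 / 2)) by exact HA.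
      rewrite <- (CInt_Chasles A (- INR n - 1 / 2) (INR n - 1 / 2) (INR n + 1 / 2)) by exact HA.
      ring. }
  assert (IT : forall k, CInt (fun y => (efun (- k) y * T y)%C) (- (1 / 2)) (1 / 2) = Fh k).
  { intros k.
    assert (H := normal_sum_CInt _ (fun y => (efun (- k) y * T y)%C) _ (- (1 / 2)) (1 / 2)
      (mulc fT (- k)%Z cT) (muld fT (- k)%Z _ dT)
      (fun y => is_sumZ_scal _ _ _ (sT y)) ltac:(lra)).
    apply is_Clim_unique with (1 := H).
    assert (Hn : forall n : Z, CInt (fun y => (efun (- k) y * fT n y)%C) (- (1 / 2)) (1 / 2)
                 = (Fh n * CInt (efun (n - k)) (- (1 / 2)) (1 / 2))%C).
    { intros n. rewrite <- CInt_scal by apply Ccont_efun. apply CInt_ext; [lra|].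
      intros y _. unfold fT. replace (n - k)%Z with (n + - k)%Z by lia.
      rewrite <- efun_plus. ring. }
    replace (Fh k) with (CInt (fun y => (efun (- k) y * fT k y)%C) (- (1 / 2)) (1 / 2)).
    - apply (is_sumZ_single
        (fun n => CInt (fun y => (efun (- k) y * fT n y)%C) (- (1 / 2)) (1 / 2))).
      intros n Hnk. rewrite Hn, CInt_efun by lia. ring.
    - rewrite Hn, Z.sub_diag, (CInt_ext _ (fun _ => 1%C)), CInt_const.
      + replace (1 / 2 - - (1 / 2)) with 1 by field. ring.
      + lra.
      + intros y _. apply efun_0. }
  assert (HD : (G 0 + (- (1)) * T 0)%C = 0%C).
  { apply (fourier_unique (fun y => (G y + (- (1)) * T y)%C)).
    - apply Ccont_plus; [exact contG|apply Ccont_mult; [apply Ccont_const|exact contT]].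
    - intros k.
      rewrite (CInt_ext _ (fun y => (efun (- - k) y * G y + (- (1)) * (efun (- - k) y * T y))%C)).
      + rewrite CInt_plus, CInt_scal, IG, IT.
        * ring.
        * apply Ccont_mult; [apply Ccont_efun|exact contT].
        * apply Ccont_mult; [apply Ccont_efun|exact contG].
        * apply Ccont_mult; [apply Ccont_const|].
          apply Ccont_mult; [apply Ccont_efun|exact contT].
      + lra.
      + intros y _. rewrite Z.opp_involutive. ring. }
  assert (EG : G 0 = s).
  { apply is_sumZ_sumZ. refine (is_sumZ_ext _ _ _ _ Hs). intros n. unfold fG.
    rewrite clamp_id, Rplus_0_l by lra. reflexivity. }
  assert (ET : T 0 = s).
  { rewrite <- EG. replace (G 0) with ((G 0 + (- (1)) * T 0) + T 0)%C by ring. rewrite HD. ring. }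
  rewrite <- ET. refine (is_sumZ_ext _ _ _ _ (sT 0)).
  intros k. unfold fT. rewrite efun_at_0. ring.
Qed.

(** * Gaussian integrals along horizontal lines *)

Lemma RInt_tail (f : R -> R) (M a b : R) :
  (forall x, continuous f x) -> (forall u, Rabs (f u) <= M / (1 + u ^ 2)) ->
  a <= b -> 0 < a \/ b < 0 -> Rabs (RInt f a b) <= M * (/ a - / b).
Proof.
  intros Hf HM Hab H0.
  assert (Hne : forall u, a <= u <= b -> u <> 0) by (intros u Hu; lra).
  assert (HM0 : 0 <= M).
  { specialize (HM 0). generalize (Rabs_pos (f 0)).
    replace (M / (1 + 0 ^ 2)) with M in HM by field. lra. }
  assert (Hd : is_RInt (fun u => M / u ^ 2) a b (minus (- M / b) (- M / a))).
  { apply (is_RInt_derive (V := R_CompleteNormedModule) (fun u => - M / u)).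
    - intros u. rewrite Rmin_left, Rmax_right by exact Hab. intros Hu.
      auto_derive; [apply Hne, Hu|]. field. apply Hne, Hu.
    - intros u. rewrite Rmin_left, Rmax_right by exact Hab. intros Hu.
      apply (ex_derive_continuous (fun u => M / u ^ 2)). auto_derive.
      apply Hne in Hu. simpl. nra. }
  eapply Rle_trans; [apply abs_RInt_le; [exact Hab|apply cont_ex_RInt, Hf]|].
  replace (M * (/ a - / b)) with (minus (- M / b) (- M / a))
    by (unfold minus, plus, opp; simpl; field; split; apply Hne; lra).
  eapply is_RInt_le; [exact Hab| |exact Hd|].
  - apply (RInt_correct (V := R_CompleteNormedModule)). apply cont_ex_RInt. intros x.
    apply (continuous_comp f Rabs); [apply Hf|apply continuous_Rabs].
  - intros u Hu. eapply Rle_trans; [apply HM|].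
    apply Rmult_le_compat_l; [exact HM0|]. apply Rinv_le_contravar.
    + assert (Hu0 := Hne u ltac:(lra)). nra.
    + lra.
Qed.

Lemma CInt_tail (f : R -> C) (M a b : R) :
  Ccont f -> (forall u, Cmod (f u) <= M / (1 + u ^ 2)) ->
  a <= b -> 0 < a \/ b < 0 -> Cmod (CInt f a b) <= 2 * M * (/ a - / b).
Proof.
  intros [Hf1 Hf2] HM Hab H0. eapply Rle_trans; [apply Cmod_le_abs|].
  assert (H1 : Rabs (RInt (fun u => Re (f u)) a b) <= M * (/ a - / b)).
  { apply RInt_tail; auto. intros u. eapply Rle_trans; [apply re_le_Cmod|apply HM]. }
  assert (H2 : Rabs (RInt (fun u => Im (f u)) a b) <= M * (/ a - / b)).
  { apply RInt_tail; auto. intros u. eapply Rle_trans; [apply im_le_Cmod|apply HM]. }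
  unfold CInt; simpl in *. lra.
Qed.

Lemma CInt_window (f : R -> C) (M A B A' B' : R) :
  Ccont f -> (forall u, Cmod (f u) <= M / (1 + u ^ 2)) ->
  1 <= A <= A' -> 1 <= B <= B' ->
  Cmod (CInt f (- A') B' - CInt f (- A) B) <= 2 * M * (/ A + / B).
Proof.
  intros Hf HM HA HB.
  assert (HM0 : 0 <= M).
  { specialize (HM 0). generalize (Cmod_ge_0 (f 0)).
    replace (M / (1 + 0 ^ 2)) with M in HM by field. lra. }
  rewrite <- (CInt_Chasles f (- A') (- A) B'), <- (CInt_Chasles f (- A) B B') by exact Hf.
  replace (CInt f (- A') (- A) + (CInt f (- A) B + CInt f B B') - CInt f (- A) B)%C
    with (CInt f (- A') (- A) + CInt f B B')%C by ring.
  eapply Rle_trans; [apply Cmod_triangle|].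
  assert (H1 := CInt_tail f M (- A') (- A) Hf HM ltac:(lra) ltac:(lra)).
  assert (H2 := CInt_tail f M B B' Hf HM ltac:(lra) ltac:(lra)).
  assert (0 < / A') by (apply Rinv_0_lt_compat; lra).
  assert (0 < / B') by (apply Rinv_0_lt_compat; lra).
  rewrite !Rinv_opp in H1. nra.
Qed.

(** The two cut-offs are independent, so that translated and rescaled intervals keep the same
    limit. *)
Lemma CInt_improper (f : R -> C) (M : R) :
  Ccont f -> (forall u, Cmod (f u) <= M / (1 + u ^ 2)) ->
  exists l, is_Clim (fun n => CInt f (- INR n) (INR n)) l /\
    forall A B, 1 <= A -> 1 <= B -> Cmod (CInt f (- A) B - l) <= 2 * M * (/ A + / B).
Proof.
  intros Hf HM.
  destruct (Cauchy_rate (fun n => CInt f (- INR (S n)) (INR (S n)))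
    (fun n => 4 * M / (INR n + 1))) as [l Hl].
  - intros n m Hnm.
    assert (Hn := pos_INR n). assert (Hm : INR n <= INR m) by (apply le_INR; exact Hnm).
    rewrite !S_INR.
    eapply Rle_trans; [apply (CInt_window f M); auto; lra|].
    right; field; lra.
  - apply is_lim_seq_div_S.
  - exists l.
    assert (Hlim : is_Clim (fun n => CInt f (- INR n) (INR n)) l).
    { apply (is_lim_seq_incr_1 (fun n => Cmod (CInt f (- INR n) (INR n) - l))).
      apply is_Clim_le with (fun n => 4 * M / (INR n + 1)); [exact Hl|apply is_lim_seq_div_S]. }
    split; [exact Hlim|].
    intros A B HA HB.
    destruct (INR_unbounded (A + B)) as [N HN].
    replace (CInt f (- A) B - l)%C with (- (l - CInt f (- A) B))%C by ring. rewrite Cmod_opp.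
    apply is_Clim_Cmod_le with
      (fun n => (CInt f (- INR (N + n)) (INR (N + n)) - CInt f (- A) B)%C).
    + intros n. rewrite plus_INR. assert (Hn := pos_INR n).
      apply CInt_window; auto; lra.
    + apply is_Clim_minus; [|apply is_Clim_const].
      apply (is_Clim_subseq (fun n => CInt f (- INR n) (INR n)) l (fun n => (N + n)%nat));
        [intros; lia|exact Hlim].
Qed.

Definition gauss (a w : C) (v : R) : C := Cexp (- a * ((RtoC v + w) * (RtoC v + w)))%C.

Lemma gauss_cont (a w : C) : Ccont (gauss a w).
Proof.
  assert (H : Ccont (fun v => RtoC v + w)%C).
  { apply Ccont_plus; [apply Ccont_id|apply Ccont_const]. }
  apply Ccont_Cexp, Ccont_mult; [apply Ccont_const|]. apply Ccont_mult; exact H.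
Qed.

Lemma gauss_decay (a w : C) : 0 < Re a ->
  exists M, forall s v, 0 <= s <= 1 -> Cmod (gauss a (RtoC s * w) v) <= M / (1 + v ^ 2).
Proof.
  intros Ha. destruct a as [a1 a2], w as [w1 w2]; simpl in Ha.
  set (b := 2 * a2 * w2 - 2 * a1 * w1).
  set (c := - a1 * w1 ^ 2 + a1 * w2 ^ 2 + 2 * a2 * w1 * w2).
  destruct (gauss_bound a1 (Rabs b) (Rabs c) Ha) as [M HM]. exists M. intros s v Hs.
  specialize (HM (Rabs v)). rewrite pow2_abs in HM.
  eapply Rle_trans; [|exact HM].
  unfold gauss. rewrite Cmod_Cexp.
  replace (Re _) with (- a1 * v ^ 2 + s * (b * v) + s ^ 2 * c)
    by (unfold b, c; simpl; ring).
  assert (H1 : s * (b * v) <= Rabs b * Rabs v).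
  { rewrite <- Rabs_mult. generalize (Rle_abs (b * v)) (Rabs_pos (b * v)). nra. }
  assert (H2 : s ^ 2 * c <= Rabs c).
  { assert (0 <= s ^ 2 <= 1) by (simpl; nra). generalize (Rle_abs c) (Rabs_pos c). nra. }
  assert (Hle : - a1 * v ^ 2 + s * (b * v) + s ^ 2 * c
                <= - a1 * v ^ 2 + Rabs b * Rabs v + Rabs c) by lra.
  destruct Hle as [Hle|Hle]; [left; apply exp_increasing, Hle|rewrite Hle; apply Rle_refl].
Qed.

Lemma continuity_2d_pt_1d (f : R -> R) (g : R -> R -> R) (x y : R) :
  (forall z, ex_derive f z) -> continuity_2d_pt g x y ->
  continuity_2d_pt (fun u v => f (g u v)) x y.
Proof.
  intros Hf Hg. apply continuity_1d_2d_pt_comp; [|exact Hg].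
  apply continuity_pt_filterlim, (ex_derive_continuous f), Hf.
Qed.

Lemma is_derive_exp_cos (p q : R -> R) (p' q' c1 c2 v : R) :
  is_derive p v p' -> is_derive q v q' ->
  is_derive (fun v => exp (p v) * (c1 * cos (q v) - c2 * sin (q v))) v
    (exp (p v) * (c1 * (p' * cos (q v) - q' * sin (q v)) - c2 * (p' * sin (q v) + q' * cos (q v)))).
Proof.
  intros Hp Hq. auto_derive.
  - repeat split; eexists; eassumption.
  - replace (Derive (fun x => p x) v) with p' by (symmetry; apply is_derive_unique, Hp).
    replace (Derive (fun x => q x) v) with q' by (symmetry; apply is_derive_unique, Hq). ring.
Qed.

(* For holomorphic [h], the [s]-derivative of [c h (v + s w)] is the
   [v]-derivative of [c w h (v + s w)], so moving the line of integration only
   produces boundary terms. *)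
Lemma gauss_contour_Re (a w c : C) (M A B : R) :
  (forall s v, 0 <= s <= 1 -> Cmod (gauss a (RtoC s * w) v) <= M / (1 + v ^ 2)) ->
  1 <= A -> 1 <= B ->
  Rabs (RInt (fun v => Re (c * gauss a (RtoC 1 * w) v)%C) (- A) B
        - RInt (fun v => Re (c * gauss a (RtoC 0 * w) v)%C) (- A) B)
  <= Cmod (c * w) * M * (/ A + / B).
Proof.
  intros HM HA HB.
  destruct a as [a1 a2], w as [w1 w2].
  set (P := fun s v => - a1 * ((v + s * w1) ^ 2 - (s * w2) ^ 2)
                       + 2 * a2 * ((v + s * w1) * (s * w2))).
  set (Q := fun s v => - a2 * ((v + s * w1) ^ 2 - (s * w2) ^ 2)
                       - 2 * a1 * ((v + s * w1) * (s * w2))).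
  set (f := fun (c : C) s v => exp (P s v) * (fst c * cos (Q s v) - snd c * sin (Q s v))).
  assert (Ef : forall c s v, Re (c * gauss (a1, a2) (RtoC s * (w1, w2)) v)%C = f c s v).
  { intros [c1 c2] s v. unfold f, gauss.
    replace (- (a1, a2) * ((RtoC v + RtoC s * (w1, w2)) * (RtoC v + RtoC s * (w1, w2))))%C
      with (P s v, Q s v) by (apply C_eq; unfold P, Q; simpl; ring).
    unfold Cexp; simpl. ring. }
  set (Pv := fun s v => - a1 * (2 * (v + s * w1)) + 2 * a2 * (s * w2)).
  set (Qv := fun s v => - a2 * (2 * (v + s * w1)) - 2 * a1 * (s * w2)).
  set (fv := fun (c : C) s v => exp (P s v) *
    (fst c * (Pv s v * cos (Q s v) - Qv s v * sin (Q s v))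
     - snd c * (Pv s v * sin (Q s v) + Qv s v * cos (Q s v)))).
  assert (Dv : forall c s v, is_derive (fun v => f c s v) v (fv c s v)).
  { intros c' s v. unfold f, fv. apply is_derive_exp_cos; unfold P, Q, Pv, Qv;
      (auto_derive; [exact I|ring]). }
  assert (Ds : forall c s v, is_derive (fun s => f c s v) s (fv (c * (w1, w2))%C s v)).
  { intros [c1 c2] s v. unfold f.
    replace (fv ((c1, c2) * (w1, w2))%C s v) with (exp (P s v) *
      (c1 * ((w1 * Pv s v - w2 * Qv s v) * cos (Q s v) - (w1 * Qv s v + w2 * Pv s v) * sin (Q s v))
       - c2 * ((w1 * Pv s v - w2 * Qv s v) * sin (Q s v)
               + (w1 * Qv s v + w2 * Pv s v) * cos (Q s v)))) by (unfold fv; simpl; ring).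
    apply (is_derive_exp_cos (fun s => P s v) (fun s => Q s v)); unfold P, Q, Pv, Qv;
      (auto_derive; [exact I|ring]). }
  assert (C2 : forall c s v, continuity_2d_pt (fv c) s v).
  { intros c' s v.
    assert (L : forall k1 k2 k3, continuity_2d_pt (fun s v => k1 * v + k2 * s + k3) s v).
    { intros k1 k2 k3.
      apply continuity_2d_pt_plus; [apply continuity_2d_pt_plus|apply continuity_2d_pt_const];
        (apply continuity_2d_pt_mult; [apply continuity_2d_pt_const|]);
        [apply continuity_2d_pt_id2|apply continuity_2d_pt_id1]. }
    assert (LP : continuity_2d_pt Pv s v).
    { apply continuity_2d_pt_ext with
        (fun s v => (- 2 * a1) * v + (- 2 * a1 * w1 + 2 * a2 * w2) * s + 0);
        [intros; unfold Pv; ring|apply L]. }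
    assert (LQ : continuity_2d_pt Qv s v).
    { apply continuity_2d_pt_ext with
        (fun s v => (- 2 * a2) * v + (- 2 * a2 * w1 - 2 * a1 * w2) * s + 0);
        [intros; unfold Qv; ring|apply L]. }
    assert (LX : continuity_2d_pt (fun s v => v + s * w1) s v).
    { apply continuity_2d_pt_ext with (fun s v => 1 * v + w1 * s + 0); [intros; ring|apply L]. }
    assert (LY : continuity_2d_pt (fun s v => s * w2) s v).
    { apply continuity_2d_pt_ext with (fun s v => 0 * v + w2 * s + 0); [intros; ring|apply L]. }
    assert (CP : forall k1 k2, continuity_2d_pt (fun s v => k1 * ((v + s * w1) ^ 2 - (s * w2) ^ 2)
                       + k2 * ((v + s * w1) * (s * w2))) s v).
    { intros k1 k2. apply continuity_2d_pt_ext with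
        (fun s v => k1 * ((v + s * w1) * (v + s * w1) - (s * w2) * (s * w2))
                       + k2 * ((v + s * w1) * (s * w2))); [intros; ring|].
      apply continuity_2d_pt_plus; apply continuity_2d_pt_mult; try apply continuity_2d_pt_const.
      - apply continuity_2d_pt_minus; apply continuity_2d_pt_mult; assumption.
      - apply continuity_2d_pt_mult; assumption. }
    assert (CQ : continuity_2d_pt Q s v).
    { apply continuity_2d_pt_ext with (fun s v => - a2 * ((v + s * w1) ^ 2 - (s * w2) ^ 2)
                       + - (2 * a1) * ((v + s * w1) * (s * w2)));
      [intros; unfold Q; ring|apply CP]. }
    assert (Cc : continuity_2d_pt (fun s v => cos (Q s v)) s v).
    { apply (continuity_2d_pt_1d cos); [intros z; auto_derive; exact I|exact CQ]. }
    assert (Cs : continuity_2d_pt (fun s v => sin (Q s v)) s v).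
    { apply (continuity_2d_pt_1d sin); [intros z; auto_derive; exact I|exact CQ]. }
    unfold fv. apply continuity_2d_pt_mult.
    - apply (continuity_2d_pt_1d exp); [intros z; auto_derive; exact I|apply CP].
    - apply continuity_2d_pt_minus; (apply continuity_2d_pt_mult; [apply continuity_2d_pt_const|]).
      + apply continuity_2d_pt_minus; apply continuity_2d_pt_mult; assumption.
      + apply continuity_2d_pt_plus; apply continuity_2d_pt_mult; assumption. }
  assert (Cv : forall c s v, continuous (fun v => fv c s v) v).
  { intros c' s v. unfold fv, P, Q, Pv, Qv.
    match goal with |- continuous ?h v => apply (ex_derive_continuous h) end.
    auto_derive. exact I. }
  set (Phi := fun s => RInt (fun v => f c s v) (- A) B).
  assert (DPhi : forall s, is_derive Phi s (f (c * (w1, w2))%C s B - f (c * (w1, w2))%C s (- A))).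
  { intros s.
    assert (Hd := is_derive_RInt_param (f c) (- A) B s).
    assert (E : RInt (fun t => Derive (fun u => f c u t) s) (- A) B
                = f (c * (w1, w2))%C s B - f (c * (w1, w2))%C s (- A)).
    { apply (is_RInt_unique (V := R_CompleteNormedModule)).
      apply is_RInt_ext with (fun v => fv (c * (w1, w2))%C s v).
      - intros v _. symmetry. apply is_derive_unique, Ds.
      - apply (is_RInt_derive (V := R_CompleteNormedModule)); intros v _; [apply Dv|apply Cv]. }
    rewrite <- E. apply Hd.
    - apply filter_forall. intros x t _. eexists. apply Ds.
    - intros t _. apply continuity_2d_pt_ext with (fv (c * (w1, w2))%C); [|apply C2].
      intros x y. symmetry. apply is_derive_unique, Ds.
    - apply filter_forall. intros y. apply cont_ex_RInt. intros v.
      apply (ex_derive_continuous (fun v => f c y v)). eexists. apply Dv. }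
  (* The mean value theorem turns the bound on the boundary terms, uniform in [s], into a bound on
     the total change of the integral. *)
  destruct (MVT_gen Phi 0 1 (fun s => f (c * (w1, w2))%C s B - f (c * (w1, w2))%C s (- A)))
    as [s [Hs Es]].
  - intros x _. apply DPhi.
  - intros x _. apply continuity_pt_filterlim.
    apply (ex_derive_continuous Phi). eexists. apply DPhi.
  - rewrite Rmin_left, Rmax_right in Hs by lra.
    rewrite (RInt_ext (fun v => Re (c * gauss (a1, a2) (RtoC 1 * (w1, w2)) v)%C) (fun v => f c 1 v))
      by (intros v _; apply Ef).
    rewrite (RInt_ext (fun v => Re (c * gauss (a1, a2) (RtoC 0 * (w1, w2)) v)%C) (fun v => f c 0 v))
      by (intros v _; apply Ef).
    change (Rabs (Phi 1 - Phi 0) <= Cmod (c * (w1, w2)) * M * (/ A + / B)).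
    rewrite Es, Rminus_0_r, Rmult_1_r.
    assert (HM0 : 0 <= M).
    { specialize (HM 0 0 ltac:(lra)). generalize (Cmod_ge_0 (gauss (a1, a2) (RtoC 0 * (w1, w2)) 0)).
      replace (M / (1 + 0 ^ 2)) with M in HM by field. lra. }
    assert (Hb : forall v D, 1 <= D -> v ^ 2 = D ^ 2 ->
              Rabs (f (c * (w1, w2))%C s v) <= Cmod (c * (w1, w2)) * M * / D).
    { intros v D HD Hv. rewrite <- Ef. eapply Rle_trans; [apply re_le_Cmod|].
      rewrite Cmod_mult, Rmult_assoc. apply Rmult_le_compat_l; [apply Cmod_ge_0|].
      eapply Rle_trans; [apply HM, Hs|]. rewrite Hv. apply Rmult_le_compat_l; [exact HM0|].
      apply Rinv_le_contravar; nra. }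
    assert (H1 := Hb B B HB eq_refl). assert (H2 := Hb (- A) A HA ltac:(ring)).
    unfold Rminus at 1. eapply Rle_trans; [apply Rabs_triang|]. rewrite Rabs_Ropp. lra.
Qed.

Definition gint (a : C) : C := Clim_seq (fun n => CInt (gauss a 0) (- INR n) (INR n)).

Lemma gauss_line (a w : C) : 0 < Re a ->
  exists K, forall A B, 1 <= A -> 1 <= B ->
    Cmod (CInt (gauss a w) (- A) B - gint a) <= K * (/ A + / B).
Proof.
  intros Ha. destruct (gauss_decay a w Ha) as [M HM].
  assert (E0 : (RtoC 0 * w)%C = 0%C) by ring. assert (E1 : (RtoC 1 * w)%C = w) by ring.
  destruct (CInt_improper (gauss a 0) M (gauss_cont a 0)) as [l [Hl HlM]].
  { intros u. rewrite <- E0. apply HM. lra. }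
  assert (El : gint a = l) by apply (is_Clim_Clim_seq _ _ Hl).
  exists (2 * M + (Cmod w * M + Cmod w * M)). intros A B HA HB.
  rewrite El.
  replace (CInt (gauss a w) (- A) B - l)%C
    with ((CInt (gauss a 0) (- A) B - l) + (CInt (gauss a w) (- A) B - CInt (gauss a 0) (- A) B))%C
    by ring.
  eapply Rle_trans; [apply Cmod_triangle|].
  assert (H1 := gauss_contour_Re a w 1 M A B HM HA HB).
  (* Since Re (- i z) = Im z, the choice c = - i transfers the estimate to the imaginary part. *)
  assert (H2 := gauss_contour_Re a w (- Ci) M A B HM HA HB).
  rewrite E0, E1 in H1, H2. rewrite Cmod_mult, Cmod_opp, Cmod_Ci, Rmult_1_l in H2.
  assert (H3 : Cmod (CInt (gauss a w) (- A) B - CInt (gauss a 0) (- A) B)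
               <= (Cmod w * M + Cmod w * M) * (/ A + / B)).
  { eapply Rle_trans; [apply Cmod_le_abs|].
    rewrite Rmult_plus_distr_r. apply Rplus_le_compat.
    - eapply Rle_trans; [|exact H1]. right. f_equal.
      transitivity (RInt (fun v => Re (gauss a w v)) (- A) B
                    - RInt (fun v => Re (gauss a 0 v)) (- A) B); [reflexivity|].
      f_equal; apply RInt_ext; intros v _; rewrite Cmult_1_l; reflexivity.
    - eapply Rle_trans; [|exact H2]. right. f_equal.
      transitivity (RInt (fun v => Im (gauss a w v)) (- A) B
                    - RInt (fun v => Im (gauss a 0 v)) (- A) B); [reflexivity|].
      f_equal; apply RInt_ext; intros v _.
      + destruct (gauss a w v) as [p q]; simpl; ring.
      + destruct (gauss a 0 v) as [p q]; simpl; ring. }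
  specialize (HlM A B HA HB). lra.
Qed.

Lemma is_lim_seq_inv_shift (x l : R) : 0 < l -> is_lim_seq (fun n => / (INR n * l + x)) 0.
Proof.
  intros Hl. replace (Finite 0) with (Rbar_inv p_infty) by reflexivity.
  apply is_lim_seq_inv; [|discriminate].
  apply is_lim_seq_plus with p_infty x; [|apply is_lim_seq_const|reflexivity].
  replace p_infty with (Rbar_mult p_infty l).
  - apply is_lim_seq_mult with p_infty l; [apply is_lim_seq_INR|apply is_lim_seq_const|].
    simpl. unfold is_Rbar_mult. simpl.
    destruct (Rle_dec 0 l) as [H|H]; [|lra]. destruct (Rle_lt_or_eq_dec 0 l H); [reflexivity|lra].
  - simpl. destruct (Rle_dec 0 l) as [H|H]; [|lra].
    destruct (Rle_lt_or_eq_dec 0 l H); [reflexivity|lra].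
Qed.

(** The slope [l] serves the rescaling in [gint_scale]; the offsets [x] and [y] serve the
    half-integer limits of Poisson summation. *)
Lemma gauss_line_lim (a w : C) (l x y : R) : 0 < Re a -> 0 < l ->
  is_Clim (fun n => CInt (gauss a w) (- (INR n * l + x)) (INR n * l + y)) (gint a).
Proof.
  intros Ha Hl. destruct (gauss_line a w Ha) as [K HK].
  assert (Hlim : is_lim_seq (fun n => K * (/ (INR n * l + x) + / (INR n * l + y))) 0).
  { replace (Finite 0) with (Finite (K * (0 + 0))) by (f_equal; ring).
    apply is_lim_seq_mult'; [apply is_lim_seq_const|].
    apply is_lim_seq_plus'; apply is_lim_seq_inv_shift, Hl. }
  destruct (INR_unbounded ((1 + Rabs x + Rabs y) / l)) as [N HN].
  apply (is_lim_seq_incr_n _ N). apply (is_lim_seq_incr_n _ N) in Hlim.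
  revert Hlim. apply is_lim_seq_le_le with (u := fun _ => 0); [|apply is_lim_seq_const].
  intros n. split; [apply Cmod_ge_0|].
  assert (H1 : 1 + Rabs x + Rabs y <= INR (n + N) * l).
  { rewrite plus_INR. assert (Hn := pos_INR n).
    replace (1 + Rabs x + Rabs y) with ((1 + Rabs x + Rabs y) / l * l) by (field; lra).
    apply Rmult_le_compat_r; lra. }
  assert (Hx := Rabs_pos x). assert (Hy := Rabs_pos y).
  assert (Hx' := Rle_abs (- x)). assert (Hy' := Rle_abs (- y)). rewrite Rabs_Ropp in Hx', Hy'.
  apply HK; lra.
Qed.

(** The substitution v -> v / l. It multiplies the cut-offs by 1 / l, hence the slope 1 / l in the
    limit for [gint a]. *)
Lemma gint_scale (a : C) (l : R) : 0 < Re a -> 0 < l ->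
  gint (a * RtoC (/ (l * l)))%C = (RtoC l * gint a)%C.
Proof.
  intros Ha Hl.
  assert (Hil : 0 < / l) by (apply Rinv_0_lt_compat, Hl).
  assert (Ha' : 0 < Re (a * RtoC (/ (l * l)))%C).
  { destruct a as [a1 a2]; simpl in *. rewrite Rmult_0_r, Rminus_0_r.
    apply Rmult_lt_0_compat; [exact Ha|]. apply Rinv_0_lt_compat. nra. }
  apply is_Clim_unique with (1 := gauss_line_lim _ 0 1 0 0 Ha' Rlt_0_1).
  refine (is_Clim_ext _ _ _ _ (is_Clim_scal (RtoC l) _ _ (gauss_line_lim a 0 (/ l) 0 0 Ha Hil))).
  intros n.
  replace (- (INR n * / l + 0)) with (/ l * (- (INR n * 1 + 0)) + 0) by (field; lra).
  replace (INR n * / l + 0) with (/ l * (INR n * 1 + 0) + 0) by (field; lra).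
  rewrite <- CInt_comp_lin, <- CInt_scal.
  - apply CInt_ext; [generalize (pos_INR n); lra|]. intros v _.
    rewrite Cmult_assoc, <- RtoC_mult, Rinv_r, Cmult_1_l by lra.
    unfold gauss. f_equal. apply C_eq; simpl; field; lra.
  - apply Ccont_mult; [apply Ccont_const|]. apply (Ccont_comp (gauss a 0)); [apply gauss_cont|].
    intros x. apply (ex_derive_continuous (fun v => / l * v + 0)). auto_derive. exact I.
  - apply gauss_cont.
Qed.

(** * Inversion of theta series *)

Lemma Ci_sqr : (Ci * Ci)%C = (- (1))%C.
Proof. apply C_eq; simpl; ring. Qed.

Definition theta_term (a : C) (x b : R) (n : Z) : C :=
  Cexp (- a * RtoC ((IZR n + x) * (IZR n + x)) - RtoC (2 * PI * b * (IZR n + x)) * Ci)%C.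

(** The Fourier transform, at frequency k, of the function summed in [theta_term], divided by
    [gint a]. *)
Definition theta_dual (a : C) (x b : R) (k : Z) : C :=
  Cexp (- (RtoC (PI * (IZR k + b)) * RtoC (PI * (IZR k + b)) * / a)
        + RtoC (2 * PI * IZR k * x) * Ci)%C.

Lemma theta_term_dominated (a : C) (x b : R) : 0 < Re a ->
  exists M, dominated (theta_term a x b) M.
Proof.
  intros Ha. apply (dominated_Cexp _ (Re a) (- 2 * Re a * x) (- Re a * x ^ 2)); [exact Ha|].
  intros k. destruct a as [a1 a2]; simpl. ring.
Qed.

Lemma Re_inv_pos (a : C) : 0 < Re a -> 0 < Re (/ a)%C.
Proof.
  intros Ha. destruct a as [a1 a2]; simpl in *.
  apply Rdiv_lt_0_compat; [exact Ha|]. nra.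
Qed.

Lemma theta_dual_dominated (a : C) (x b : R) : 0 < Re a ->
  exists M, dominated (theta_dual a x b) M.
Proof.
  intros Ha. assert (Hi := Re_inv_pos a Ha).
  set (p := Re (/ a)%C) in *. assert (Hpi := PI_RGT_0).
  apply (dominated_Cexp _ (PI ^ 2 * p) (- 2 * PI ^ 2 * p * b) (- PI ^ 2 * p * b ^ 2)).
  - apply Rmult_lt_0_compat; [apply pow_lt, Hpi|exact Hi].
  - intros k. unfold p. destruct (/ a)%C as [a1 a2]; simpl. ring.
Qed.

(** Completing the square displaces the Gaussian by the complex number x + i PI (k + b) / a, which
    is why integrals along shifted horizontal lines are needed. *)
Lemma theta_term_fourier (a : C) (x b u : R) (k : Z) : 0 < Re a ->
  (Cexp (- a * RtoC ((u + x) * (u + x)) - RtoC (2 * PI * b * (u + x)) * Ci) * efun (- k) u)%C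
  = (theta_dual a x b k * gauss a (RtoC x + RtoC (PI * (IZR k + b)) * Ci * / a) u)%C.
Proof.
  intros Ha.
  assert (Ha0 : (a * / a)%C = 1%C).
  { apply Cinv_r. intros H. rewrite H in Ha. simpl in Ha. lra. }
  unfold efun, theta_dual, gauss. rewrite <- !Cexp_plus. f_equal.
  set (ia := (/ a)%C) in *.
  set (c := RtoC (PI * (IZR k + b))).
  replace (- a * ((RtoC u + (RtoC x + c * Ci * ia)) * (RtoC u + (RtoC x + c * Ci * ia))))%C
    with (- a * ((RtoC u + RtoC x) * (RtoC u + RtoC x))
          - 2 * (a * ia) * (RtoC u + RtoC x) * (c * Ci) - (a * ia) * (c * c * ia * (Ci * Ci)))%C
    by ring.
  rewrite Ha0, Ci_sqr. unfold c. rewrite opp_IZR.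
  rewrite !RtoC_mult, !RtoC_plus, !RtoC_opp. ring.
Qed.

(** The displacement depends on k, but the integral along every horizontal line is the same
    [gint a], which therefore factors out of the dual series. *)
Lemma theta_inversion (a : C) (x b : R) (s : C) : 0 < Re a ->
  is_sumZ (theta_term a x b) s -> is_sumZ (fun k => (gint a * theta_dual a x b k)%C) s.
Proof.
  intros Ha Hs.
  set (F := fun u => Cexp (- a * RtoC ((u + x) * (u + x)) - RtoC (2 * PI * b * (u + x)) * Ci)%C).
  destruct (gauss_bound (Re a) (- 2 * Re a * x) (- Re a * x ^ 2) Ha) as [M HM].
  destruct (theta_dual_dominated a x b Ha) as [M' HM'].
  assert (Hlin : Ccont (fun u => RtoC (u + x))).
  { apply Ccont_RtoC. intros u. apply (ex_derive_continuous (fun u => u + x)). auto_derive. exact I. }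
  apply (poisson_summation F _ M (Cmod (gint a) * M')).
  - apply Ccont_Cexp. apply Ccont_plus; [apply Ccont_mult; [apply Ccont_const|]|].
    + apply Ccont_RtoC. intros u.
      apply (ex_derive_continuous (fun u => (u + x) * (u + x))). auto_derive. exact I.
    + destruct (Ccont_mult (fun _ => (- (1))%C)
        (fun u => (RtoC (2 * PI * b * (u + x)) * Ci)%C)) as [H1 H2].
      * apply Ccont_const.
      * apply Ccont_mult; [|apply Ccont_const]. apply Ccont_RtoC. intros u.
        apply (ex_derive_continuous (fun u => 2 * PI * b * (u + x))). auto_derive. exact I.
      * split; intros u.
        -- apply continuous_ext with (2 := H1 u). intros v. simpl. ring.
        -- apply continuous_ext with (2 := H2 u). intros v. simpl. ring.
  - intros u. eapply Rle_trans; [|apply HM]. unfold F. rewrite Cmod_Cexp. right; f_equal.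
    destruct a as [a1 a2]; simpl. ring.
  - intros k. rewrite Cmod_mult. unfold Rdiv. rewrite Rmult_assoc.
    apply Rmult_le_compat_l; [apply Cmod_ge_0|apply HM'].
  - intros k. rewrite Cmult_comm.
    set (w := (RtoC x + RtoC (PI * (IZR k + b)) * Ci * / a)%C).
    refine (is_Clim_ext _ _ _ _ (is_Clim_scal (theta_dual a x b k) _ _
      (gauss_line_lim a w 1 (1 / 2) (- (1 / 2)) Ha Rlt_0_1))).
    intros n. rewrite <- CInt_scal by apply gauss_cont.
    replace (- (INR n * 1 + 1 / 2)) with (- INR n - 1 / 2) by ring.
    replace (INR n * 1 + - (1 / 2)) with (INR n - 1 / 2) by ring.
    apply CInt_ext; [generalize (pos_INR n); lra|].
    intros u _. symmetry. apply theta_term_fourier, Ha.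
  - exact Hs.
Qed.

(** If [gint a] vanished, inversion would make the sum of exp (- a n^2 - 2 PI i b n) vanish for
    every real [b]. Integrating over a period in [b] isolates the term n = 0, which is 1. *)
Lemma gint_neq_0 (a : C) : 0 < Re a -> gint a <> 0%C.
Proof.
  intros Ha H0.
  assert (HS : forall b, is_sumZ (theta_term a 0 b) 0%C).
  { intros b. destruct (theta_term_dominated a 0 b Ha) as [M HM].
    destruct (dominated_sum _ _ HM) as [s [Hs _]].
    assert (H := theta_inversion a 0 b s Ha Hs).
    replace (RtoC 0) with s; [exact Hs|].
    apply (is_sumZ_unique _ _ _ H). rewrite H0.
    apply is_Clim_ext with (fun _ => RtoC 0); [|apply is_Clim_const].
    intros n. symmetry. apply csum_zero. intros i _. ring. }
  set (f := fun (n : Z) (b : R) => (Cexp (- a * RtoC (IZR n * IZR n)) * efun (- n) b)%C).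
  assert (Ef : forall n b, theta_term a 0 b n = f n b).
  { intros n b. unfold theta_term, f, efun. rewrite <- Cexp_plus. f_equal.
    rewrite opp_IZR. apply C_eq; simpl; ring. }
  destruct (theta_term_dominated a 0 0 Ha) as [M HM].
  assert (Hd : forall b, dominated (fun n => f n b) M).
  { intros b n. unfold f. rewrite Cmod_mult, Cmod_efun, Rmult_1_r.
    eapply Rle_trans; [|apply (HM n)]. rewrite Ef. unfold f.
    rewrite Cmod_mult, Cmod_efun. lra. }
  assert (Hc : forall n, Ccont (f n)).
  { intros n. apply Ccont_mult; [apply Ccont_const|apply Ccont_efun]. }
  assert (Hsum : is_sumZ (fun n => CInt (f n) (- (1 / 2)) (1 / 2))
                   (CInt (fun _ => RtoC 0) (- (1 / 2)) (1 / 2))).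
  { apply (normal_sum_CInt f (fun _ => RtoC 0) M); auto; [|lra].
    intros b. refine (is_sumZ_ext _ _ _ (fun n => Ef n b) (HS b)). }
  assert (Hone : is_sumZ (fun n => CInt (f n) (- (1 / 2)) (1 / 2))
                   (CInt (f 0%Z) (- (1 / 2)) (1 / 2))).
  { apply (is_sumZ_single (fun n => CInt (f n) (- (1 / 2)) (1 / 2))).
    intros m Hm. unfold f. rewrite CInt_scal, CInt_efun by (try apply Ccont_efun; lia). ring. }
  assert (E := is_sumZ_unique _ _ _ Hsum Hone). apply C1_nz.
  rewrite CInt_const, Cmult_0_r in E. rewrite E.
  rewrite (CInt_ext _ (fun _ => 1%C)).
  - rewrite CInt_const. replace (1 / 2 - - (1 / 2)) with 1 by field. ring.
  - lra.
  - intros y _. unfold f. simpl Z.opp. rewrite efun_0.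
    replace (- a * RtoC (0 * 0))%C with (RtoC 0) by (apply C_eq; simpl; ring).
    rewrite Cexp_0. ring.
Qed.

(** On odd integers m = 2k + 1 the map m -> - m is k -> -1 - k, an exact symmetry of the window.
    Symmetrising replaces exponentials by cosines. *)
Lemma is_sumZ_even_part (f : Z -> C) (s : C) :
  is_sumZ (fun k => f (2 * k + 1)%Z) s ->
  is_sumZ (fun k => ((f (2 * k + 1)%Z + f (- (2 * k + 1))%Z) / 2)%C) s.
Proof.
  intros Hs. assert (Hr := is_sumZ_refl _ _ Hs).
  assert (H := is_sumZ_scal (/ 2)%C _ _ (is_sumZ_plus _ _ _ _ Hs Hr)).
  replace (/ 2 * (s + s))%C with s in H by field.
  refine (is_sumZ_ext _ _ _ _ H). intros k. cbv beta.
  replace (2 * (- 1 - k) + 1)%Z with (- (2 * k + 1))%Z by lia. unfold Cdiv. ring.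
Qed.

Definition alt_dual (a : C) (x : R) (m : Z) : C :=
  (Cexp (- (RtoC (PI ^ 2 * IZR m ^ 2 / 4) * / a)) * RtoC (cos (PI * IZR m * x)))%C.

(** The sign (-1)^k is the character of frequency b = 1/2 up to the constant phase exp (i PI x), and
    k + 1/2 = (2k + 1) / 2 brings in the odd integers. *)
Lemma alternating_inversion (a : C) (x : R) (s : C) : 0 < Re a ->
  is_sumZ (fun k => Cexp (RtoC (PI * IZR k) * Ci - a * RtoC ((IZR k + x) ^ 2))%C) s ->
  is_sumZ (fun k => (gint a * alt_dual a x (2 * k + 1))%C) s.
Proof.
  intros Ha Hs.
  assert (H1 : is_sumZ (theta_term a x (1 / 2)) (Cexp (- (RtoC (PI * x) * Ci)) * s)%C).
  { refine (is_sumZ_ext _ _ _ _ (is_sumZ_scal _ _ _ Hs)). intros k. cbv beta.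
    unfold theta_term. rewrite <- Cexp_plus. apply Cexp_eq_mod with k.
    apply C_eq; simpl; field. }
  apply (theta_inversion a x (1 / 2) _ Ha) in H1.
  apply (is_sumZ_scal (Cexp (RtoC (PI * x) * Ci))) in H1.
  rewrite Cmult_assoc, Cexp_opp, Cmult_1_l in H1.
  set (f := fun m : Z => (gint a * Cexp (- (RtoC (PI ^ 2 * IZR m ^ 2 / 4) * / a)
                          + RtoC (PI * IZR m * x) * Ci))%C).
  assert (H2 : is_sumZ (fun k => f (2 * k + 1)%Z) s).
  { refine (is_sumZ_ext _ _ _ _ H1). intros k. cbv beta. unfold f, theta_dual.
    rewrite Cmult_assoc, (Cmult_comm _ (gint a)), <- Cmult_assoc. f_equal.
    rewrite <- Cexp_plus. f_equal. rewrite plus_IZR, mult_IZR.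
    generalize (/ a)%C; intros [i1 i2]. apply C_eq; simpl; field. }
  apply is_sumZ_even_part in H2.
  refine (is_sumZ_ext _ _ _ _ H2). intros k. cbv beta. unfold f, alt_dual.
  set (m := (2 * k + 1)%Z). rewrite RtoC_cos, !Cexp_plus, opp_IZR.
  replace (RtoC (PI ^ 2 * (- IZR m) ^ 2 / 4)) with (RtoC (PI ^ 2 * IZR m ^ 2 / 4))
    by (f_equal; field).
  replace (RtoC (PI * - IZR m * x) * Ci)%C with (- (RtoC (PI * IZR m * x) * Ci))%C
    by (apply C_eq; simpl; ring).
  unfold Cdiv. ring.
Qed.

Lemma RtoC_cos_shift (x : R) (k : Z) :
  RtoC (cos (x + PI * IZR k)) = (Cexp (RtoC (PI * IZR k) * Ci) * RtoC (cos x))%C.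
Proof.
  rewrite !RtoC_cos.
  assert (E1 : Cexp (RtoC (x + PI * IZR k) * Ci)%C
               = (Cexp (RtoC (PI * IZR k) * Ci) * Cexp (RtoC x * Ci))%C).
  { rewrite <- Cexp_plus. f_equal. apply C_eq; simpl; ring. }
  assert (E2 : Cexp (- (RtoC (x + PI * IZR k) * Ci))%C
               = (Cexp (RtoC (PI * IZR k) * Ci) * Cexp (- (RtoC x * Ci)))%C).
  { rewrite <- Cexp_plus. apply Cexp_eq_mod with (- k)%Z. rewrite opp_IZR.
    apply C_eq; simpl; ring. }
  rewrite E1, E2. unfold Cdiv. ring.
Qed.

(** The sign + + - - of period 4 becomes a cosine, hence a sum of two exponentials linear in n, to
    which theta inversion applies. *)
Lemma quarter_sign (n : Z) :
  Cexp (RtoC (PI * (IZR n * (IZR n - 1) / 2)) * Ci)%C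
  = RtoC (sqrt 2 * cos (PI / 2 * (IZR n - 1 / 2))).
Proof.
  assert (H2 : sqrt 2 * (1 / sqrt 2) = 1).
  { field. apply Rgt_not_eq, sqrt_lt_R0. lra. }
  rewrite (RtoC_mult (sqrt 2)).
  destruct (Z.Even_or_Odd n) as [[p ->]|[p ->]].
  - rewrite mult_IZR.
    replace (PI / 2 * (2 * IZR p - 1 / 2)) with (- (PI / 4) + PI * IZR p) by field.
    rewrite RtoC_cos_shift, cos_neg, cos_PI4.
    rewrite (Cmult_comm (Cexp _)), Cmult_assoc, <- RtoC_mult, H2, Cmult_1_l.
    apply Cexp_eq_mod with (p * p - p)%Z. rewrite minus_IZR, mult_IZR.
    apply C_eq; simpl; field.
  - rewrite plus_IZR, mult_IZR.
    replace (PI / 2 * (2 * IZR p + 1 - 1 / 2)) with (PI / 4 + PI * IZR p) by field.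
    rewrite RtoC_cos_shift, cos_PI4.
    rewrite (Cmult_comm (Cexp _)), Cmult_assoc, <- RtoC_mult, H2, Cmult_1_l.
    apply Cexp_eq_mod with (p * p)%Z. rewrite mult_IZR.
    apply C_eq; simpl; field.
Qed.

(* On odd [m], [sqrt 2 * cos (PI / 4 * m)] is the sign [+ - - +] of period 8. *)
Definition quarter_dual (a : C) (y : R) (m : Z) : C :=
  (Cexp (- (RtoC (PI ^ 2 * IZR m ^ 2 / 16) * / a))
   * (RtoC (sqrt 2 * cos (PI / 4 * IZR m)) * RtoC (cos (PI * IZR m * y / 2))))%C.

(** By [quarter_sign] the series is a combination of two theta series of frequencies 1/4 and 3/4,
    the latter standing for -1/4. Their duals run over k + 1/4 and k + 3/4, that is over m = 4k + 1
    and m = 4k + 3, and together exhaust the odd integers. *)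
Lemma quarter_inversion (a : C) (y : R) (s : C) : 0 < Re a ->
  is_sumZ (fun k => Cexp (RtoC (PI * (IZR k * (IZR k - 1) / 2)) * Ci
                          - a * RtoC ((IZR k + (y - 1 / 2)) ^ 2))%C) s ->
  is_sumZ (fun k => (gint a * RtoC (1 / sqrt 2) * quarter_dual a y (2 * k + 1))%C) s.
Proof.
  intros Ha Hs.
  assert (Hsq : sqrt 2 <> 0) by (apply Rgt_not_eq, sqrt_lt_R0; lra).
  set (x := y - 1 / 2) in *.
  destruct (theta_term_dominated a x (1 / 4) Ha) as [M1 HM1].
  destruct (theta_term_dominated a x (3 / 4) Ha) as [M3 HM3].
  destruct (dominated_sum _ _ HM1) as [s1 [Hs1 _]].
  destruct (dominated_sum _ _ HM3) as [s3 [Hs3 _]].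
  set (c1 := Cexp (RtoC (PI * y / 2) * Ci)%C).
  set (c3 := Cexp (RtoC (PI * (3 * y / 2 - 1)) * Ci)%C).
  assert (Es : s = (RtoC (1 / sqrt 2) * (c1 * s1 + c3 * s3))%C).
  { apply (is_sumZ_unique _ _ _ Hs).
    refine (is_sumZ_ext _ _ _ _ (is_sumZ_scal _ _ _ (is_sumZ_plus _ _ _ _
      (is_sumZ_scal c1 _ _ Hs1) (is_sumZ_scal c3 _ _ Hs3)))).
    intros k. cbv beta. unfold Cminus. rewrite Cexp_plus, quarter_sign, (RtoC_mult (sqrt 2)), RtoC_cos.
    unfold theta_term, c1, c3. rewrite <- !Cexp_plus.
    set (w := (- (a * RtoC ((IZR k + x) ^ 2)))%C).
    replace (Cexp (RtoC (PI * y / 2) * Ci + (- a * RtoC ((IZR k + x) * (IZR k + x))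
               - RtoC (2 * PI * (1 / 4) * (IZR k + x)) * Ci))%C)
      with (Cexp (- (RtoC (PI / 2 * (IZR k - 1 / 2)) * Ci)) * Cexp w)%C.
    2:{ rewrite <- Cexp_plus. f_equal. unfold w, x.
        destruct a as [a1 a2]; apply C_eq; simpl; field. }
    replace (Cexp (RtoC (PI * (3 * y / 2 - 1)) * Ci + (- a * RtoC ((IZR k + x) * (IZR k + x))
               - RtoC (2 * PI * (3 / 4) * (IZR k + x)) * Ci))%C)
      with (Cexp (RtoC (PI / 2 * (IZR k - 1 / 2)) * Ci) * Cexp w)%C.
    2:{ rewrite <- Cexp_plus. apply Cexp_eq_mod with k. unfold w, x.
        destruct a as [a1 a2]; apply C_eq; simpl; field. }
    replace (RtoC (1 / sqrt 2)) with (RtoC (sqrt 2) * / 2)%C.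
    - unfold Cdiv. ring.
    - assert (Hs2 : sqrt 2 * sqrt 2 = 2) by (apply sqrt_sqrt; lra).
      apply C_eq; simpl; [|field].
      replace (1 / sqrt 2) with (sqrt 2 / (sqrt 2 * sqrt 2)) by (field; exact Hsq).
      rewrite Hs2. field. }
  set (f := fun m : Z => (gint a * RtoC (1 / sqrt 2) * (RtoC (sqrt 2 * cos (PI / 4 * IZR m)) *
     Cexp (- (RtoC (PI ^ 2 * IZR m ^ 2 / 16) * / a) + RtoC (PI * IZR m * y / 2) * Ci)))%C).
  assert (Hq : forall j, sqrt 2 * cos (PI / 4 + PI * IZR j) = cos (PI * IZR j)).
  { intros j. assert (H : RtoC (sqrt 2 * cos (PI / 4 + PI * IZR j)) = RtoC (cos (PI * IZR j))).
    { rewrite <- (Rplus_0_l (PI * IZR j)) at 2. rewrite (RtoC_mult (sqrt 2)), !RtoC_cos_shift, cos_0, cos_PI4.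
      rewrite (Cmult_comm (Cexp _)), Cmult_assoc, <- RtoC_mult.
      replace (sqrt 2 * (1 / sqrt 2)) with 1 by (field; exact Hsq). ring. }
    injection H; auto. }
  assert (Hsgn : forall j, RtoC (cos (PI * IZR j)) = Cexp (RtoC (PI * IZR j) * Ci)%C).
  { intros j. rewrite <- (Rplus_0_l (PI * IZR j)) at 1. rewrite RtoC_cos_shift, cos_0. ring. }
  assert (F1 : is_sumZ (fun k => f (4 * k + 1)%Z) (RtoC (1 / sqrt 2) * (c1 * s1))%C).
  { assert (H := is_sumZ_scal (RtoC (1 / sqrt 2)) _ _
      (is_sumZ_scal c1 _ _ (theta_inversion _ _ _ _ Ha Hs1))).
    refine (is_sumZ_ext _ _ _ _ H). intros k. cbv beta. unfold f.
    rewrite plus_IZR, mult_IZR.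
    replace (PI / 4 * (4 * IZR k + 1)) with (PI / 4 + PI * IZR k) by field.
    rewrite Hq, Hsgn, <- Cexp_plus. unfold c1, theta_dual.
    transitivity (gint a * RtoC (1 / sqrt 2) * (Cexp (RtoC (PI * y / 2) * Ci) *
      Cexp (- (RtoC (PI * (IZR k + 1 / 4)) * RtoC (PI * (IZR k + 1 / 4)) * / a)
        + RtoC (2 * PI * IZR k * x) * Ci)))%C; [ring|].
    rewrite <- Cexp_plus. f_equal. apply Cexp_eq_mod with (- k)%Z. unfold x. rewrite opp_IZR.
    generalize (/ a)%C; intros [i1 i2]. apply C_eq; simpl; field. }
  assert (F3 : is_sumZ (fun k => f (4 * k + 3)%Z) (RtoC (1 / sqrt 2) * (c3 * s3))%C).
  { assert (H := is_sumZ_scal (RtoC (1 / sqrt 2)) _ _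
      (is_sumZ_scal c3 _ _ (theta_inversion _ _ _ _ Ha Hs3))).
    refine (is_sumZ_ext _ _ _ _ H). intros k. cbv beta. unfold f.
    rewrite plus_IZR, mult_IZR.
    (* By evenness of the cosine, 4k + 3 may be replaced by its negative 4 (-k - 1) + 1, which
       reduces this class to [Hq]. *)
    replace (cos (PI / 4 * (4 * IZR k + 3))) with (cos (PI / 4 + PI * IZR (- k - 1))).
    2:{ rewrite <- (cos_neg (PI / 4 * _)). f_equal. rewrite minus_IZR, opp_IZR. field. }
    rewrite Hq, Hsgn, <- Cexp_plus. unfold c3, theta_dual.
    transitivity (gint a * RtoC (1 / sqrt 2) * (Cexp (RtoC (PI * (3 * y / 2 - 1)) * Ci) *
      Cexp (- (RtoC (PI * (IZR k + 3 / 4)) * RtoC (PI * (IZR k + 3 / 4)) * / a)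
        + RtoC (2 * PI * IZR k * x) * Ci)))%C; [ring|].
    rewrite <- Cexp_plus. f_equal. apply Cexp_eq_mod with 0%Z. unfold x.
    rewrite minus_IZR, opp_IZR.
    generalize (/ a)%C; intros [i1 i2]. apply C_eq; simpl; field. }
  (* Convergence of the sum over all odd integers has to be known before [is_sumZ_blocks] can split
     it into the classes modulo 4. *)
  assert (HF : exists M, dominated (fun k => f (2 * k + 1)%Z) M).
  { assert (Hi := Re_inv_pos a Ha). assert (Hpi := PI_RGT_0).
    destruct (dominated_Cexp (fun k => - (RtoC (PI ^ 2 * IZR (2 * k + 1) ^ 2 / 16) * / a)
      + RtoC (PI * IZR (2 * k + 1) * y / 2) * Ci)%C (PI ^ 2 * Re (/ a)%C / 4)
      (- (PI ^ 2 * Re (/ a)%C / 4)) (- (PI ^ 2 * Re (/ a)%C / 16))) as [M HM].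
    - assert (0 < PI ^ 2) by (apply pow_lt; lra). nra.
    - intros k. rewrite plus_IZR, mult_IZR.
      generalize (/ a)%C; intros [i1 i2]. simpl. field.
    - exists (Cmod (gint a * RtoC (1 / sqrt 2)) * (sqrt 2 * M)). intros k. unfold f.
      rewrite Cmod_mult. set (K := Cmod (gint a * RtoC (1 / sqrt 2))).
      replace (K * (sqrt 2 * M) / (1 + IZR k ^ 2)) with (K * (sqrt 2 * (M / (1 + IZR k ^ 2))))
        by (unfold Rdiv; ring).
      apply Rmult_le_compat_l; [apply Cmod_ge_0|]. rewrite Cmod_mult.
      apply Rmult_le_compat; try apply Cmod_ge_0; [|apply HM].
      rewrite Cmod_R, Rabs_mult, (Rabs_pos_eq (sqrt 2)) by apply sqrt_pos.
      rewrite <- (Rmult_1_r (sqrt 2)) at 2. apply Rmult_le_compat_l; [apply sqrt_pos|].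
      apply Rabs_le, COS_bound. }
  destruct HF as [M HM]. destruct (dominated_sum _ _ HM) as [s' [Hs' _]].
  assert (E : s' = s).
  { rewrite Es.
    rewrite (is_sumZ_blocks (fun k => f (2 * k + 1)%Z) 2 s'
      (fun l => match l with O => RtoC (1 / sqrt 2) * (c1 * s1)
                | _ => RtoC (1 / sqrt 2) * (c3 * s3) end)%C).
    - simpl. ring.
    - lia.
    - exact Hs'.
    - intros l Hl. destruct l as [|[|l]]; [| |lia].
      + refine (is_sumZ_ext _ _ _ _ F1). intros k. f_equal. lia.
      + refine (is_sumZ_ext _ _ _ _ F3). intros k. f_equal. lia. }
  rewrite E in Hs'. apply is_sumZ_even_part in Hs'.
  refine (is_sumZ_ext _ _ _ _ Hs'). intros k. cbv beta. unfold f, quarter_dual.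
  set (m := (2 * k + 1)%Z). rewrite (RtoC_cos (PI * IZR m * y / 2)), !Cexp_plus, opp_IZR.
  replace (PI / 4 * - IZR m) with (- (PI / 4 * IZR m)) by ring. rewrite cos_neg.
  replace (RtoC (PI ^ 2 * (- IZR m) ^ 2 / 16)) with (RtoC (PI ^ 2 * IZR m ^ 2 / 16))
    by (f_equal; field).
  replace (RtoC (PI * - IZR m * y / 2) * Ci)%C with (- (RtoC (PI * IZR m * y / 2) * Ci))%C
    by (apply C_eq; simpl; field).
  unfold Cdiv. ring.
Qed.

(* Every odd integer is, up to sign, congruent modulo [2 (4 r - 1)] to exactly
   one of [1, 3, ..., 4 r - 1]. *)
Lemma odd_fold (h : Z -> C) (r : nat) (t : nat -> C) (s : C) :
  (1 <= r)%nat -> (forall m, h (- m)%Z = h m) ->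
  is_sumZ (fun k => h (2 * k + 1)%Z) s ->
  (forall l, (l < 2 * r - 1)%nat ->
     is_sumZ (fun n => h (2 * (4 * Z.of_nat r - 1) * n + 2 * Z.of_nat l + 1)%Z) (t l)) ->
  (forall n, h ((4 * Z.of_nat r - 1) * (2 * n + 1))%Z = 0%C) ->
  s = (2 * csum t (2 * r - 1))%C.
Proof.
  intros Hr Heven Hs Ht H0.
  set (T := fun l => if (l <? 2 * r - 1)%nat then t l
                     else if (l =? 2 * r - 1)%nat then 0%C else t (4 * r - 2 - l)%nat).
  rewrite (is_sumZ_blocks (fun k => h (2 * k + 1)%Z) (4 * r - 1) s T).
  - replace (4 * r - 1)%nat with (2 * r - 1 + (1 + (2 * r - 1)))%nat by lia.
    rewrite !csum_app, (csum_rev t).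
    rewrite (csum_ext T t).
    2:{ intros i Hi. unfold T. destruct (Nat.ltb_spec i (2 * r - 1)); [reflexivity|lia]. }
    rewrite (csum_ext (fun i => T (2 * r - 1 + i)%nat) (fun _ => 0%C)).
    2:{ intros i Hi. unfold T. destruct (Nat.ltb_spec (2 * r - 1 + i) (2 * r - 1)); [lia|].
        destruct (Nat.eqb_spec (2 * r - 1 + i) (2 * r - 1)); [reflexivity|lia]. }
    rewrite (csum_ext (fun i => T (2 * r - 1 + (1 + i))%nat) (fun i => t (2 * r - 1 - 1 - i)%nat)).
    2:{ intros i Hi. unfold T. destruct (Nat.ltb_spec (2 * r - 1 + (1 + i)) (2 * r - 1)); [lia|].
        destruct (Nat.eqb_spec (2 * r - 1 + (1 + i)) (2 * r - 1)); [lia|]. f_equal. lia. }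
    rewrite (csum_rev t). simpl csum at 2. ring.
  - lia.
  - exact Hs.
  - intros l Hl. unfold T. destruct (Nat.ltb_spec l (2 * r - 1)) as [H1|H1].
    + refine (is_sumZ_ext _ _ _ _ (Ht l H1)). intros n. cbv beta. f_equal. lia.
    + destruct (Nat.eqb_spec l (2 * r - 1)) as [H2|H2].
      * apply is_Clim_ext with (fun _ => RtoC 0); [|apply is_Clim_const].
        intros n. symmetry. apply csum_zero. intros i _. rewrite <- (H0 (Z.of_nat i - Z.of_nat n)%Z).
        f_equal. lia.
      * refine (is_sumZ_ext _ _ _ _ (is_sumZ_refl _ _ (Ht (4 * r - 2 - l)%nat ltac:(lia)))).
        intros n. cbv beta. rewrite <- Heven. f_equal. lia.
Qed.

(** For every odd m exactly one of m and - m is congruent to 1 modulo 4; the class of 3 is reached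
    by reflection. *)
Lemma odd_fold_4 (h : Z -> C) (t s : C) :
  (forall m, h (- m)%Z = h m) ->
  is_sumZ (fun k => h (2 * k + 1)%Z) s -> is_sumZ (fun n => h (4 * n + 1)%Z) t ->
  s = (2 * t)%C.
Proof.
  intros Heven Hs Ht.
  rewrite (is_sumZ_blocks (fun k => h (2 * k + 1)%Z) 2 s (fun _ => t)).
  - simpl. ring.
  - lia.
  - exact Hs.
  - intros l Hl. destruct l as [|[|l]]; [| |lia].
    + refine (is_sumZ_ext _ _ _ _ Ht). intros n. f_equal. lia.
    + refine (is_sumZ_ext _ _ _ _ (is_sumZ_refl _ _ Ht)). intros n. cbv beta.
      rewrite <- Heven. f_equal. lia.
Qed.

(** * The theta series in [g] and [gvee] *)

(* The terms of the triple product with base [(-1)^d exp (- p al)] and argument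
   [(-1)^e exp (- p be)], after completing the square in the exponent. *)
Definition jtheta (p : C) (al be d e : R) (k : Z) : C :=
  Cexp (RtoC (PI * (IZR k + d * (IZR k * (IZR k - 1) / 2) + e * IZR k)) * Ci
        - p * RtoC (al / 2 * (IZR k - (al - 2 * be) / (2 * al)) ^ 2))%C.

Definition jprod (p : C) (al be d e : R) : C :=
  qpochs [Cexp (RtoC (PI * e) * Ci - p * RtoC be);
          Cexp (RtoC (PI * (d - e)) * Ci - p * RtoC (al - be));
          Cexp (RtoC (PI * d) * Ci - p * RtoC al)]%C
         (Cexp (RtoC (PI * d) * Ci - p * RtoC al))%C.

Lemma jtheta_dominated (p : C) (al be d e : R) : 0 < Re p -> 0 < al ->
  exists M, dominated (jtheta p al be d e) M.
Proof.
  intros Hp Hal. set (x := (al - 2 * be) / (2 * al)).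
  apply (dominated_Cexp _ (Re p * al / 2) (Re p * al * x) (- Re p * al / 2 * x ^ 2)).
  - nra.
  - intros k. fold x. destruct p as [p1 p2]; simpl. field.
Qed.

Lemma jtheta_correct (p : C) (al be d e : R) : 0 < Re p -> 0 < al ->
  is_sumZ (jtheta p al be d e) (sumZ (jtheta p al be d e)).
Proof.
  intros Hp Hal. destruct (jtheta_dominated p al be d e Hp Hal) as [M HM].
  exact (dominated_sumZ _ _ HM).
Qed.

(** Completing the square in al k(k-1)/2 + be k leaves the constant (al - 2 be)^2 / (8 al); these
    constants are the origin of the fractional powers of q in [g] and [gvee]. *)
Lemma jtheta_prod (p : C) (al be d e : R) : 0 < Re p -> 0 < al ->
  sumZ (jtheta p al be d e)
  = (Cexp (- p * RtoC ((al - 2 * be) ^ 2 / (8 * al))) * jprod p al be d e)%C.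
Proof.
  intros Hp Hal. apply is_sumZ_sumZ.
  set (u := (RtoC (PI * e) * Ci - p * RtoC be)%C).
  set (v := (RtoC (PI * d) * Ci - p * RtoC al)%C).
  assert (Hv : Re v < 0).
  { unfold v. destruct p as [p1 p2]; simpl in *. nra. }
  assert (H := jacobi_triple_product u v Hv).
  unfold jprod. fold u v.
  replace (RtoC (PI * (d - e)) * Ci - p * RtoC (al - be))%C with (v - u)%C
    by (unfold u, v; destruct p as [p1 p2]; apply C_eq; simpl; ring).
  refine (is_sumZ_ext _ _ _ _ (is_sumZ_scal _ _ _ H)). intros k. cbv beta.
  unfold jtp_term, jtheta. rewrite <- Cexp_plus. f_equal. unfold u, v.
  destruct p as [p1 p2]; apply C_eq; simpl; field; lra.
Qed.

Definition costh (r j l : nat) : R :=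
  cos ((2 * INR j - 1) * (2 * INR l - 1) * PI / (2 * (4 * INR r - 1))).

Lemma Cinv_mult_real (p : C) (x : R) : 0 < Re p -> x <> 0 ->
  (/ (p * RtoC x))%C = (RtoC (/ x) * / p)%C.
Proof.
  intros Hp Hx.
  assert (Hp0 : p <> 0%C) by (intros H; rewrite H in Hp; simpl in Hp; lra).
  rewrite RtoC_inv by exact Hx. field. split; [exact Hp0|].
  intros H; injection H; exact Hx.
Qed.

Lemma Re_mult_real (p : C) (x : R) : 0 < Re p -> 0 < x -> 0 < Re (p * RtoC x)%C.
Proof. intros Hp Hx. destruct p as [p1 p2]; simpl in *. nra. Qed.

Lemma Re_dual (p : C) : 0 < Re p -> 0 < Re (RtoC (PI ^ 2) * / p)%C.
Proof.
  intros Hp. rewrite Cmult_comm. apply Re_mult_real; [apply Re_inv_pos, Hp|].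
  apply pow_lt, PI_RGT_0.
Qed.

Lemma N_pos (r : nat) : (1 <= r)%nat -> 3 <= 4 * INR r - 1.
Proof. intros Hr. apply le_INR in Hr. simpl in Hr. lra. Qed.

(** Adding 2 (4r-1) to m adds (2j-1) PI to the argument, an odd multiple of PI, so a residue class
    contributes a single cosine and the sign (-1)^n. *)
Lemma cos_fold (r j l : nat) (n : Z) : (1 <= r)%nat ->
  RtoC (cos (PI * IZR (2 * (4 * Z.of_nat r - 1) * n + 2 * Z.of_nat l + 1)
             * ((2 * INR j - 1) / (2 * (4 * INR r - 1)))))
  = (Cexp (RtoC (PI * IZR n) * Ci) * RtoC (costh r j (l + 1)))%C.
Proof.
  intros Hr. assert (HN := N_pos r Hr).
  replace (PI * _ * _) with ((2 * INR j - 1) * (2 * INR (l + 1) - 1) * PI / (2 * (4 * INR r - 1))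
                             + PI * IZR (n * (2 * Z.of_nat j - 1))).
  - rewrite RtoC_cos_shift. unfold costh. f_equal.
    apply Cexp_eq_mod with (n * (Z.of_nat j - 1))%Z.
    rewrite !mult_IZR, !minus_IZR, !mult_IZR. apply C_eq; simpl; ring.
  - rewrite plus_INR, !plus_IZR, !mult_IZR, !minus_IZR, !mult_IZR, <- !INR_IZR_INZ. simpl INR.
    field. lra.
Qed.

(** The argument is (2n+1)(2j-1) PI / 2; this removes the one class of odd integers that has no row
    in [Smat]. *)
Lemma cos_mid (r j : nat) (n : Z) : (1 <= r)%nat ->
  cos (PI * IZR ((4 * Z.of_nat r - 1) * (2 * n + 1)) * ((2 * INR j - 1) / (2 * (4 * INR r - 1)))) = 0.
Proof.
  intros Hr. assert (HN := N_pos r Hr). apply cos_eq_0_1.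
  exists (2 * n * Z.of_nat j + Z.of_nat j - n - 1)%Z.
  rewrite !minus_IZR, plus_IZR, !mult_IZR, minus_IZR, plus_IZR, !mult_IZR, <- !INR_IZR_INZ.
  field. lra.
Qed.

(** * Inversion of the two numerators and the two denominators *)

Lemma A_transform (p : C) (r j : nat) : 0 < Re p -> (1 <= r)%nat ->
  sumZ (jtheta p (4 * (4 * INR r - 1)) (8 * INR r - 4 * INR j) 0 0)
  = (2 * (gint (p * RtoC (2 * (4 * INR r - 1))) *
     csum (fun l => RtoC (costh r j (l + 1)) *
       sumZ (jtheta (RtoC (PI ^ 2) * / p) (4 * INR r - 1) (2 * INR r - INR (l + 1)) 0 0))
       (2 * r - 1)))%C.
Proof.
  intros Hp Hr. assert (HN := N_pos r Hr).
  set (N := 4 * INR r - 1) in *. set (a := (p * RtoC (2 * N))%C).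
  assert (Ha : 0 < Re a) by (apply Re_mult_real; lra).
  set (x := - ((2 * INR j - 1) / (2 * N))).
  rewrite <- csum_scal.
  apply (odd_fold (fun m => gint a * alt_dual a x m)%C r); [exact Hr| | | |].
  - intros m. f_equal. unfold alt_dual. rewrite opp_IZR.
    replace ((- IZR m) ^ 2) with (IZR m ^ 2) by ring.
    replace (PI * - IZR m * x) with (- (PI * IZR m * x)) by ring. rewrite cos_neg. reflexivity.
  - apply (alternating_inversion a x _ Ha).
    refine (is_sumZ_ext _ _ _ _ (jtheta_correct p _ _ 0 0 Hp _)); [|lra].
    intros k. unfold jtheta. f_equal. unfold a, x, N in *.
    destruct p as [p1 p2]; apply C_eq; simpl; field; lra.
  - intros l Hl.
    destruct (jtheta_dominated (RtoC (PI ^ 2) * / p)%C N (2 * INR r - INR (l + 1)) 0 0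
      (Re_dual p Hp) ltac:(lra)) as [M HM].
    (* The dual Gaussian contains n + (2l+1)/(2N), while [jtheta] contains k - (2l+1)/(2N); the two
       match under k = - n. *)
    assert (H := is_sumZ_opp _ _ _ HM (dominated_sumZ _ _ HM)).
    refine (is_sumZ_ext _ _ _ _ (is_sumZ_scal _ _ _ (is_sumZ_scal _ _ _ H))).
    intros n. cbv beta. f_equal. unfold alt_dual.
    replace (PI * IZR (2 * (4 * Z.of_nat r - 1) * n + 2 * Z.of_nat l + 1) * x)
      with (- (PI * IZR (2 * (4 * Z.of_nat r - 1) * n + 2 * Z.of_nat l + 1)
               * ((2 * INR j - 1) / (2 * (4 * INR r - 1))))) by (unfold x, N; ring).
    rewrite cos_neg. rewrite cos_fold by exact Hr.
    rewrite Cmult_assoc, (Cmult_comm (RtoC _)). f_equal.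
    unfold jtheta. rewrite <- Cexp_plus. apply Cexp_eq_mod with (- n)%Z.
    unfold a. rewrite Cinv_mult_real by lra.
    rewrite opp_IZR, plus_INR, !plus_IZR, !mult_IZR, !minus_IZR, !mult_IZR, <- !INR_IZR_INZ.
    simpl INR. unfold N. fold N.
    replace (4 * INR r - 1) with N by reflexivity.
    replace (INR r) with ((N + 1) / 4) by (unfold N; field).
    generalize (/ p)%C; intros [i1 i2]. apply C_eq; simpl; field; lra.
  - intros n. unfold alt_dual.
    replace (PI * IZR ((4 * Z.of_nat r - 1) * (2 * n + 1)) * x)
      with (- (PI * IZR ((4 * Z.of_nat r - 1) * (2 * n + 1)) * ((2 * INR j - 1) / (2 * (4 * INR r - 1)))))
      by (unfold x, N; ring).
    rewrite cos_neg. rewrite cos_mid by exact Hr. ring.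
Qed.

Lemma B_transform (p : C) (r j : nat) : 0 < Re p -> (1 <= r)%nat ->
  sumZ (jtheta p (4 * INR r - 1) (2 * INR j - 1) 1 1)
  = (2 * (gint (p * RtoC ((4 * INR r - 1) / 2)) * RtoC (1 / sqrt 2) *
     csum (fun l => RtoC (costh r j (l + 1)) *
       (Cexp (RtoC (PI * (INR (l + 1) * (INR (l + 1) - 1) / 2)) * Ci) *
        sumZ (jtheta (RtoC (PI ^ 2) * / p) (4 * INR r - 1) (2 * INR r - INR (l + 1))
                (4 * INR r - 1) (2 * INR r - INR (l + 1)))))
       (2 * r - 1)))%C.
Proof.
  intros Hp Hr. assert (HN := N_pos r Hr).
  set (N := 4 * INR r - 1) in *. set (a := (p * RtoC (N / 2))%C).
  assert (Ha : 0 < Re a) by (apply Re_mult_real; lra).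
  set (y := (2 * INR j - 1) / N).
  rewrite <- csum_scal.
  apply (odd_fold (fun m => gint a * RtoC (1 / sqrt 2) * quarter_dual a y m)%C r); [exact Hr| | | |].
  - intros m. f_equal. unfold quarter_dual. rewrite opp_IZR.
    replace ((- IZR m) ^ 2) with (IZR m ^ 2) by ring.
    replace (PI * - IZR m * y / 2) with (- (PI * IZR m * y / 2)) by field.
    replace (PI / 4 * - IZR m) with (- (PI / 4 * IZR m)) by ring.
    rewrite !cos_neg. reflexivity.
  - apply (quarter_inversion a y _ Ha).
    refine (is_sumZ_ext _ _ _ _ (jtheta_correct p _ _ 1 1 Hp _)); [|lra].
    intros k. unfold jtheta. apply Cexp_eq_mod with k. unfold a, y.
    destruct p as [p1 p2]; apply C_eq; simpl; field; lra.
  - intros l Hl.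
    destruct (jtheta_dominated (RtoC (PI ^ 2) * / p)%C N (2 * INR r - INR (l + 1)) N
      (2 * INR r - INR (l + 1)) (Re_dual p Hp) ltac:(lra)) as [M HM].
    assert (H := is_sumZ_opp _ _ _ HM (dominated_sumZ _ _ HM)).
    refine (is_sumZ_ext _ _ _ _ (is_sumZ_scal _ _ _ (is_sumZ_scal _ _ _ (is_sumZ_scal _ _ _ H)))).
    intros n. cbv beta. f_equal. unfold quarter_dual.
    set (m := (2 * (4 * Z.of_nat r - 1) * n + 2 * Z.of_nat l + 1)%Z).
    replace (PI * IZR m * y / 2)
      with (PI * IZR m * ((2 * INR j - 1) / (2 * (4 * INR r - 1))))
      by (unfold y, N in *; field; lra).
    unfold m at 3. rewrite cos_fold by exact Hr.
    (* Up to the full turns 2 PI r n, PI m / 4 is PI/2 (z - 1/2), so the sign of the dual series is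
       (-1)^(z(z-1)/2). Its part depending on l + 1 alone is the sign in front of the second term of
       [gvee]; the rest, with (-1)^n from [cos_fold], changes q to -q in the product. *)
    set (z := (Z.of_nat l + 1 - n)%Z).
    assert (Ez : RtoC (sqrt 2 * cos (PI / 4 * IZR m))
                 = Cexp (RtoC (PI * (IZR z * (IZR z - 1) / 2)) * Ci)%C).
    { rewrite quarter_sign.
      replace (PI / 4 * IZR m)
        with (PI / 2 * (IZR z - 1 / 2) + PI * IZR (2 * (Z.of_nat r * n))).
      - rewrite !(RtoC_mult (sqrt 2)). f_equal. rewrite RtoC_cos_shift.
        rewrite (Cexp_eq_mod _ 0 (Z.of_nat r * n)), Cexp_0; [ring|].
        rewrite (mult_IZR 2). apply C_eq; simpl; ring.
      - unfold m, z. rewrite !minus_IZR, !plus_IZR, !mult_IZR, minus_IZR, !mult_IZR. field. }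
    rewrite Ez.
    (* The phases differ by multiples of n (n + 1) / 2 turns, which must be exhibited as an
       integer. *)
    assert (Hw : exists w, (n * (n + 1) = 2 * w)%Z).
    { destruct (Z.Even_or_Odd n) as [[q ->]|[q ->]].
      - exists (q * (2 * q + 1))%Z. ring.
      - exists ((2 * q + 1) * (q + 1))%Z. ring. }
    destruct Hw as [w Hw].
    assert (Hw' : IZR w = IZR n * (IZR n + 1) / 2).
    { apply (f_equal IZR) in Hw. rewrite !mult_IZR, plus_IZR in Hw. lra. }
    rewrite (Cmult_comm _ (RtoC (costh r j (l + 1)))), !Cmult_assoc.
    rewrite (Cmult_comm _ (RtoC (costh r j (l + 1)))), <- !Cmult_assoc. f_equal.
    unfold jtheta. rewrite <- !Cexp_plus.
    apply Cexp_eq_mod with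
      (- n + (2 * Z.of_nat r - 1) * w - Z.of_nat r * n + (Z.of_nat l + 1) * n)%Z.
    unfold a. rewrite Cinv_mult_real by lra. unfold m, z.
    repeat rewrite ?opp_IZR, ?plus_INR, ?plus_IZR, ?mult_IZR, ?minus_IZR.
    rewrite Hw', <- !INR_IZR_INZ. simpl INR.
    replace (INR r) with ((N + 1) / 4) by (unfold N; field).
    generalize (/ p)%C; intros [i1 i2]. apply C_eq; simpl; field; lra.
  - intros n. unfold quarter_dual.
    replace (PI * IZR ((4 * Z.of_nat r - 1) * (2 * n + 1)) * y / 2)
      with (PI * IZR ((4 * Z.of_nat r - 1) * (2 * n + 1)) * ((2 * INR j - 1) / (2 * (4 * INR r - 1))))
      by (unfold y, N in *; field; lra).
    rewrite cos_mid by exact Hr. ring.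
Qed.

(** The shift 1/4 makes every cosine cos (PI/4 + PI n) = (-1)^n / sqrt 2, so the series reproduces
    itself. *)
Lemma D1_transform (p : C) : 0 < Re p ->
  sumZ (jtheta p 4 1 0 0)
  = (2 * (gint (p * RtoC 2) * RtoC (1 / sqrt 2) * sumZ (jtheta (RtoC (PI ^ 2) * / p) 4 1 0 0)))%C.
Proof.
  intros Hp. set (a := (p * RtoC 2)%C).
  assert (Ha : 0 < Re a) by (apply Re_mult_real; lra).
  apply (odd_fold_4 (fun m => gint a * alt_dual a (- (1 / 4)) m)%C).
  - intros m. f_equal. unfold alt_dual. rewrite opp_IZR.
    replace ((- IZR m) ^ 2) with (IZR m ^ 2) by ring.
    replace (PI * - IZR m * - (1 / 4)) with (- (PI * IZR m * - (1 / 4))) by ring.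
    rewrite cos_neg. reflexivity.
  - apply (alternating_inversion a _ _ Ha).
    refine (is_sumZ_ext _ _ _ _ (jtheta_correct p 4 1 0 0 Hp _)); [|lra].
    intros k. unfold jtheta. f_equal. unfold a.
    destruct p as [p1 p2]; apply C_eq; simpl; field.
  - destruct (jtheta_dominated (RtoC (PI ^ 2) * / p)%C 4 1 0 0 (Re_dual p Hp) ltac:(lra)) as [M HM].
    assert (H := is_sumZ_opp _ _ _ HM (dominated_sumZ _ _ HM)).
    refine (is_sumZ_ext _ _ _ _ (is_sumZ_scal _ _ _ H)).
    intros n. cbv beta. rewrite <- !Cmult_assoc. f_equal. unfold alt_dual.
    replace (PI * IZR (4 * n + 1) * - (1 / 4)) with (- (PI / 4 + PI * IZR n))
      by (rewrite plus_IZR, mult_IZR; field).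
    rewrite cos_neg, RtoC_cos_shift, cos_PI4, Cmult_comm, Cmult_assoc. f_equal.
    unfold jtheta. rewrite <- Cexp_plus. apply Cexp_eq_mod with (- n)%Z.
    unfold a. rewrite Cinv_mult_real by lra. rewrite opp_IZR, plus_IZR, mult_IZR.
    generalize (/ p)%C; intros [i1 i2]. apply C_eq; simpl; field.
Qed.

(** With shift 0 all cosines are 1, so the dual series has no signs, which is the triple product
    with argument -q. *)
Lemma D2_transform (p : C) : 0 < Re p ->
  sumZ (jtheta p 4 2 0 0)
  = (2 * (gint (p * RtoC 2) * sumZ (jtheta (RtoC (PI ^ 2) * / p) 4 1 0 1)))%C.
Proof.
  intros Hp. set (a := (p * RtoC 2)%C).
  assert (Ha : 0 < Re a) by (apply Re_mult_real; lra).
  apply (odd_fold_4 (fun m => gint a * alt_dual a 0 m)%C).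
  - intros m. f_equal. unfold alt_dual. rewrite opp_IZR, !Rmult_0_r.
    replace ((- IZR m) ^ 2) with (IZR m ^ 2) by ring. reflexivity.
  - apply (alternating_inversion a _ _ Ha).
    refine (is_sumZ_ext _ _ _ _ (jtheta_correct p 4 2 0 0 Hp _)); [|lra].
    intros k. unfold jtheta. f_equal. unfold a.
    destruct p as [p1 p2]; apply C_eq; simpl; field.
  - destruct (jtheta_dominated (RtoC (PI ^ 2) * / p)%C 4 1 0 1 (Re_dual p Hp) ltac:(lra)) as [M HM].
    assert (H := is_sumZ_opp _ _ _ HM (dominated_sumZ _ _ HM)).
    refine (is_sumZ_ext _ _ _ _ (is_sumZ_scal _ _ _ H)).
    intros n. cbv beta. f_equal. unfold alt_dual.
    rewrite Rmult_0_r, cos_0, Cmult_1_r.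
    unfold jtheta. apply Cexp_eq_mod with (- n)%Z.
    unfold a. rewrite Cinv_mult_real by lra. rewrite opp_IZR, plus_IZR, mult_IZR.
    generalize (/ p)%C; intros [i1 i2]. apply C_eq; simpl; field.
Qed.

(** * The transformation law of the quotients *)

Lemma Cinv_0 : (/ 0)%C = 0%C.
Proof. apply C_eq; simpl; unfold Rdiv; ring. Qed.

(* For [y = 0] both sides are 0, by Rocq's convention [/ 0 = 0]. *)
Lemma Cdiv_mult (c d x y : C) : d <> 0%C -> ((c * x) / (d * y))%C = ((c / d) * (x / y))%C.
Proof.
  intros Hd. destruct (Ceq_dec y 0) as [->|Hy].
  - unfold Cdiv. rewrite Cmult_0_r, !Cinv_0. ring.
  - field. split; assumption.
Qed.

Definition g_theta (r j : nat) (p : C) : C :=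
  (sumZ (jtheta p (4 * (4 * INR r - 1)) (8 * INR r - 4 * INR j) 0 0) / sumZ (jtheta p 4 1 0 0)
   + sumZ (jtheta p (4 * INR r - 1) (2 * INR j - 1) 1 1) / sumZ (jtheta p 4 2 0 0))%C.

Definition gvee_theta (r l : nat) (p : C) : C :=
  (1 / 2 * (sumZ (jtheta p (4 * INR r - 1) (2 * INR r - INR l) 0 0) / sumZ (jtheta p 4 1 0 0)
    + Cexp (RtoC (PI * (INR l * (INR l - 1) / 2)) * Ci) *
      (sumZ (jtheta p (4 * INR r - 1) (2 * INR r - INR l) (4 * INR r - 1) (2 * INR r - INR l))
       / sumZ (jtheta p 4 1 0 1))))%C.

Lemma theta_transform (p : C) (r j : nat) : 0 < Re p -> (1 <= r)%nat ->
  g_theta r j p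
  = csum (fun l => 2 * RtoC (s_coef r j (l + 1)) * gvee_theta r (l + 1) (RtoC (PI ^ 2) * / p))%C
      (2 * r - 1).
Proof.
  intros Hp Hr. assert (HN := N_pos r Hr).
  unfold g_theta.
  rewrite A_transform, B_transform, D1_transform, D2_transform by assumption.
  set (ip := (RtoC (PI ^ 2) * / p)%C). set (N := 4 * INR r - 1) in *.
  assert (HsN : 0 < sqrt N) by (apply sqrt_lt_R0; lra).
  assert (Hs2 : 0 < sqrt 2) by (apply sqrt_lt_R0; lra).
  assert (HsN2 : sqrt N * sqrt N = N) by (apply sqrt_sqrt; lra).
  assert (Hs22 : sqrt 2 * sqrt 2 = 2) by (apply sqrt_sqrt; lra).
  assert (G2 : gint (p * RtoC 2) <> 0%C) by (apply gint_neq_0, Re_mult_real; lra).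
  assert (GA : gint (p * RtoC (2 * N)) <> 0%C) by (apply gint_neq_0, Re_mult_real; lra).
  assert (GB : gint (p * RtoC (N / 2)) <> 0%C) by (apply gint_neq_0, Re_mult_real; lra).
  (* The scalings come from 2 p = (2 N p) / N, with l = sqrt N, and in [EB] from 2 p = (N p / 2) /
     (N / 4), with l = sqrt N / 2. *)
  assert (EA : gint (p * RtoC 2) = (RtoC (sqrt N) * gint (p * RtoC (2 * N)))%C).
  { rewrite <- gint_scale by (try apply Re_mult_real; lra). f_equal.
    rewrite HsN2, <- Cmult_assoc, <- RtoC_mult. do 2 f_equal. field. lra. }
  assert (EB : gint (p * RtoC 2) = (RtoC (sqrt N / 2) * gint (p * RtoC (N / 2)))%C).
  { rewrite <- gint_scale by (try apply Re_mult_real; lra). f_equal.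
    replace (sqrt N / 2 * (sqrt N / 2)) with (sqrt N * sqrt N / 4) by field.
    rewrite HsN2, <- Cmult_assoc, <- RtoC_mult. do 2 f_equal. field. lra. }
  assert (nzR : forall x, x <> 0 -> RtoC x <> 0%C) by (intros x Hx H; injection H; exact Hx).
  set (XA := csum _ _). set (XB := csum _ _).
  set (YA := sumZ (jtheta ip 4 1 0 0)). set (YB := sumZ (jtheta ip 4 1 0 1)).
  set (gA := gint (p * RtoC (2 * N))) in *. set (gB := gint (p * RtoC (N / 2))) in *.
  set (g2 := gint (p * RtoC 2)) in *.
  (* Here sqrt (2/N) is (1 / sqrt N) / (1 / sqrt 2), while in [HB] it is (2 / sqrt N) (1 / sqrt
     2). *)
  assert (HA : ((2 * (gA * XA)) / (2 * (g2 * RtoC (1 / sqrt 2) * YA)))%C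
               = (RtoC (sqrt (2 / N)) * (XA / YA))%C).
  { rewrite !Cmult_assoc, Cdiv_mult.
    - f_equal. rewrite EA, sqrt_div_alt by lra.
      rewrite !RtoC_div by lra. field.
      repeat split; try (apply nzR; lra); exact GA.
    - repeat apply Cmult_neq_0; try exact G2; apply nzR; [lra|].
      apply Rgt_not_eq, Rdiv_lt_0_compat; lra. }
  assert (HB : ((2 * (gB * RtoC (1 / sqrt 2) * XB)) / (2 * (g2 * YB)))%C
               = (RtoC (sqrt (2 / N)) * (XB / YB))%C).
  { rewrite !Cmult_assoc, Cdiv_mult.
    - f_equal. rewrite EB, sqrt_div_alt by lra.
      replace (sqrt 2 / sqrt N) with (2 * (1 / sqrt 2) / sqrt N).
      2:{ f_equal. apply Rmult_eq_reg_r with (sqrt 2); [|lra]. rewrite Hs22. field. lra. }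
      rewrite !RtoC_div, RtoC_mult, !RtoC_div by lra. field.
      repeat split; try (apply nzR; lra); exact GB.
    - apply Cmult_neq_0; [apply nzR; lra|exact G2]. }
  rewrite HA, HB. unfold Cdiv. rewrite (Cmult_comm XA), (Cmult_comm XB).
  unfold XA, XB. rewrite <- !csum_scal, <- csum_plus.
  apply csum_ext. intros l Hl. unfold gvee_theta, s_coef. fold N. fold YA YB.
  change (cos ((2 * INR j - 1) * (2 * INR (l + 1) - 1) * PI / (2 * N))) with (costh r j (l + 1)).
  rewrite (RtoC_mult (sqrt (2 / N))).
  set (c := RtoC (sqrt (2 / N))). set (K := RtoC (costh r j (l + 1))). set (E := Cexp _).
  set (T1 := sumZ (jtheta ip N _ 0 0)). set (T2 := sumZ (jtheta ip N _ N _)).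
  unfold Cdiv.
  transitivity ((2 * / 2) * (c * (/ YA * (K * T1)) + c * (/ YB * (K * (E * T2)))))%C; [|ring].
  rewrite Cinv_r by (apply nzR; lra). ring.
Qed.

(** * From theta series back to products in q *)

Definition neg_log_q (tau : C) : C := (- (RtoC (2 * PI) * Ci * tau))%C.

Lemma Re_neg_log_q (tau : C) : Re (neg_log_q tau) = 2 * PI * Im tau.
Proof. destruct tau as [t1 t2]; simpl. ring. Qed.

Lemma qpow_neg_log_q (tau : C) (x : R) : qpow tau x = Cexp (- neg_log_q tau * RtoC x)%C.
Proof.
  unfold qpow, neg_log_q. f_equal. destruct tau as [t1 t2]; apply C_eq; simpl; ring.
Qed.

Lemma qpow_nat (tau : C) (n : nat) :
  (qpow tau 1 ^ n)%C = Cexp (- neg_log_q tau * RtoC (INR n))%C.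
Proof.
  rewrite qpow_neg_log_q, Cexp_pow. f_equal. rewrite Cmult_1_r. ring.
Qed.

(** This lemma and the next two recognise the three shapes q^n, - q^n and (- q)^n of the entries of
    the products; [z] counts full turns in the phase. *)
Lemma q_even (tau : C) (e x : R) (n : nat) (z : Z) : e = 2 * IZR z -> x = INR n ->
  Cexp (RtoC (PI * e) * Ci - neg_log_q tau * RtoC x)%C = (qpow tau 1 ^ n)%C.
Proof.
  intros -> ->. rewrite qpow_nat. apply Cexp_eq_mod with z.
  generalize (neg_log_q tau); intros [t1 t2]; apply C_eq; simpl; ring.
Qed.

Lemma q_odd (tau : C) (e x : R) (n : nat) (z : Z) : e = 2 * IZR z + 1 -> x = INR n ->
  Cexp (RtoC (PI * e) * Ci - neg_log_q tau * RtoC x)%C = (- qpow tau 1 ^ n)%C.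
Proof.
  intros -> ->. rewrite qpow_nat.
  replace (- Cexp (- neg_log_q tau * RtoC (INR n)))%C
    with (Cexp (RtoC PI * Ci) * Cexp (- neg_log_q tau * RtoC (INR n)))%C by (rewrite Cexp_PI; ring).
  rewrite <- Cexp_plus. apply Cexp_eq_mod with z.
  generalize (neg_log_q tau); intros [t1 t2]; apply C_eq; simpl; ring.
Qed.

Lemma q_neg (tau : C) (x : R) (n : nat) : x = INR n ->
  Cexp (RtoC (PI * x) * Ci - neg_log_q tau * RtoC x)%C = ((- qpow tau 1) ^ n)%C.
Proof.
  intros ->. rewrite qpow_neg_log_q.
  replace (- Cexp (- neg_log_q tau * RtoC 1))%C
    with (Cexp (RtoC PI * Ci) * Cexp (- neg_log_q tau * RtoC 1))%C by (rewrite Cexp_PI; ring).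
  rewrite <- Cexp_plus, Cexp_pow. f_equal.
  generalize (neg_log_q tau); intros [t1 t2]; apply C_eq; simpl; ring.
Qed.

Lemma jprod_entries (p : C) (al be d e : R) (a b c : C) :
  Cexp (RtoC (PI * e) * Ci - p * RtoC be)%C = a ->
  Cexp (RtoC (PI * (d - e)) * Ci - p * RtoC (al - be))%C = b ->
  Cexp (RtoC (PI * d) * Ci - p * RtoC al)%C = c ->
  jprod p al be d e = qpochs [a; b; c] c.
Proof. intros <- <- <-. reflexivity. Qed.

Lemma Cexp_quot (p P Q : C) (x y : R) :
  ((Cexp (- p * RtoC x) * P) / (Cexp (- p * RtoC y) * Q))%C
  = (Cexp (- p * RtoC (x - y)) * (P / Q))%C.
Proof.
  rewrite Cdiv_mult by apply Cexp_neq_0. f_equal.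
  assert (H := Cexp_neq_0 (- p * RtoC y)%C).
  replace (- p * RtoC x)%C with (- p * RtoC (x - y) + - p * RtoC y)%C
    by (rewrite RtoC_minus; ring).
  rewrite Cexp_plus. field. exact H.
Qed.

Ltac push_INR := repeat rewrite ?minus_INR, ?plus_INR, ?mult_INR by lia; simpl INR.

(** The outer power of q is the completed-square constant of the second quotient, whose denominator
    has constant 0; the inner power (2j - r - 1)/2 is the difference between the constants of the
    two quotients. *)
Lemma g_eq_theta (r j : nat) (tau : C) : (1 <= r)%nat -> (1 <= j <= 2 * r - 1)%nat ->
  0 < Im tau -> g r j tau = g_theta r j (neg_log_q tau).
Proof.
  intros Hr Hj Htau. assert (HN := N_pos r Hr).
  assert (Hp : 0 < Re (neg_log_q tau)).
  { rewrite Re_neg_log_q. generalize PI_RGT_0. nra. }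
  unfold g_theta. rewrite !jtheta_prod by lra.
  rewrite (jprod_entries (neg_log_q tau) (4 * (4 * INR r - 1)) (8 * INR r - 4 * INR j) 0 0
    (qpow tau 1 ^ (8 * r - 4 * j)) (qpow tau 1 ^ (8 * r + 4 * j - 4)) (qpow tau 1 ^ (16 * r - 4))).
  2:{ apply (q_even _ _ _ _ 0); [ring|push_INR; ring]. }
  2:{ apply (q_even _ _ _ _ 0); [ring|push_INR; ring]. }
  2:{ apply (q_even _ _ _ _ 0); [ring|push_INR; ring]. }
  rewrite (jprod_entries (neg_log_q tau) 4 1 0 0 (qpow tau 1) (qpow tau 1 ^ 3) (qpow tau 1 ^ 4)).
  2:{ rewrite <- (Cpow_1_r (qpow tau 1)). apply (q_even _ _ _ _ 0); [ring|push_INR; ring]. }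
  2:{ apply (q_even _ _ _ _ 0); [ring|push_INR; ring]. }
  2:{ apply (q_even _ _ _ _ 0); [ring|push_INR; ring]. }
  rewrite (jprod_entries (neg_log_q tau) (4 * INR r - 1) (2 * INR j - 1) 1 1
    (- qpow tau 1 ^ (2 * j - 1)) (qpow tau 1 ^ (4 * r - 2 * j)) (- qpow tau 1 ^ (4 * r - 1))).
  2:{ apply (q_odd _ _ _ _ 0); [ring|push_INR; ring]. }
  2:{ apply (q_even _ _ _ _ 0); [ring|push_INR; ring]. }
  2:{ apply (q_odd _ _ _ _ 0); [ring|push_INR; ring]. }
  rewrite (jprod_entries (neg_log_q tau) 4 2 0 0 (qpow tau 1 ^ 2) (qpow tau 1 ^ 2) (qpow tau 1 ^ 4)).
  2:{ apply (q_even _ _ _ _ 0); [ring|push_INR; ring]. }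
  2:{ apply (q_even _ _ _ _ 0); [ring|push_INR; ring]. }
  2:{ apply (q_even _ _ _ _ 0); [ring|push_INR; ring]. }
  rewrite !Cexp_quot. unfold g.
  rewrite (qpow_neg_log_q tau ((4 * INR r - 4 * INR j + 1) ^ 2 / _)), (qpow_neg_log_q tau ((2 * INR j - INR r - 1) / 2)).
  rewrite Cmult_plus_distr_l, Cmult_assoc, <- Cexp_plus.
  rewrite <- Cmult_plus_distr_l, <- RtoC_plus.
  f_equal.
  - f_equal. f_equal. f_equal. f_equal. field. lra.
  - f_equal. f_equal. f_equal. f_equal. field. lra.
Qed.

Lemma sign_nat (j : nat) :
  ((- (1)) ^ (j * (j - 1) / 2))%C = Cexp (RtoC (PI * (INR j * (INR j - 1) / 2)) * Ci)%C.
Proof.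
  assert (H : (j * (j - 1) = 2 * (j * (j - 1) / 2))%nat).
  { destruct (Nat.Even_or_Odd j) as [[q ->]|[q ->]].
    - replace (2 * q * (2 * q - 1))%nat with (q * (2 * q - 1) * 2)%nat by lia.
      rewrite Nat.div_mul; lia.
    - replace ((2 * q + 1) * (2 * q + 1 - 1))%nat with ((2 * q + 1) * q * 2)%nat by lia.
      rewrite Nat.div_mul; lia. }
  set (n := (j * (j - 1) / 2)%nat) in *.
  rewrite <- Cexp_PI, Cexp_pow. f_equal.
  assert (H' : INR (j * (j - 1)) = INR j * (INR j - 1)).
  { destruct j as [|i]; [simpl; ring|]. rewrite mult_INR, minus_INR by lia. reflexivity. }
  rewrite <- H', H, mult_INR. apply C_eq; simpl; field.
Qed.

(** Both quotients have the same constant (2l-1)^2 / (8 (4r-1)) - 1/8, hence the single power of q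
    in front. *)
Lemma gvee_eq_theta (r l : nat) (tau : C) : (1 <= r)%nat -> (1 <= l <= 2 * r - 1)%nat ->
  0 < Im tau -> gvee_double r l tau = gvee_theta r l (neg_log_q tau).
Proof.
  intros Hr Hl Htau. assert (HN := N_pos r Hr).
  assert (Hp : 0 < Re (neg_log_q tau)).
  { rewrite Re_neg_log_q. generalize PI_RGT_0. nra. }
  unfold gvee_theta. rewrite !jtheta_prod by lra.
  rewrite (jprod_entries (neg_log_q tau) (4 * INR r - 1) (2 * INR r - INR l) 0 0
    (qpow tau 1 ^ (2 * r - l)) (qpow tau 1 ^ (2 * r + l - 1)) (qpow tau 1 ^ (4 * r - 1))).
  2:{ apply (q_even _ _ _ _ 0); [ring|push_INR; ring]. }
  2:{ apply (q_even _ _ _ _ 0); [ring|push_INR; ring]. }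
  2:{ apply (q_even _ _ _ _ 0); [ring|push_INR; ring]. }
  rewrite (jprod_entries (neg_log_q tau) 4 1 0 0 (qpow tau 1) (qpow tau 1 ^ 3) (qpow tau 1 ^ 4)).
  2:{ rewrite <- (Cpow_1_r (qpow tau 1)). apply (q_even _ _ _ _ 0); [ring|push_INR; ring]. }
  2:{ apply (q_even _ _ _ _ 0); [ring|push_INR; ring]. }
  2:{ apply (q_even _ _ _ _ 0); [ring|push_INR; ring]. }
  rewrite (jprod_entries (neg_log_q tau) (4 * INR r - 1) (2 * INR r - INR l)
    (4 * INR r - 1) (2 * INR r - INR l)
    ((- qpow tau 1) ^ (2 * r - l)) ((- qpow tau 1) ^ (2 * r + l - 1)) (- qpow tau 1 ^ (4 * r - 1))).
  2:{ apply q_neg. push_INR; ring. }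
  2:{ apply q_neg. push_INR; ring. }
  2:{ apply (q_odd _ _ _ _ (2 * Z.of_nat r - 1)).
      - rewrite minus_IZR, mult_IZR, <- INR_IZR_INZ. ring.
      - push_INR; ring. }
  rewrite (jprod_entries (neg_log_q tau) 4 1 0 1 (- qpow tau 1) (- qpow tau 1 ^ 3) (qpow tau 1 ^ 4)).
  2:{ rewrite <- (Cpow_1_r (qpow tau 1)). apply (q_odd _ _ _ _ 0); [ring|push_INR; ring]. }
  2:{ apply (q_odd _ _ _ _ (-1)); [ring|push_INR; ring]. }
  2:{ apply (q_even _ _ _ _ 0); [ring|push_INR; ring]. }
  rewrite !Cexp_quot, <- sign_nat. unfold gvee_double.
  rewrite (qpow_neg_log_q tau ((2 * INR l ^ 2 - _ - _ + 1) / _)).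
  replace ((4 * INR r - 1 - 2 * (2 * INR r - INR l)) ^ 2 / (8 * (4 * INR r - 1))
           - (4 - 2 * 1) ^ 2 / (8 * 4))
    with ((2 * INR l ^ 2 - 2 * INR l - 2 * INR r + 1) / (16 * INR r - 4)) by (field; lra).
  ring.
Qed.

(** The value tau / 2 on the right is the one at which [gvee] evaluates [gvee_double]; this accounts
    for the 2 in -1/(2 tau). *)
Lemma dual_neg_log_q (tau : C) : 0 < Im tau ->
  (RtoC (PI ^ 2) * / neg_log_q (- (1) / (2 * tau)))%C = neg_log_q (tau / 2).
Proof.
  intros Htau.
  assert (Ht : tau <> 0%C) by (intros H; rewrite H in Htau; simpl in Htau; lra).
  assert (Hpi : RtoC PI <> 0%C) by (intros H; injection H; apply PI_neq0).
  assert (HCi : Ci <> 0%C) by (intros H; injection H; lra).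
  unfold neg_log_q. rewrite RtoC_pow, RtoC_mult.
  transitivity (- (RtoC PI * tau * / Ci * (- (1))))%C.
  - field. repeat split; assumption.
  - replace (/ Ci)%C with (- Ci)%C.
    + field.
    + apply C_eq; simpl; field.
Qed.

Lemma Im_inversion (tau : C) : 0 < Im tau -> 0 < Im (- (1) / (2 * tau))%C.
Proof.
  intros Htau. destruct tau as [t1 t2]; simpl in *.
  match goal with |- 0 < ?x => replace x with (t2 * / (2 * (t1 ^ 2 + t2 ^ 2))) by (field; nra) end.
  apply Rmult_lt_0_compat; [exact Htau|]. apply Rinv_0_lt_compat. nra.
Qed.

Lemma g_transform (r j : nat) (tau : C) : (1 <= r)%nat -> (1 <= j <= 2 * r - 1)%nat ->
  0 < Im tau ->
  g r j (- (1) / (2 * tau))%C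
  = csum (fun l => 2 * RtoC (s_coef r j (l + 1)) * gvee r (l + 1) tau)%C (2 * r - 1).
Proof.
  intros Hr Hj Htau. assert (Htau' := Im_inversion tau Htau).
  rewrite g_eq_theta by assumption.
  rewrite theta_transform, dual_neg_log_q; [|assumption| |exact Hr].
  - apply csum_ext. intros l Hl. f_equal. unfold gvee. symmetry. apply gvee_eq_theta; [lia|lia|].
    destruct tau as [t1 t2]; simpl in *. lra.
  - rewrite Re_neg_log_q. generalize PI_RGT_0. nra.
Qed.

(** * The matrix [S] *)

(** Telescoping: 2 sin phi cos ((2k-1) phi) = sin (2k phi) - sin ((2k-2) phi). *)
Lemma cos_odd_sum (phi : R) (M : nat) (z : C) :
  z = csum (fun k => RtoC (cos ((2 * INR (k + 1) - 1) * phi))) M ->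
  (RtoC (2 * sin phi) * z)%C = RtoC (sin (2 * INR M * phi)).
Proof.
  intros ->. induction M as [|M IH].
  - simpl. rewrite Rmult_0_r, Rmult_0_l, sin_0. ring.
  - simpl csum. rewrite Cmult_plus_distr_l, IH, <- RtoC_mult, <- RtoC_plus. f_equal.
    rewrite (S_INR M), plus_INR. change (INR 1) with 1.
    replace (2 * (INR M + 1) * phi) with (2 * INR M * phi + phi + phi) by ring.
    replace ((2 * (INR M + 1) - 1) * phi) with (2 * INR M * phi + phi) by ring.
    set (x := 2 * INR M * phi). rewrite (sin_plus (x + phi)), sin_plus, cos_plus.
    assert (H := sin2_cos2 phi). unfold Rsqr in H.
    replace (sin x) with (sin x * (sin phi * sin phi + cos phi * cos phi)) at 1 by (rewrite H; ring).
    ring.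
Qed.

(** Twice the number of terms is (4r-1) - 1, so the numerator of the closed form is sin (PI q - phi)
    and only a sign survives the division by sin phi. *)
Lemma cos_odd_sum_N (r : nat) (q : Z) : (1 <= r)%nat ->
  sin (IZR q * PI / (4 * INR r - 1)) <> 0 ->
  csum (fun k => RtoC (cos ((2 * INR (k + 1) - 1) * (IZR q * PI / (4 * INR r - 1))))) (2 * r - 1)
  = (- (RtoC (cos (PI * IZR q)) / 2))%C.
Proof.
  intros Hr Hs. assert (HN := N_pos r Hr).
  set (phi := IZR q * PI / (4 * INR r - 1)) in *.
  assert (H := cos_odd_sum phi (2 * r - 1) _ eq_refl).
  assert (E : sin (2 * INR (2 * r - 1) * phi) = - (cos (PI * IZR q) * sin phi)).
  { replace (2 * INR (2 * r - 1) * phi) with (PI * IZR q - phi).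
    - rewrite sin_minus. replace (sin (PI * IZR q)) with 0; [ring|].
      symmetry. apply sin_eq_0_1. exists q. ring.
    - rewrite minus_INR, mult_INR by lia. simpl INR. unfold phi. field. lra. }
  rewrite E in H. set (z := csum _ _) in *.
  assert (Hs' : RtoC (sin phi) <> 0%C) by (intros H0; injection H0; exact Hs).
  rewrite RtoC_opp, !RtoC_mult in H.
  replace z with (2 * RtoC (sin phi) * z / (2 * RtoC (sin phi)))%C by (field; exact Hs').
  rewrite H. field. exact Hs'.
Qed.

Lemma sin_frac_neq_0 (r : nat) (q : Z) : (1 <= r)%nat ->
  (0 < Z.abs q < 4 * Z.of_nat r - 1)%Z -> sin (IZR q * PI / (4 * INR r - 1)) <> 0.
Proof.
  intros Hr Hq. assert (HN := N_pos r Hr). assert (Hpi := PI_RGT_0).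
  assert (Hpos : forall q, (0 < q < 4 * Z.of_nat r - 1)%Z -> 0 < sin (IZR q * PI / (4 * INR r - 1))).
  { intros n [H1 H2]. apply IZR_lt in H1, H2.
    rewrite minus_IZR, mult_IZR, <- INR_IZR_INZ in H2.
    apply sin_gt_0.
    - apply Rdiv_lt_0_compat; nra.
    - apply Rmult_lt_reg_r with (4 * INR r - 1); [lra|].
      unfold Rdiv. rewrite Rmult_assoc, Rinv_l by lra. nra. }
  destruct (Z_lt_ge_dec 0 q) as [H|H].
  - apply Rgt_not_eq, Hpos. lia.
  - specialize (Hpos (- q)%Z ltac:(lia)). rewrite opp_IZR in Hpos.
    replace (- IZR q * PI / (4 * INR r - 1)) with (- (IZR q * PI / (4 * INR r - 1))) in Hpos
      by (field; lra).
    rewrite sin_neg in Hpos. lra.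
Qed.

(** Product-to-sum gives cosine sums of frequencies i - l and i + l + 1, which have opposite parity.
    For i <> l their values -1/2 and 1/2 cancel; for i = l they are 2r - 1 and 1/2, which add up to
    (4r-1)/2. *)
Lemma S_square (r i l : nat) : (1 <= r)%nat -> (i < 2 * r - 1)%nat -> (l < 2 * r - 1)%nat ->
  csum (fun k => RtoC (s_coef r (i + 1) (k + 1)) * RtoC (s_coef r (k + 1) (l + 1)))%C (2 * r - 1)
  = if Nat.eq_dec i l then (/ 2)%C else 0%C.
Proof.
  intros Hr Hi Hl. assert (HN := N_pos r Hr).
  set (F := fun q k => RtoC (cos ((2 * INR (k + 1) - 1) * (IZR q * PI / (4 * INR r - 1))))).
  rewrite (csum_ext _ (fun k => RtoC (1 / (4 * INR r - 1)) *
    (F (Z.of_nat i - Z.of_nat l)%Z k + F (Z.of_nat i + Z.of_nat l + 1)%Z k))%C).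
  2:{ intros k _. unfold F. rewrite <- !RtoC_mult, <- RtoC_plus, <- RtoC_mult. f_equal. unfold s_coef.
      set (x := (2 * INR (i + 1) - 1) * (2 * INR (k + 1) - 1) * PI / (2 * (4 * INR r - 1))).
      set (y := (2 * INR (k + 1) - 1) * (2 * INR (l + 1) - 1) * PI / (2 * (4 * INR r - 1))).
      replace ((2 * INR (k + 1) - 1) * (IZR (Z.of_nat i - Z.of_nat l) * PI / (4 * INR r - 1)))
        with (x - y).
      2:{ unfold x, y. rewrite minus_IZR, <- !INR_IZR_INZ, !plus_INR. simpl INR. field. lra. }
      replace ((2 * INR (k + 1) - 1) * (IZR (Z.of_nat i + Z.of_nat l + 1) * PI / (4 * INR r - 1)))
        with (x + y).
      2:{ unfold x, y. rewrite !plus_IZR, <- !INR_IZR_INZ, !plus_INR. simpl INR. field. lra. }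
      rewrite cos_minus, cos_plus.
      transitivity (sqrt (2 / (4 * INR r - 1)) * sqrt (2 / (4 * INR r - 1)) * (cos x * cos y)); [ring|].
      rewrite sqrt_sqrt by (apply Rlt_le, Rdiv_lt_0_compat; lra). field. lra. }
  rewrite csum_scal, csum_plus. unfold F.
  rewrite (cos_odd_sum_N r (Z.of_nat i + Z.of_nat l + 1)) by
    (try exact Hr; apply sin_frac_neq_0; lia).
  assert (Hpar : cos (PI * IZR (Z.of_nat i + Z.of_nat l + 1))
                 = - cos (PI * IZR (Z.of_nat i - Z.of_nat l))).
  { replace (PI * IZR (Z.of_nat i + Z.of_nat l + 1))
      with (PI * IZR (Z.of_nat i - Z.of_nat l) + 2 * INR l * PI + PI).
    - rewrite neg_cos, cos_period. reflexivity.
    - rewrite !plus_IZR, minus_IZR, <- !INR_IZR_INZ. ring. }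
  assert (nz : RtoC (4 * INR r - 1) <> 0%C) by (intros H; injection H; lra).
  destruct (Nat.eq_dec i l) as [->|Hil].
  - rewrite Hpar, Z.sub_diag, Rmult_0_r, cos_0.
    assert (E : forall n, csum (fun k => RtoC (cos ((2 * INR (k + 1) - 1) * (0 * PI / (4 * INR r - 1))))) n
                = RtoC (INR n)).
    { induction n as [|n IH]; [reflexivity|]. simpl csum. rewrite IH, S_INR, RtoC_plus. f_equal.
      f_equal. replace ((2 * INR (n + 1) - 1) * (0 * PI / (4 * INR r - 1))) with 0 by (field; lra).
      apply cos_0. }
    rewrite E, minus_INR, mult_INR by lia. simpl INR. apply C_eq; simpl; field; lra.
  - rewrite (cos_odd_sum_N r (Z.of_nat i - Z.of_nat l)) by
      (try exact Hr; apply sin_frac_neq_0; lia).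
    rewrite Hpar. rewrite RtoC_opp. unfold Cdiv. ring.
Qed.

(** * The second identity and the matrix form *)

Lemma sum_n_csum (f : nat -> C) (n : nat) :
  sum_n (G := C_AbelianGroup) f n = csum f (S n).
Proof.
  induction n as [|n IH].
  - rewrite sum_O. simpl. ring.
  - rewrite sum_Sn, IH. reflexivity.
Qed.

Lemma inversion_involutive (tau : C) : 0 < Im tau ->
  (- (1) / (2 * (- (1) / (2 * tau))))%C = tau.
Proof.
  intros Htau.
  assert (Ht : tau <> 0%C) by (intros H; rewrite H in Htau; simpl in Htau; lra).
  field. exact Ht.
Qed.

Lemma gvee_transform (r j : nat) (tau : C) : (1 <= r)%nat -> (j < 2 * r - 1)%nat ->
  0 < Im tau ->
  gvee r (j + 1) (- (1) / (2 * tau))%C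
  = csum (fun l => RtoC (s_coef r (j + 1) (l + 1)) * g r (l + 1) tau)%C (2 * r - 1).
Proof.
  intros Hr Hj Htau. set (tau' := (- (1) / (2 * tau))%C).
  assert (Htau' : 0 < Im tau') by apply Im_inversion, Htau.
  rewrite (csum_ext _ (fun l => csum (fun k => 2 * gvee r (k + 1) tau' *
    (* Each g (tau) is expanded by [g_transform] at tau' = -1/(2 tau), whose own inversion is tau;
       after exchanging the sums the inner one is an entry of S^2. *)
    (RtoC (s_coef r (j + 1) (l + 1)) * RtoC (s_coef r (l + 1) (k + 1))))%C (2 * r - 1))).
  2:{ intros l Hl. rewrite <- (inversion_involutive tau Htau) at 1. fold tau'.
      rewrite g_transform by (try assumption; lia). rewrite <- csum_scal. apply csum_ext.
      intros k _. ring. }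
  rewrite csum_swap.
  rewrite (csum_ext _ (fun k => 2 * gvee r (k + 1) tau' * (if Nat.eq_dec j k then / 2 else 0))%C).
  2:{ intros k Hk. rewrite csum_scal. f_equal. apply S_square; assumption. }
  rewrite (csum_single _ _ j Hj).
  - destruct (Nat.eq_dec j j); [field|contradiction].
  - intros k Hk. destruct (Nat.eq_dec j k); [subst; contradiction|ring].
Qed.

Theorem theorem5p5 (r : nat) (hr : (2 <= r)%nat) (tau : C) (htau : 0 < Im tau) :
  gvec r (- (1) / (2 * tau))%C
    = @Mmult C_Ring _ _ _ (Mscale 2%C (Smat r)) (gveevec r tau) /\
  gveevec r (- (1) / (2 * tau))%C
    = @Mmult C_Ring _ _ _ (Smat r) (gvec r tau).
Proof.
  split.
  - apply mk_matrix_ext. intros i k Hi Hk.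
    rewrite g_transform by (try assumption; lia).
    (* [Mmult] sums up to an inclusive last index, [csum] counts terms; 2r - 1 > 0 lets the
       successor cancel the predecessor. *)
    rewrite sum_n_csum. replace (S (pred (2 * r - 1))) with (2 * r - 1)%nat by lia.
    apply csum_ext. intros l Hl. unfold Mscale, Smat, gveevec.
    rewrite !coeff_mat_bij by assumption. reflexivity.
  - apply mk_matrix_ext. intros i k Hi Hk.
    rewrite gvee_transform by (try assumption; lia).
    rewrite sum_n_csum. replace (S (pred (2 * r - 1))) with (2 * r - 1)%nat by lia.
    apply csum_ext. intros l Hl. unfold Smat, gvec.
    rewrite !coeff_mat_bij by assumption. reflexivity.
Qed.
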